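(* Let $X=\mathbb{R}^{2n}/\mathbb{Z}^{2n}$ with symplectic form $\omega=\sum_{i=1}^n dy^i\wedge dx^i$, let $k\in\mathbb{N}$, $\hbar=\frac1k$, and let $Q^\hbar$ be the Toeplitz operator for the pair of polarizations $(\mathcal{P}^{\check T},\mathcal{P}^T)$ acting on $\mathcal{H}^\hbar$. For all $i\in\{1,\dots,n\}$, define $U_i^\hbar=Q_{f_i}^\hbar$ and $V_i^\hbar=Q_{g_i}^\hbar$, where $$f_i(x,y)=e^{2\pi\sqrt{-1}y^i}\quad\text{and}\quad g_i(x,y)=e^{2\pi\sqrt{-1}x^i}.$$ Then for all $i,j\in\{1,\dots,n\}$, $$U_i^\hbar\circ U_j^\hbar=U_j^\hbar\circ U_i^\hbar,\qquad V_i^\hbar\circ V_j^\hbar=V_j^\hbar\circ V_i^\hbar,\qquad U_i^\hbar\circ V_j^\hbar=e^{2\pi\sqrt{-1}\hbar\delta_{i,j}}\,V_j^\hbar\circ U_i^\hbar.$$ In particular, this gives a representation in $\mathcal{H}^\hbar$ of the quantum torus with the $2n\times2n$ matrix $(q_{ij})$ (with generators $u_i\mapsto U_i^\hbar$, $u_{n+i}\mapsto V_i^\hbar$ for $1\le i\le n$), where $q_{ij}=e^{2\pi\sqrt{-1}\hbar\delta_{i,j-n}}$ if $1\le i\le j\le2n$, and $q_{ij}=q_{ji}^{-1}$ if $1\le j<i\le2n$.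
   Context: Quantum torus. For an $N\times N$ complex matrix $q=(q_{ij})$ with $q_{ii}=1$ and $q_{ij}q_{ji}=1$ for $i\ne j$, the quantum torus is the $\mathbb{C}$-algebra generated by variables $u_1,\dots,u_N$ and their inverses subject to $u_iu_j=q_{ij}u_ju_i$ for all $i,j$. Setting. Let $n\ge 1$, $\mathbb{N}=\{1,2,\dots\}$, $T=\check T=\mathbb{R}^n/\mathbb{Z}^n$, $X=T\times\check T=\mathbb{R}^{2n}/\mathbb{Z}^{2n}$ with periodic coordinates $(x,y)$, $x,y\in\mathbb{R}^n$, and $\omega=\sum_{i=1}^n dy^i\wedge dx^i$. $\mathcal{C}^\infty(X,\mathbb{C})$ is identified with the smooth $\mathbb{Z}^{2n}$-periodic functions on $\mathbb{R}^{2n}$. $\mathcal{P}^T$ is the complex span of the $\partial_{x^i}$ and $\mathcal{P}^{\check T}$ the complex span of the $\partial_{y^i}$. For $k\in\mathbb{N}$ put $\hbar=1/k$ and $\mathbb{Z}_k^n=\mathbb{Z}^n/k\mathbb{Z}^n$; $[m]$ is the class of $m\in\mathbb{Z}^n$. Line bundle. Smooth sections of the prequantum bundle $L^{\otimes k}$ are identified with smooth $s:\mathbb{R}^{2n}\to\mathbb{C}$ satisfying $s(u+\lambda)=\alpha(\lambda)^ke^{-k\pi\sqrt{-1}\,\omega(u,\lambda)}s(u)$ for $\lambda\in\mathbb{Z}^{2n}$, where $\alpha(\lambda)=(-1)^{\sum_i\lambda_i\lambda_{n+i}}$ and $\omega(u,v)=\sum_i(u_{n+i}v_i-u_iv_{n+i})$.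 The connection is $\nabla^\hbar=d-k\pi\sqrt{-1}\sum_i(y^idx^i-x^idy^i)$, and $\langle s,t\rangle_{L^2}=\int_{[0,1]^{2n}}s\bar t\,d^nx\,d^ny$. A distributional section $s\in\Gamma^{-\infty}(X,L^{\otimes k})$ is a continuous linear functional $t\mapsto s(\bar t)=:\langle s,t\rangle$ of $\bar t$, $t$ smooth, with smooth sections embedded via $\langle\cdot,\cdot\rangle_{L^2}$; products with functions and $\nabla^\hbar$ extend by duality. Weil-Brezin transform. For smooth $s$ and $[m]\in\mathbb{Z}_k^n$ let $(s)_{[m]}(y)=\int_{[0,1]^n}\tilde s(x,y+\hbar m)e^{-2\pi\sqrt{-1}m\cdot x}d^nx$, where $\tilde s(x,y)=e^{k\pi\sqrt{-1}x\cdot y}s(x,y)$. This gives isomorphisms $\Gamma^\infty(X,L^{\otimes k})\cong\prod_{\mathbb{Z}_k^n}\mathcal{S}(\mathbb{R}^n)$ and, by extension, $\Gamma^{-\infty}(X,L^{\otimes k})\cong\prod_{\mathbb{Z}_k^n}\mathcal{S}'(\mathbb{R}^n)$, with $\langle a,b\rangle_{L^2}=\sum_{[m]}\int_{\mathbb{R}^n}(a)_{[m]}\overline{(b)_{[m]}}\,d^ny$. Quantum Hilbert spaces. $\mathcal{H}^\hbar=\{s\in\Gamma^{-\infty}(X,L^{\otimes k}):\nabla^\hbar_{\bar\xi}s=0\ \forall\xi\in\Gamma^\infty(X,\mathcal{P}^T)\}\otimes\mathbb{C}\rho$, and $\check{\mathcal{H}}^\hbar$ is defined likewise with $\mathcal{P}^{\check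 T}$ and $\check\rho$ in place of $\mathcal{P}^T$ and $\rho$. Here $\rho,\check\rho$ are the chosen half-form generators (square roots of $\bigwedge^n(-2\sqrt{-1}dy)$ and $\bigwedge^n(2dx)$), paired by $\langle\rho,\check\rho\rangle=2^{n/2}k^{-n/2}$. Bases indexed by $m\in\mathbb{Z}_k^n$ are $\sigma_\hbar^m=2^{n/4}k^{n/2}\vartheta_\hbar^m\otimes\rho$ of $\mathcal{H}^\hbar$ and $\check\sigma_\hbar^m=2^{n/4}k^{n/2}\check\vartheta_\hbar^m\otimes\check\rho$ of $\check{\mathcal{H}}^\hbar$, where the Weil-Brezin coefficients are $(\vartheta_\hbar^m)_{m'}(\varphi)=\delta_{m,m'}(2k)^{-n/2}\varphi(0)$ for $\varphi\in\mathcal{S}(\mathbb{R}^n)$, and $(\check\vartheta_\hbar^m)_{m'}$ is the constant function $\delta_{m,m'}2^{-n/2}$. Pairing and Toeplitz operator. Let $\mathrm{WF}^\hbar$, $\check{\mathrm{WF}}^\hbar$ be the unions of wavefront sets of (the section parts of) elements of $\mathcal{H}^\hbar$, $\check{\mathcal{H}}^\hbar$. They are disjoint, so by Hörmander's criterion $\langle\cdot,\cdot\rangle_{L^2}$ extends to a sesquilinear pairing (linear in the first slot) of distributional sections with wavefront set in $\mathrm{WF}^\hbar$ against those with wavefront set in $\check{\mathrm{WF}}^\hbar$; it is tensored with $\langle\rho,\check\rho\rangle$. Concretely, for smooth $f$, $\langle f\vartheta_\hbar^a,\check\vartheta_\hbar^b\rangle=\langle\vartheta_\hbar^a,\bar f\check\vartheta_\hbar^b\rangle=\sum_{c\in\mathbb{Z}_k^n}(\vartheta_\hbar^a)_c\big(\overline{(\bar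 f\check\vartheta_\hbar^b)_c}\big)$, the pairing of compactly supported distributions with smooth functions on $\mathbb{R}^n$. Then $\langle\sigma_\hbar^m,\check\sigma_\hbar^{m'}\rangle=\delta_{m,m'}$. The projection is $\Pi^\hbar s=\sum_{m\in\mathbb{Z}_k^n}\langle s,\check\sigma_\hbar^m\rangle\sigma_\hbar^m$ and the Toeplitz operator for $(\mathcal{P}^{\check T},\mathcal{P}^T)$ is $Q_f^\hbar s=\Pi^\hbar(fs)$, $f\in\mathcal{C}^\infty(X,\mathbb{C})$, $s\in\mathcal{H}^\hbar$. *)

(* Defs.v *)
From HB Require Import structures.
From mathcomp Require Import all_boot all_order all_algebra.
From mathcomp Require Import complex ring.
From mathcomp Require Import all_classical all_reals all_analysis.

Set Implicit Arguments.
Unset Strict Implicit.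
Unset Printing Implicit Defensive.

Import Order.TTheory GRing.Theory Num.Theory numFieldNormedType.Exports.

Local Open Scope classical_set_scope.
Local Open Scope ring_scope.
Local Open Scope complex_scope.

Section Calculus.
Context {R : realType}.

Definition cis (t : R) : R[i] := cos t +i* sin t.

Definition expi2pi (t : R) : R[i] := cis (2 * pi * t).

(* Iterated Lebesgue integral over D^n.  All the functions integrated below   *)
(* are continuous on a cube, Schwartz or continuous with compact support, so  *)
(* that by Fubini this is the integral for the Lebesgue measure of R^n.       *)
Fixpoint iter_int (D : set R) (n : nat) : ('rV[R]_n -> R) -> R :=
  if n is m.+1 then
    fun f => \int[lebesgue_measure]_(a in D)
               iter_int D (fun v : 'rV[R]_m => f (row_mx (a%:M : 'rV_1) v))
  else fun f => f 0.

Definition cint (D : set R) (n : nat) (f : 'rV[R]_n -> R[i]) : R[i] :=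
  iter_int D (fun v => complex.Re (f v)) +i* iter_int D (fun v => complex.Im (f v)).

Section Smooth.
Context {N : nat}.
Implicit Types (f g : 'rV[R]_N -> R) (F G : 'rV[R]_N -> R[i]) (i : 'I_N).

Definition evec i : 'rV[R]_N := delta_mx 0 i.

Fixpoint Ck (m : nat) f : Prop :=
  continuous f /\
  if m is p.+1 then
    forall i, (forall u, derivable f u (evec i)) /\
              Ck p (fun u => 'D_(evec i) f u)
  else True.

Definition smooth F : Prop :=
  forall m, Ck m (fun u => complex.Re (F u)) /\ Ck m (fun u => complex.Im (F u)).

Definition pdiff i F : 'rV[R]_N -> R[i] :=
  fun u => 'D_(evec i) (fun v => complex.Re (F v)) u
           +i* 'D_(evec i) (fun v => complex.Im (F v)) u.

Definition pdiffs (l : seq 'I_N) F : 'rV[R]_N -> R[i] := foldr pdiff F l.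

Lemma Ck_cont m f : Ck m f -> continuous f.
Proof. by case: m => [|m] []. Qed.

Lemma CkW m f : Ck m.+1 f -> Ck m f.
Proof.
elim: m f => [f [] //|m IH f [cf H]]; split => // i.
by have [d Hd] := H i; split=> //; exact: IH.
Qed.

Lemma Ck_ext m f g : f =1 g -> Ck m f -> Ck m g.
Proof. by move=> /funext ->. Qed.

Lemma Ck_cst m (c : R) : Ck m (fun=> c).
Proof.
elim: m c => [|m IH] c; split=> //; try exact: cst_continuous.
move=> i; split; first by move=> u; exact: derivable_cst.
by apply: Ck_ext (IH 0) => u; rewrite derive_cst.
Qed.

Lemma CkD m f g : Ck m f -> Ck m g -> Ck m (fun u => f u + g u).
Proof.
elim: m f g => [|m IH] f g [cf Hf] [cg Hg];
  (split; first by move=> u; exact: (cvgD (cf u) (cg u))) => // i.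
have [df Ddf] := Hf i; have [dg Ddg] := Hg i; split.
  by move=> u; exact: (derivableD (df u) (dg u)).
apply: Ck_ext (IH _ _ Ddf Ddg) => u /=.
by rewrite -(deriveD (df u) (dg u)).
Qed.

Lemma CkM m f g : Ck m f -> Ck m g -> Ck m (fun u => f u * g u).
Proof.
elim: m f g => [|m IH] f g Hf0 Hg0; case: (Hf0) => cf Hf; case: (Hg0) => cg Hg;
  (split; first by move=> u; exact: (cvgM (cf u) (cg u))) => // i.
have [df Ddf] := Hf i; have [dg Ddg] := Hg i; split.
  by move=> u; exact: (derivableM (df u) (dg u)).
apply: Ck_ext (CkD (IH _ _ (CkW Hf0) Ddg) (IH _ _ (CkW Hg0) Ddf)) => u /=.
by rewrite -[RHS]/('D_(evec i) (f * g) u) (deriveM (df u) (dg u)).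
Qed.

Lemma CkN m f : Ck m f -> Ck m (fun u => - f u).
Proof.
move=> Hf; apply: Ck_ext (CkM (Ck_cst m (-1)) Hf) => u /=.
by rewrite mulN1r.
Qed.

Lemma linear_is_derive f u v : (forall h w z, f (h *: w + z) = h * f w + f z) ->
  is_derive u v f (f v).
Proof.
move=> lf.
have H : (fun h : R => h^-1 *: ((f \o shift u) (h *: v) - f u)) @ 0^' --> f v.
  apply: cvg_near_cst.
  near=> h => /=.
  rewrite lf addrK /GRing.scale /= mulrA mulVf ?mul1r //.
  by near: h; exact: nbhs_dnbhs_neq.
split; first by apply/cvg_ex; exists (f v).
exact: cvg_lim H.
Unshelve. all: by end_near. Qed.

Lemma Ck_linear m f : continuous f ->
  (forall h w z, f (h *: w + z) = h * f w + f z) -> Ck m f.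
Proof.
move=> cf lf; case: m => [|m]; split=> // i.
have D u := linear_is_derive u (evec i) lf.
split; first by move=> u; exact: ex_derive.
by apply: Ck_ext (Ck_cst m (f (evec i))) => u; rewrite (@derive_val _ _ _ _ _ _ _ (D u)).
Qed.

Lemma Ck_coord m i : Ck m (fun u : 'rV[R]_N => u 0 i).
Proof.
apply: Ck_linear; first exact: coord_continuous.
by move=> h w z; rewrite !mxE.
Qed.

Lemma Ck_sum m (I : Type) (r : seq I) (f : I -> 'rV[R]_N -> R) :
  (forall j, Ck m (f j)) -> Ck m (fun u => \sum_(j <- r) f j u).
Proof.
move=> Hf; elim: r => [|j r IH].
  by apply: Ck_ext (Ck_cst m 0) => u; rewrite big_nil.
by apply: Ck_ext (CkD (Hf j) IH) => u; rewrite big_cons.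
Qed.

Lemma is_derive_comp1 (h : R -> R) (dh : R) f (df : R) u v :
  is_derive (f u) 1 h dh -> is_derive u v f df ->
  is_derive u v (fun w => h (f w)) (dh * df).
Proof.
move=> Hh Hf.
have lineE (g : 'rV[R]_N -> R) : (fun a : R => a^-1 *: ((g \o shift u) (a *: v) - g u)) =
   (fun a : R => a^-1 *: (((fun t : R => g (t *: v + u)) \o shift 0) (a *: 1) - (fun t : R => g (t *: v + u)) 0)).
  apply/funext => a /=.
  by rewrite addr0 scale0r add0r /GRing.scale /= mulr1.
have toline (g : 'rV[R]_N -> R) (dg : R) : is_derive u v g dg <-> is_derive (0:R) (1:R) (fun t : R => g (t *: v + u)) dg.
  have dE : derivable g u v = derivable (fun t : R => g (t *: v + u)) 0 1.
    by rewrite /derivable lineE.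
  have DE : 'D_v g u = 'D_1 (fun t : R => g (t *: v + u)) 0.
    by rewrite /derive lineE.
  by split=> -[d1 d2]; split;
    [rewrite -dE|rewrite -DE|rewrite dE|rewrite DE].
apply/toline.
have Hf1 := (toline _ _).1 Hf.
have Hh1 : is_derive ((fun t : R => f (t *: v + u)) 0) 1 h dh.
  by rewrite scale0r add0r.
exact: (@is_derive1_comp _ h (fun t : R => f (t *: v + u)) 0 dh df Hh1 Hf1).
Qed.

Lemma Ck_trig m f : Ck m f ->
  Ck m (fun u => cos (f u)) /\ Ck m (fun u => sin (f u)).
Proof.
elim: m f => [|m IH] f Hf0; case: (Hf0) => cf Hf.
  split; split=> // u;
   [apply: (continuous_comp (cf u)); exact: continuous_cos
   |apply: (continuous_comp (cf u)); exact: continuous_sin].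
have [Ic Is] := IH _ (CkW Hf0).
split; (split; first by move=> u; apply: (continuous_comp (cf u));
   (exact: continuous_cos || exact: continuous_sin)) => i;
 have [df Ddf] := Hf i.
- have D u := is_derive_comp1 (is_derive_cos (f u)) (derivableP (df u)).
  split; first by move=> u; exact: (@ex_derive _ _ _ _ _ _ _ (D u)).
  apply: Ck_ext (CkM (CkN Is) Ddf) => u /=.
  by rewrite (@derive_val _ _ _ _ _ _ _ (D u)).
- have D u := is_derive_comp1 (is_derive_sin (f u)) (derivableP (df u)).
  split; first by move=> u; exact: (@ex_derive _ _ _ _ _ _ _ (D u)).
  apply: Ck_ext (CkM Ic Ddf) => u /=.
  by rewrite (@derive_val _ _ _ _ _ _ _ (D u)).
Qed.

Lemma smooth_cst (c : R[i]) : smooth (fun=> c).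
Proof. by move=> m; split; exact: Ck_cst. Qed.

Lemma smoothD F G : smooth F -> smooth G -> smooth (fun u => F u + G u).
Proof.
move=> HF HG m; have [F1 F2] := HF m; have [G1 G2] := HG m.
by split; [apply: Ck_ext (CkD F1 G1)|apply: Ck_ext (CkD F2 G2)] => u;
  case: (F u) (G u) => [a b] [c d].
Qed.

Lemma smoothM F G : smooth F -> smooth G -> smooth (fun u => F u * G u).
Proof.
move=> HF HG m; have [F1 F2] := HF m; have [G1 G2] := HG m; split.
  apply: Ck_ext (CkD (CkM F1 G1) (CkN (CkM F2 G2))) => u.
  by case: (F u) (G u) => [a b] [c d].
apply: Ck_ext (CkD (CkM F1 G2) (CkM F2 G1)) => u.
by case: (F u) (G u) => [a b] [c d].
Qed.

Lemma smooth_conj F : smooth F -> smooth (fun u => (F u)^*).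
Proof.
move=> HF m; have [F1 F2] := HF m; split.
  by apply: Ck_ext F1 => u; case: (F u).
by apply: Ck_ext (CkN F2) => u; case: (F u).
Qed.

Lemma smooth_pdiff i F : smooth F -> smooth (pdiff i F).
Proof.
by move=> HF m; have [[_ F1] [_ F2]] := HF m.+1; split;
  [have [] := F1 i|have [] := F2 i].
Qed.

Lemma smooth_real f : (forall m, Ck m f) -> smooth (fun u => (f u)%:C).
Proof. by move=> Hf m; split; [exact: Hf|exact: Ck_cst]. Qed.

Lemma smooth_cis f : (forall m, Ck m f) -> smooth (fun u => cis (f u)).
Proof. by move=> Hf m; have [] := Ck_trig (Hf m). Qed.

Lemma smooth_derivable i F u : smooth F ->
  derivable (fun v => complex.Re (F v)) u (evec i) /\
  derivable (fun v => complex.Im (F v)) u (evec i).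
Proof.
move=> /(_ 1%N) [[_ F1] [_ F2]].
by have [H1 _] := F1 i; have [H2 _] := F2 i.
Qed.

Lemma der_mul f g u v : derivable f u v -> derivable g u v ->
  is_derive u v (fun w => f w * g w) ('D_v f u * g u + f u * 'D_v g u).
Proof.
move=> /derivableP df /derivableP dg.
have := is_deriveM df dg; rewrite /GRing.scale /= => H.
by apply: is_derive_eq H _; rewrite addrC; congr (_ + _); exact: mulrC.
Qed.

Lemma der_add f g (a b : R) u v : is_derive u v f a -> is_derive u v g b ->
  is_derive u v (fun w => f w + g w) (a + b).
Proof. exact: is_deriveD. Qed.

Lemma der_opp f (a : R) u v : is_derive u v f a ->
  is_derive u v (fun w => - f w) (- a).
Proof. exact: is_deriveN. Qed.

Lemma pdiffM i F G : smooth F -> smooth G ->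
  pdiff i (fun u => F u * G u) =
  fun u => pdiff i F u * G u + F u * pdiff i G u.
Proof.
move=> sF sG; apply/funext => u; rewrite /pdiff.
have [F1 F2] := smooth_derivable i u sF; have [G1 G2] := smooth_derivable i u sG.
have HRe : (fun v => complex.Re (F v * G v)) = (fun v =>
    complex.Re (F v) * complex.Re (G v) + - (complex.Im (F v) * complex.Im (G v))).
  by apply/funext => v; case: (F v) (G v) => [a b] [c d].
have HIm : (fun v => complex.Im (F v * G v)) = (fun v =>
    complex.Re (F v) * complex.Im (G v) + complex.Im (F v) * complex.Re (G v)).
  by apply/funext => v; case: (F v) (G v) => [a b] [c d].
rewrite HRe HIm.
have dRe := der_add (der_mul F1 G1) (der_opp (der_mul F2 G2)).
have dIm := der_add (der_mul F1 G2) (der_mul F2 G1).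
rewrite (@derive_val _ _ _ _ _ _ _ dRe) (@derive_val _ _ _ _ _ _ _ dIm).
move: ('D_(evec i) _ u) ('D_(evec i) _ u) ('D_(evec i) _ u) ('D_(evec i) _ u).
move=> g2 f2 g1 f1; case: (F u) (G u) => [a b] [c d] /=.
apply/eqP; rewrite eq_complex /=; apply/andP; split; apply/eqP; ring.
Qed.

Lemma pdiff_cst i (c : R[i]) : pdiff i (fun=> c) = fun=> 0.
Proof. by apply/funext => u; rewrite /pdiff !derive_cst. Qed.

Lemma pdiffD i F G : smooth F -> smooth G ->
  pdiff i (fun u => F u + G u) = fun u => pdiff i F u + pdiff i G u.
Proof.
move=> sF sG; apply/funext => u; rewrite /pdiff.
have [F1 F2] := smooth_derivable i u sF; have [G1 G2] := smooth_derivable i u sG.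
rewrite (_ : (fun v => complex.Re (F v + G v)) = (fun v => complex.Re (F v)) + (fun v => complex.Re (G v)));
  last by apply/funext => v; rewrite fctE; case: (F v) (G v) => [a b] [c d].
rewrite (_ : (fun v => complex.Im (F v + G v)) = (fun v => complex.Im (F v)) + (fun v => complex.Im (G v)));
  last by apply/funext => v; rewrite fctE; case: (F v) (G v) => [a b] [c d].
by rewrite (deriveD F1 G1) (deriveD F2 G2).
Qed.

Lemma derive_shift f (a u v : 'rV[R]_N) :
  'D_v (fun w => f (w + a)) u = 'D_v f (u + a).
Proof.
rewrite /derive; set g1 := fun _ => _; set g2 := fun _ => _.
by have -> : g1 = g2; rewrite // /g1 /g2; apply/funext => h /=; rewrite addrA.
Qed.

Lemma pdiff_shift i F (a : 'rV[R]_N) u :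
  pdiff i (fun v => F (v + a)) u = pdiff i F (u + a).
Proof.
rewrite /pdiff.
by rewrite (derive_shift (fun w => complex.Re (F w)))
  (derive_shift (fun w => complex.Im (F w))).
Qed.

Lemma pdiff_cis i f (c : R) u :
  is_derive u (evec i) f c ->
  pdiff i (fun v => cis (f v)) u = 'i * c%:C * cis (f u).
Proof.
move=> Hf; rewrite /pdiff /=.
rewrite (@derive_val _ _ _ _ _ _ _ (is_derive_comp1 (is_derive_cos (f u)) Hf)).
rewrite (@derive_val _ _ _ _ _ _ _ (is_derive_comp1 (is_derive_sin (f u)) Hf)).
apply/eqP; rewrite eq_complex /=; apply/andP; split; apply/eqP; ring.
Qed.

End Smooth.

Lemma cisD a b : cis (a + b) = cis a * cis b.
Proof.
apply/eqP; rewrite /cis eq_complex /= cosD sinD.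
by apply/andP; split; apply/eqP; ring.
Qed.

Lemma expi2piD a b : expi2pi (a + b) = expi2pi a * expi2pi b.
Proof. by rewrite /expi2pi mulrDr cisD. Qed.

Lemma expi2pi0 : expi2pi 0 = 1.
Proof. by rewrite /expi2pi mulr0 /cis cos0 sin0. Qed.

Lemma expi2pi_nat (m : nat) : expi2pi m%:R = 1.
Proof.
elim: m => [|m IH]; first by rewrite expi2pi0.
rewrite -addn1 natrD expi2piD IH mul1r /expi2pi mulr1 /cis mulrC mulr_natr.
by rewrite cos2pi sin2pi.
Qed.

Lemma expi2pi_int (m : int) : expi2pi m%:~R = 1.
Proof.
case: m => m; first by rewrite -pmulrn expi2pi_nat.
rewrite NegzE mulrNz -pmulrn.
by rewrite -[LHS]mul1r -{1}(expi2pi_nat m.+1) -expi2piD subrr expi2pi0.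
Qed.

End Calculus.

Section Torus.
Context {R : realType} {n : nat}.

Definition intvec (l : 'rV[int]_(n + n)) : 'rV[R]_(n + n) := map_mx intr l.

(* A point of R^(2n) is row_mx x y: x^i is the coordinate lshift n i and y^i  *)
(* is the coordinate rshift n i.                                              *)
Definition omega (u v : 'rV[R]_(n + n)) : R :=
  \sum_(i < n) (u 0 (rshift n i) * v 0 (lshift n i)
                - u 0 (lshift n i) * v 0 (rshift n i)).

Lemma omegaDl u v w : omega (u + v) w = omega u w + omega v w.
Proof.
rewrite /omega -big_split; apply: eq_bigr => i _ /=.
by rewrite !mxE; ring.
Qed.

Lemma omegaZl a u v w : omega (a *: u + v) w = a * omega u w + omega v w.
Proof.
rewrite omegaDl; congr (_ + _); rewrite /omega mulr_sumr.
by apply: eq_bigr => i _; rewrite !mxE; ring.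
Qed.

Lemma omegaC u v : omega u v = - omega v u.
Proof.
by rewrite /omega -sumrN; apply: eq_bigr => i _; ring.
Qed.

Lemma Ck_omega (w : 'rV[R]_(n + n)) (c : R) m :
  Ck m (fun u => c * omega u w).
Proof.
apply: CkM; first exact: Ck_cst.
apply: Ck_sum => i; apply: CkD.
  by apply: CkM; [exact: Ck_coord|exact: Ck_cst].
by apply: CkN; apply: CkM; [exact: Ck_coord|exact: Ck_cst].
Qed.

Lemma is_derive_omega (w : 'rV[R]_(n + n)) (c : R) u v :
  is_derive u v (fun u => c * omega u w) (c * omega v w).
Proof.
apply: (linear_is_derive (f := fun u => c * omega u w)) => h z t.
by rewrite omegaZl; ring.
Qed.

Record smoothX := SmoothX {
  smoothX_fun :> 'rV[R]_(n + n) -> R[i];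
  smoothX_smooth : smooth smoothX_fun;
  smoothX_periodic : forall u l, smoothX_fun (u + intvec l) = smoothX_fun u }.

Program Definition conjX (f : smoothX) : smoothX :=
  @SmoothX (fun u => (f u)^*) _ _.
Next Obligation. by move=> f; apply: smooth_conj; exact: smoothX_smooth. Qed.
Next Obligation. by move=> f u l /=; rewrite smoothX_periodic. Qed.

Program Definition expX (i : 'I_(n + n)) : smoothX :=
  @SmoothX (fun u => expi2pi (u 0 i)) _ _.
Next Obligation.
by move=> i; apply: smooth_cis => m; apply: CkM; [exact: Ck_cst|exact: Ck_coord].
Qed.
Next Obligation. by move=> i u l /=; rewrite !mxE expi2piD expi2pi_int mulr1. Qed.

Definition f_ (i : 'I_n) : smoothX := expX (rshift n i).
Definition g_ (i : 'I_n) : smoothX := expX (lshift n i).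

Section LineBundle.
Variable k : nat.

Definition alpha (l : 'rV[int]_(n + n)) : R[i] :=
  (-1) ^ (\sum_(i < n) l 0 (lshift n i) * l 0 (rshift n i)).

Definition quasi_periodic (s : 'rV[R]_(n + n) -> R[i]) : Prop :=
  forall u l, s (u + intvec l) =
    alpha l ^+ k * cis (- (k%:R * pi) * omega u (intvec l)) * s u.

Definition section_pred : {pred ('rV[R]_(n + n) -> R[i]^o)} :=
  fun s => `[< smooth s /\ quasi_periodic s >].

Lemma section_submod : submod_closed section_pred.
Proof.
split.
  apply/asboolP; split; first exact: smooth_cst.
  by move=> u l; rewrite mulr0.
move=> a s t /asboolP[s1 s2] /asboolP[t1 t2]; apply/asboolP; split.
  by apply: smoothD => //; apply: smoothM => //; exact: smooth_cst.
move=> u l; rewrite -[LHS]/(a * s (u + intvec l) + t (u + intvec l)).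
rewrite s2 t2; set E := _ * cis _.
by rewrite -[RHS]/(E * (a * s u + t u)); ring.
Qed.

HB.instance Definition _ :=
  GRing.isSubmodClosed.Build _ _ section_pred section_submod.

Record section := Section_ {
  section_fun :> 'rV[R]_(n + n) -> R[i]^o;
  section_in : section_fun \in section_pred }.

HB.instance Definition _ := [isSub for section_fun].
HB.instance Definition _ := [Choice of section by <:].
HB.instance Definition _ := [SubChoice_isSubLmodule of section by <:].

Lemma section_smooth (s : section) : smooth s.
Proof. by have /asboolP[] := section_in s. Qed.

Lemma section_qp (s : section) : quasi_periodic s.
Proof. by have /asboolP[] := section_in s. Qed.

Program Definition mul_section (f : smoothX) (s : section) : section :=
  @Section_ (fun u => f u * s u) _.
Next Obligation.
move=> f s; apply/asboolP; split; first by apply: smoothM; [exact: smoothX_smooth|exact: section_smooth].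
by move=> u l; rewrite smoothX_periodic section_qp mulrCA.
Qed.

(* The connection form sum_j (y^j dx^j - x^j dy^j) at u, evaluated on a       *)
(* constant vector field v, is omega u v.                                     *)
Program Definition nabla_section (i : 'I_(n + n)) (s : section) : section :=
  @Section_ (fun u => pdiff i s u
                      - (k%:R * pi * omega u (evec i))%:C * 'i * s u) _.
Next Obligation.
move=> i s; have sm := section_smooth s.
apply/asboolP; split.
  apply: smoothD; first exact: smooth_pdiff.
  have -> : (fun u => - ((k%:R * pi * omega u (evec i))%:C * 'i * s u)) =
            (fun u => (k%:R * pi * omega u (evec i))%:C * (- 'i) * s u).
    by apply/funext => u; rewrite mulrN mulNr.
  apply: smoothM => //; apply: smoothM; last exact: smooth_cst.
  by apply: smooth_real => m; exact: Ck_omega.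
move=> u l.
set c := - (k%:R * pi).
pose E := fun u => alpha l ^+ k * cis (c * omega u (intvec l)).
have sE : smooth (fun u => cis (c * omega u (intvec l))).
  by apply: smooth_cis => m; exact: Ck_omega.
have sE' : smooth E by apply: smoothM => //; exact: smooth_cst.
rewrite -pdiff_shift.
have -> : (fun v => s (v + intvec l)) = (fun v => E v * s v).
  by apply/funext => v; rewrite section_qp.
rewrite pdiffM // section_qp.
rewrite /E pdiffM //; last exact: smooth_cst.
rewrite pdiff_cst mul0r add0r.
rewrite (pdiff_cis (is_derive_omega (intvec l) c u (evec i))).
rewrite omegaDl (omegaC (intvec l)) /c.
rewrite !(rmorphD, rmorphM, rmorphN) /=.
ring.
Qed.

(* An element s of Gamma^{-oo}(X, L^k) is the functional t |-> <s, t> on      *)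
(* smooth sections; it is antilinear in t, and continuous for the C^oo        *)
(* topology, given by the sup norms of the partial derivatives on [0,1]^(2n). *)
Definition functional : Type := section -> R[i]^o.

Definition antilinear (s : functional) : Prop :=
  forall (a : R[i]) (t1 t2 : section), s (a *: t1 + t2) = a^* * s t1 + s t2.

Definition Coo_continuous (s : functional) : Prop :=
  exists (C : R) (N : nat), forall (t : section) (B : R),
    (forall (l : seq 'I_(n + n)) (u : 'rV[R]_(n + n)), (size l <= N)%N ->
      (forall i, 0 <= u 0 i <= 1) -> `|pdiffs l t u| <= B%:C) ->
    `|s t| <= (C * B)%:C.

Definition distributional (s : functional) : Prop :=
  antilinear s /\ Coo_continuous s.

Definition mul_dist (f : smoothX) (s : functional) : functional :=
  fun t => s (mul_section (conjX f) t).

(* Sign: nabla is Hermitian, hence <nabla s, t> = - <s, nabla t>.             *)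
Definition nabla_dist (i : 'I_(n + n)) (s : functional) : functional :=
  fun t => - s (nabla_section i t).

(* Derivative along the conjugate of xi = sum_j (xi j) d/dx^j, a section of   *)
(* P^T.                                                                       *)
Definition nabla_bar (xi : 'I_n -> smoothX) (s : functional) : functional :=
  \sum_(j < n) mul_dist (conjX (xi j)) (nabla_dist (lshift n j) s).

Definition hilb_pred : {pred functional} :=
  fun s => `[< distributional s /\ forall xi, nabla_bar xi s = 0 >].

Lemma nabla_barP xi a s1 s2 :
  nabla_bar xi (a *: s1 + s2) = a *: nabla_bar xi s1 + nabla_bar xi s2.
Proof.
rewrite /nabla_bar scaler_sumr -big_split; apply: eq_bigr => j _ /=.
apply/funext => t; rewrite /mul_dist /nabla_dist !fctE opprD.
by congr (_ + _); rewrite scalerN.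
Qed.

Lemma hilb_submod : submod_closed hilb_pred.
Proof.
split.
  apply/asboolP; split; last first.
    by move=> xi; have := nabla_barP xi (-1) 0 0; rewrite scaler0 addr0 scaleN1r addNr.
  split; first by move=> a t1 t2; rewrite mulr0 addr0.
  exists 0, 0%N => t B _; by rewrite normr0 mul0r.
move=> a s1 s2 /asboolP[[al1 [C1 [N1 c1]]] d1] /asboolP[[al2 [C2 [N2 c2]]] d2].
apply/asboolP; split; last by move=> xi; rewrite nabla_barP d1 d2 scaler0 addr0.
split.
  move=> b t1 t2; rewrite !fctE al1 al2 /GRing.scale /=; ring.
exists (complex.Re `|a| * C1 + C2), (maxn N1 N2) => t B HB.
have H1 := c1 t B (fun l u hl => HB l u (leq_trans hl (leq_maxl _ _))).
have H2 := c2 t B (fun l u hl => HB l u (leq_trans hl (leq_maxr _ _))).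
rewrite !fctE; apply: (le_trans (ler_normD _ _)).
rewrite mulrDl rmorphD; apply: lerD => //.
rewrite -mulrA rmorphM normrM; apply: ler_pM => //.
Qed.

HB.instance Definition _ :=
  GRing.isSubmodClosed.Build _ _ hilb_pred hilb_submod.

(* The factor C rho of the quantum Hilbert space is a line: s (x) rho is      *)
(* represented by its section part s.                                         *)
Record hilb := Hilb {
  hilb_val :> functional;
  hilb_in : hilb_val \in hilb_pred }.

HB.instance Definition _ := [isSub for hilb_val].
HB.instance Definition _ := [Choice of hilb by <:].
HB.instance Definition _ := [SubChoice_isSubLmodule of hilb by <:].

(* Z^n / k Z^n, each class being given by its representative in {0..k-1}^n.   *)
Definition Zk := {ffun 'I_n -> 'I_k}.

Definition repr_Zk (m : Zk) : 'rV[R]_n := \row_i (m i)%:R.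

Definition dot (x y : 'rV[R]_n) : R := \sum_(i < n) x 0 i * y 0 i.

Definition weil_brezin (s : section) (m : Zk) (y : 'rV[R]_n) : R[i] :=
  let tilde x y := cis (k%:R * pi * dot x y) * s (row_mx x y) in
  cint `[0, 1] (fun x => tilde x (y + k%:R^-1 *: repr_Zk m)
                         * expi2pi (- dot (repr_Zk m) x)).

(* Inverse of the isomorphism between smooth sections and families of         *)
(* Schwartz functions (0 on the families outside its range).                  *)
Definition weil_brezin_inv (phi : Zk -> 'rV[R]_n -> R[i]) : section :=
  xget 0 [set t | weil_brezin t = phi].

(* Extension to distributions: the functional on S(R^n)^(Z_k^n) and the one   *)
(* on sections are related by <s, t> = sum_m (s)_m (conj (t)_m).              *)
Definition of_coefs (a : Zk -> ('rV[R]_n -> R[i]) -> R[i]) : functional :=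
  fun t => \sum_(m : Zk) a m (fun y => (weil_brezin t m y)^*).

Definition coef (s : functional) (m : Zk) (phi : 'rV[R]_n -> R[i]) : R[i] :=
  s (weil_brezin_inv (fun m' y => (m' == m)%:R * (phi y)^*)).

Definition theta (m : Zk) : functional :=
  of_coefs (fun m' phi =>
    (m == m')%:R * ((2 * k%:R) `^ (- (n%:R / 2)))%:C * phi 0).

Definition thetav (m : Zk) : functional :=
  of_coefs (fun m' phi =>
    cint setT (fun y => (m == m')%:R * (2 `^ (- (n%:R / 2)))%:C * phi y)).

Definition sigma (m : Zk) : functional :=
  (2 `^ (n%:R / 4) * k%:R `^ (n%:R / 2))%:C *: theta m.

Definition sigmav (m : Zk) : functional :=
  (2 `^ (n%:R / 4) * k%:R `^ (n%:R / 2))%:C *: thetav m.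

Definition half_form_pairing : R[i] :=
  (2 `^ (n%:R / 2) * k%:R `^ (- (n%:R / 2)))%:C.

Definition tsupp (phi : 'rV[R]_n -> R[i]) : set 'rV[R]_n :=
  closure [set y | phi y != 0].

Definition test_function (phi : 'rV[R]_n -> R[i]) : Prop :=
  smooth phi /\ compact (tsupp phi).

Definition dist_supp (a : ('rV[R]_n -> R[i]) -> R[i]) : set 'rV[R]_n :=
  ~` [set y | exists U, [/\ open U, U y &
        forall phi, test_function phi -> tsupp phi `<=` U -> a phi = 0]].

(* Pairing of a compactly supported distribution a with a smooth function h:  *)
(* a (chi * h), for any test function chi equal to 1 near the support of a.   *)
Definition cutoff (a : ('rV[R]_n -> R[i]) -> R[i]) : 'rV[R]_n -> R[i] :=
  xget (fun=> 0) [set chi | test_function chi /\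
    exists U, [/\ open U, dist_supp a `<=` U & forall y, U y -> chi y = 1]].

Definition cs_pairing (a : ('rV[R]_n -> R[i]) -> R[i]) (h : 'rV[R]_n -> R[i]) :
  R[i] := a (fun y => cutoff a y * h y).

(* The smooth function representing the distribution (s)_m (0 if none does).  *)
Definition smooth_coef (s : functional) (m : Zk) : 'rV[R]_n -> R[i] :=
  xget (fun=> 0) [set h | smooth h /\ forall phi, test_function phi ->
    coef s m phi = cint setT (fun y => h y * phi y)].

(* The extension of the L^2 pairing to s with compactly supported and t with  *)
(* smooth Weil-Brezin coefficients, linear in s and antilinear in t.          *)
Definition pairing (s t : functional) : R[i] :=
  \sum_(m : Zk) cs_pairing (coef s m) (fun y => (smooth_coef t m y)^*).

(* <f s, t> = <s, conj(f) t>.  The coefficients of f s need not be compactly  *)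
(* supported, but if s is covariantly constant along P^T its coefficients are *)
(* supported at 0, and those of conj(f) t are smooth for t in the span of the *)
(* [sigmav m].                                                                *)
Definition pairing_mul (f : smoothX) (s t : functional) : R[i] :=
  pairing s (mul_dist (conjX f) t).

Definition toeplitz (f : smoothX) (s : functional) : functional :=
  \sum_(m : Zk) (half_form_pairing * pairing_mul f s (sigmav m)) *: sigma m.

End LineBundle.
End Torus.

Arguments smoothX : clear implicits.
Arguments section : clear implicits.
Arguments functional : clear implicits.
Arguments hilb : clear implicits.
Arguments half_form_pairing : clear implicits.

Section QuantumTorus.
Context {F : fieldType} {N : nat}.
Variable q : 'M[F]_N.

(* Words of the unital F-algebra generated by the u_i and their inverses, and *)
(* the congruence generated by the algebra axioms and the defining relations. *)
Inductive qterm : Type :=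
| QCst of F
| QGen of 'I_N
| QInv of 'I_N
| QAdd of qterm & qterm
| QMul of qterm & qterm.

Inductive qcong : qterm -> qterm -> Prop :=
| qrefl x : qcong x x
| qsym x y : qcong x y -> qcong y x
| qtrans y x z : qcong x y -> qcong y z -> qcong x z
| qcongD x x' y y' : qcong x x' -> qcong y y' -> qcong (QAdd x y) (QAdd x' y')
| qcongM x x' y y' : qcong x x' -> qcong y y' -> qcong (QMul x y) (QMul x' y')
| qaddA x y z : qcong (QAdd x (QAdd y z)) (QAdd (QAdd x y) z)
| qaddC x y : qcong (QAdd x y) (QAdd y x)
| qadd0 x : qcong (QAdd (QCst 0) x) x
| qaddN x : qcong (QAdd (QMul (QCst (-1)) x) x) (QCst 0)
| qmulA x y z : qcong (QMul x (QMul y z)) (QMul (QMul x y) z)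
| qmul1l x : qcong (QMul (QCst 1) x) x
| qmul1r x : qcong (QMul x (QCst 1)) x
| qmulDl x y z : qcong (QMul (QAdd x y) z) (QAdd (QMul x z) (QMul y z))
| qmulDr x y z : qcong (QMul x (QAdd y z)) (QAdd (QMul x y) (QMul x z))
| qcstD a b : qcong (QCst (a + b)) (QAdd (QCst a) (QCst b))
| qcstM a b : qcong (QCst (a * b)) (QMul (QCst a) (QCst b))
| qcstC a x : qcong (QMul (QCst a) x) (QMul x (QCst a))
| qgenK i : qcong (QMul (QGen i) (QInv i)) (QCst 1)
| qgenVK i : qcong (QMul (QInv i) (QGen i)) (QCst 1)
| qgenC i j : qcong (QMul (QGen i) (QGen j))
                    (QMul (QCst (q i j)) (QMul (QGen j) (QGen i))).

HB.instance Definition _ := gen_eqMixin qterm.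
HB.instance Definition _ := gen_choiceMixin qterm.

Definition qeq (x y : qterm) : bool := `[< qcong x y >].

Lemma qeq_refl : reflexive qeq.
Proof. by move=> x; apply/asboolP; exact: qrefl. Qed.

Lemma qeq_sym : symmetric qeq.
Proof. by move=> x y; apply/asboolP/asboolP; exact: qsym. Qed.

Lemma qeq_trans : transitive qeq.
Proof.
by move=> y x z /asboolP xy /asboolP yz; apply/asboolP; exact: qtrans xy yz.
Qed.

Canonical qeq_equiv := EquivRel qeq qeq_refl qeq_sym qeq_trans.

Definition qtorus := {eq_quot qeq}%qT.

HB.instance Definition _ := Choice.on qtorus.

Definition qclass (x : qterm) : qtorus := (\pi_qtorus x)%qT.

Lemma qclassP x y : qcong x y <-> qclass x = qclass y.
Proof.
split=> [xy|/eqquotP /asboolP //].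
by apply/eqquotP/asboolP.
Qed.

Lemma qreprK x : qclass (repr x) = x.
Proof. exact: reprK. Qed.

Definition qadd (x y : qtorus) := qclass (QAdd (repr x) (repr y)).
Definition qopp (x : qtorus) := qclass (QMul (QCst (-1)) (repr x)).
Definition qmul (x y : qtorus) := qclass (QMul (repr x) (repr y)).
Definition qscale (a : F) (x : qtorus) := qclass (QMul (QCst a) (repr x)).

Lemma repr_qclass x : qcong (repr (qclass x)) x.
Proof. by apply/qclassP; rewrite qreprK. Qed.

Lemma qaddE x y : qadd (qclass x) (qclass y) = qclass (QAdd x y).
Proof. by apply/qclassP; apply: qcongD; exact: repr_qclass. Qed.

Lemma qmulE x y : qmul (qclass x) (qclass y) = qclass (QMul x y).
Proof. by apply/qclassP; apply: qcongM; exact: repr_qclass. Qed.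

Lemma qscaleE a x : qscale a (qclass x) = qclass (QMul (QCst a) x).
Proof. by apply/qclassP; apply: qcongM; [exact: qrefl|exact: repr_qclass]. Qed.

Lemma qoppE x : qopp (qclass x) = qclass (QMul (QCst (-1)) x).
Proof. exact: qscaleE. Qed.

Let qE := (qaddE, qmulE, qscaleE, qoppE).

Lemma qtorus_ind (P : qtorus -> Prop) :
  (forall x, P (qclass x)) -> forall x, P x.
Proof. by move=> H x; rewrite -[x]qreprK. Qed.

Fact qaddA_ax : associative qadd.
Proof.
elim/qtorus_ind => x; elim/qtorus_ind => y; elim/qtorus_ind => z.
by rewrite !qE; apply/qclassP; exact: qaddA.
Qed.

Fact qaddC_ax : commutative qadd.
Proof.
elim/qtorus_ind => x; elim/qtorus_ind => y.
by rewrite !qE; apply/qclassP; exact: qaddC.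
Qed.

Fact qadd0_ax : left_id (qclass (QCst 0)) qadd.
Proof. by elim/qtorus_ind => x; rewrite !qE; apply/qclassP; exact: qadd0. Qed.

Fact qaddN_ax : left_inverse (qclass (QCst 0)) qopp qadd.
Proof. by elim/qtorus_ind => x; rewrite !qE; apply/qclassP; exact: qaddN. Qed.

HB.instance Definition _ := GRing.isZmodule.Build qtorus
  qaddA_ax qaddC_ax qadd0_ax qaddN_ax.

Lemma qclassD x y : qclass x + qclass y = qclass (QAdd x y).
Proof. exact: qaddE. Qed.

Fact qmulA_ax : associative qmul.
Proof.
elim/qtorus_ind => x; elim/qtorus_ind => y; elim/qtorus_ind => z.
by rewrite !qE; apply/qclassP; exact: qmulA.
Qed.

Fact qmul1l_ax : left_id (qclass (QCst 1)) qmul.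
Proof. by elim/qtorus_ind => x; rewrite !qE; apply/qclassP; exact: qmul1l. Qed.

Fact qmul1r_ax : right_id (qclass (QCst 1)) qmul.
Proof. by elim/qtorus_ind => x; rewrite !qE; apply/qclassP; exact: qmul1r. Qed.

Fact qmulDl_ax : left_distributive qmul +%R.
Proof.
elim/qtorus_ind => x; elim/qtorus_ind => y; elim/qtorus_ind => z.
by rewrite !(qclassD, qE); apply/qclassP; exact: qmulDl.
Qed.

Fact qmulDr_ax : right_distributive qmul +%R.
Proof.
elim/qtorus_ind => x; elim/qtorus_ind => y; elim/qtorus_ind => z.
by rewrite !(qclassD, qE); apply/qclassP; exact: qmulDr.
Qed.

HB.instance Definition _ := GRing.Zmodule_isPzRing.Build qtorus
  qmulA_ax qmul1l_ax qmul1r_ax qmulDl_ax qmulDr_ax.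

Fact qscaleA_ax a b (x : qtorus) : qscale a (qscale b x) = qscale (a * b) x.
Proof.
elim/qtorus_ind: x => x; rewrite !qE; apply/qclassP; apply: qtrans (qmulA _ _ _) _.
by apply: qcongM; [apply: qsym; exact: qcstM|exact: qrefl].
Qed.

Fact qscale1_ax : left_id 1 qscale.
Proof. by elim/qtorus_ind => x; rewrite !qE; apply/qclassP; exact: qmul1l. Qed.

Fact qscaleDr_ax : right_distributive qscale +%R.
Proof.
move=> a; elim/qtorus_ind => x; elim/qtorus_ind => y.
by rewrite !(qclassD, qE); apply/qclassP; exact: qmulDr.
Qed.

Fact qscaleDl_ax (x : qtorus) : {morph qscale^~ x : a b / a + b}.
Proof.
move=> a b; elim/qtorus_ind: x => x.
rewrite !(qclassD, qE); apply/qclassP; apply: qtrans (qmulDl _ _ _).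
by apply: qcongM; [exact: qcstD|exact: qrefl].
Qed.

HB.instance Definition _ := GRing.Zmodule_isLmodule.Build F qtorus
  qscaleA_ax qscale1_ax qscaleDr_ax qscaleDl_ax.

Lemma qclassM x y : qclass x * qclass y = qclass (QMul x y).
Proof. exact: qmulE. Qed.

Lemma qclassZ a x : a *: qclass x = qclass (QMul (QCst a) x).
Proof. exact: qscaleE. Qed.

(* [qtorus] is an F-algebra; it is not declared as an algType, which requires *)
(* 1 != 0, because q is arbitrary here.                                       *)
Lemma qtorus_scalerAl (a : F) (x y : qtorus) : a *: (x * y) = (a *: x) * y.
Proof.
elim/qtorus_ind: x => x; elim/qtorus_ind: y => y.
by rewrite (qclassM x y) !qclassZ qclassM; apply/qclassP; exact: qmulA.
Qed.

Lemma qtorus_scalerAr (a : F) (x y : qtorus) : a *: (x * y) = x * (a *: y).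
Proof.
elim/qtorus_ind: x => x; elim/qtorus_ind: y => y.
rewrite (qclassM x y) !qclassZ qclassM; apply/qclassP.
apply: qtrans (qmulA _ _ _) _; apply: qtrans (qsym (qmulA _ _ _)).
by apply: qcongM; [exact: qcstC|exact: qrefl].
Qed.

Definition qgen (i : 'I_N) : qtorus := qclass (QGen i).
Definition qgenV (i : 'I_N) : qtorus := qclass (QInv i).

Definition qtorus_matrix : Prop :=
  (forall i, q i i = 1) /\ (forall i j, i != j -> q i j * q j i = 1).

Record representation (V : lmodType F) (rho : qtorus -> V -> V) : Prop := {
  repr_linear : forall x, linear (rho x);
  repr_add : forall x y v, rho (x + y) v = rho x v + rho y v;
  repr_scale : forall a x v, rho (a *: x) v = a *: rho x v;
  repr_one : forall v, rho 1 v = v;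
  repr_mul : forall x y v, rho (x * y) v = rho x (rho y v) }.

End QuantumTorus.

Arguments qtorus {F N} q.

Section Operators.
Context {R : realType} {n : nat}.

Definition U_ (k : nat) (i : 'I_n) : functional R n k -> functional R n k :=
  toeplitz (f_ i).

Definition V_ (k : nat) (i : 'I_n) : functional R n k -> functional R n k :=
  toeplitz (g_ i).

(* With indices 0, ..., 2n-1: exp(2 pi sqrt(-1) hbar delta_(i, j-n)) if       *)
(* i <= j, the inverse of the (j,i) entry otherwise.                          *)
Definition qmatrix (k : nat) : 'M[R[i]]_(n + n) :=
  let e (i j : 'I_(n + n)) := expi2pi (k%:R^-1 * (i + n == j)%N%:R) in
  \matrix_(i, j) (if (i <= j)%N then e i j else (e j i)^-1).

End Operators.

(* Main.v *)
Require Import Defs.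
From HB Require Import structures.
From mathcomp Require Import all_boot all_order all_algebra.
From mathcomp Require Import complex ring lra zify.
From mathcomp Require Import all_classical all_reals all_analysis.
Set Implicit Arguments.
Unset Strict Implicit.
Unset Printing Implicit Defensive.
Import Order.TTheory GRing.Theory Num.Theory numFieldNormedType.Exports.
Local Open Scope classical_set_scope.
Local Open Scope ring_scope.
Local Open Scope complex_scope.

(** Write e(t) for exp(2 pi sqrt(-1) t).  In the basis of the sigma^m the
    operators U_i and V_i are the clock and shift operators: U_i multiplies
    sigma^m by e(m_i / k), and V_i sends the element with coordinates c_m to the
    one with coordinates c_(m - e_i) ([toeplitz_f], [toeplitz_g]).  The
    commutation relations are read off these formulas; as U_i^k and V_i^k are
    the identity, both operators are invertible, and the universal property of
    the quantum torus turns the relations into a representation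
    ([representation_qrep]).  Two facts remain: these formulas, and that the
    sigma^m span the quantum Hilbert space.

    The formulas.  The Weil-Brezin coefficients of a combination of the sigma^m
    are multiples of the Dirac distribution at 0.  Their pairing with a smooth
    function is therefore its value at 0 times a constant, whatever the cutoff
    used to define it ([cs_pairing_delta]).  The smooth functions in question
    are the coefficients of conj(f) times the dual basis vectors.  They are
    determined by their integrals against test functions ([smooth_eq_test]), and
    are computed by moving f onto the test section, where multiplication by
    e(y^i) multiplies the m-th coefficient by e(y^i + m_i / k)
    ([weil_brezin_f]) and multiplication by e(x^i) moves the index m by e_i and
    translates the argument ([weil_brezin_g]).  The values at 0 are e(m_i / k)
    and 1, and the normalizations of the two bases cancel against the half-form
    pairing ([half_form_scale]).

    Spanning.  Let s be annihilated by the covariant derivatives along the x_j.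
    After multiplication by exp(- k pi sqrt(-1) x.y), sections become smooth
    functions w with w(x + e_j, y) = e(- k y_j) w(x, y), periodic in y, and the
    covariant derivative along x_j becomes the partial derivative
    ([wform_nabla]).  Such a w has a primitive of the same kind along x_j as
    soon as its integrals over the x_j-circles vanish when y_j is in (1/k)Z
    ([primitive_exists]): to the integral of w from x_j = 0 one adds a function
    of the other variables, the integral over the circle divided by
    e(- k y_j) - 1, which is smooth by Hadamard's lemma ([Ck_div_sin]).  Modulo
    derivatives along x_j, w is therefore equal to a combination, given by
    finitely many circle integrals, of k fixed functions of (x_j, y_j)
    ([Rop_step], [local_basis]).  Doing this for all j shows that s is
    determined by the integrals of w over x at the points y = m / k.  These are
    the values at 0 of the Weil-Brezin coefficients, on which sigma^m is a
    multiple of the m-th coordinate ([killed_by_nablaE], [hilb_delta_sum]).  The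
    k fixed functions, and the test sections with one prescribed Weil-Brezin
    coefficient, are sums over the lattice ([weil_brezin_lat],
    [local_basis_exists]). *)

(** * Integrals over a segment *)

Lemma continuous_slice (P Q T : topologicalType) (F : P -> Q -> T) (p : P) :
  continuous (fun z : P * Q => F z.1 z.2) -> continuous (F p).
Proof.
move=> cF x A /(cF (p, x)) [[B C] /= [nB nC] sBC].
by apply: filterS nC => y Cy; apply: (sBC (p, y)); split => //=; exact: nbhs_singleton.
Qed.

Section IntervalIntegral.
Context {R : realType}.
Notation mu := (@lebesgue_measure R).
Implicit Types (f g : R -> R) (a b : R).

Lemma itv_integrable f a b : continuous f -> mu.-integrable `[a, b] (EFin \o f).
Proof.
move=> cf; apply: continuous_compact_integrable; first exact: segment_compact.
exact: continuous_subspaceT.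
Qed.

Lemma itv_int_lin f g a b c : continuous f -> continuous g ->
  \int[mu]_(x in `[a, b]) (c * f x + g x) =
  c * \int[mu]_(x in `[a, b]) f x + \int[mu]_(x in `[a, b]) g x.
Proof.
move=> cf cg; rewrite RintegralD ?RintegralZl//; try exact: itv_integrable.
by apply: itv_integrable => x; apply: cvgM; [exact: cvg_cst|exact: cf].
Qed.

Lemma itv_int_cst a b c : a <= b -> \int[mu]_(x in `[a, b]) c = c * (b - a).
Proof.
move=> ab; rewrite Rintegral_cst ?measurable_itv//.
congr (_ * _); transitivity (fine (@lebesgue_measure R [set` `[a, b]])); first by [].
rewrite lebesgue_measure_itv /= lte_fin; case: ltgtP ab => // -> _.
by rewrite subrr.
Qed.

Lemma itv_int_norm f a b M : a <= b -> continuous f ->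
  (forall x, a <= x <= b -> `|f x| <= M) ->
  `|\int[mu]_(x in `[a, b]) f x| <= M * (b - a).
Proof.
move=> ab cf fM.
have cnf : continuous (fun x => `|f x|).
  by move=> x; apply: cvg_norm; exact: cf.
apply: (le_trans (le_normr_Rintegral _ _)) => //; first exact: itv_integrable.
rewrite -(itv_int_cst M ab); apply: le_Rintegral => //.
- by apply: itv_integrable.
- by apply: itv_integrable => x; exact: cvg_cst.
Qed.

(** Continuity in the parameter is uniform over the segment, which is compact. *)
Lemma itv_int_continuous (P : topologicalType) (F : P -> R -> R) a b : a <= b ->
  continuous (fun z : P * R => F z.1 z.2) ->
  continuous (fun p => \int[mu]_(x in `[a, b]) F p x : R).
Proof.
move=> ab cF p0.
have cFp p : continuous (F p).
  exact: continuous_slice.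
apply/cvgrPdist_le => e e0.
have e1 : 0 < e / (b - a + 1) by apply: divr_gt0 => //; lra.
have /(_ P (nbhs p0) (fun p x => `|F p0 x - F p x| <= e / (b - a + 1))) H := (compact_near_coveringP `[a, b]).1 (@segment_compact _ a b).
have : \forall p \near nbhs p0, `[a, b] `<=` (fun x => `|F p0 x - F p x| <= e / (b - a + 1)).
  apply: H => x _.
  have e2 : 0 < e / (b - a + 1) / 2 by apply: divr_gt0.
  have /cvgrPdist_le/(_ _ e2) H1 : F p0 x' @[x' --> x] --> F p0 x by exact: cFp.
  have /cvgrPdist_le/(_ _ e2) H2 : (F z.1 z.2) @[z --> (p0, x)] --> F p0 x by exact: (cF (p0, x)).
  case: H2 => -[A B] /= [nA nB] sAB.
  exists (B `&` [set y | `|F p0 x - F p0 y| <= e / (b - a + 1) / 2], A).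
    by split => //; exact: filterI.
  case=> x' p [/= [Bx h1] Ap]; have /= h2 := sAB (p, x') (conj Ap Bx).
  have -> : F p0 x' - F p x' = - (F p0 x - F p0 x') + (F p0 x - F p x') by ring.
  apply: (le_trans (ler_normD _ _)); rewrite normrN; lra.
apply: filterS => p Hp.
have -> : \int[mu]_(x in `[a, b]) F p0 x - \int[mu]_(x in `[a, b]) F p x =
          \int[mu]_(x in `[a, b]) (-1 * F p x + F p0 x).
  by rewrite itv_int_lin//; ring.
apply: le_trans (itv_int_norm (M := e / (b - a + 1)) ab _ _) _.
- move=> x; apply: cvgD; last exact: cFp.
  by apply: cvgM; [exact: cvg_cst|exact: cFp].
- by move=> x xab; rewrite mulN1r addrC; apply: Hp; rewrite /= in_itv.
- rewrite -mulrA ler_piMr ?(ltW e0)// mulrC ler_pdivrMr; lra.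
Qed.

(** The derivative f' is bounded on a compact neighbourhood, so that a constant
    dominates it and one may differentiate under the integral sign. *)
Lemma itv_int_derive (f f' : R -> R -> R) a b (h0 : R) : a <= b ->
  continuous (fun z : R * R => f z.1 z.2) ->
  continuous (fun z : R * R => f' z.1 z.2) ->
  (forall h x : R, is_derive h 1 (f ^~ x) (f' h x)) ->
  is_derive h0 1 (fun h => \int[mu]_(x in `[a, b]) f h x)
    (\int[mu]_(x in `[a, b]) f' h0 x).
Proof.
move=> ab cf cf' df.
have sl (g : R -> R -> R) : continuous (fun z : R * R => g z.1 z.2) -> forall h, continuous (g h).
  by move=> cg h; exact: continuous_slice.
have d1 h x : partial1of2 f h x = f' h x.
  by rewrite partial1of2E; exact: (@derive_val _ _ _ _ _ _ _ (df h x)).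
have cK : compact (`[h0 - 1, h0 + 1] `*` `[a, b]).
  by apply: compact_setX; exact: segment_compact.
have cf'K : {within `[h0 - 1, h0 + 1] `*` `[a, b], continuous (fun z : R * R => f' z.1 z.2 : R^o)}.
  by apply: continuous_subspaceT.
have /compact_bounded[M [Mr HM]] := continuous_compact cf'K cK.
have {HM} := HM (M + 1); rewrite ltrDl => /(_ ltr01) HM.
pose M' : R := Num.max 0 (M + 1).
pose G : R -> R := cst M'.
have I0 : [set` `]h0 - 1, h0 + 1[] h0 by rewrite /= in_itv /=; lra.
have i_f h : [set` `]h0 - 1, h0 + 1[] h -> mu.-integrable `[a, b] (EFin \o f h).
  by move=> _; apply: itv_integrable; exact: sl.
have d_f h x : [set` `]h0 - 1, h0 + 1[] h -> [set` `[a, b]] x -> derivable (f ^~ x) h 1.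
  by move=> _ _; exact: (@ex_derive _ _ _ _ _ _ _ (df h x)).
have G0 y : 0 <= G y by rewrite /G /M' /cst le_max lexx.
have iG : mu.-integrable `[a, b] (EFin \o G).
  by apply: itv_integrable => x; exact: cvg_cst.
have uG h x : [set` `]h0 - 1, h0 + 1[] h -> [set` `[a, b]] x -> `|partial1of2 f h x| <= G x.
  move=> Ih Ix; rewrite d1 /G /M' /cst le_max; apply/orP; right; apply: HM.
  exists (h, x) => //; split=> //=.
  by move: Ih; rewrite /= !in_itv /= => /andP[/ltW -> /ltW ->].
split.
  exact: (@derivable_under_integral R _ _ mu f `[a, b] (measurable_itv _) h0 _ _ I0 i_f d_f G G0 iG uG).
have := @differentiation_under_integral R _ _ mu f `[a, b] (measurable_itv _) h0 _ _ I0 i_f d_f G G0 iG uG.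
by rewrite derive1E => ->; apply: eq_Rintegral => x _; exact: d1.
Qed.

(** A positive value propagates to a small segment by continuity. *)
Lemma itv_int_gt0 f a b (x0 : R) : a < x0 < b -> continuous f -> (forall x, 0 <= f x) ->
  0 < f x0 -> 0 < \int[mu]_(x in `[a, b]) f x.
Proof.
move=> /andP[ax xb] cf f0 fx0.
have f2 : f x0 / 2 < f x0 by rewrite ltr_pdivrMr// ltr_pMr// ltr1n.
have H : \forall x \near x0, (f x0 / 2 <= f x) /\ a <= x <= b.
  near=> x; split; first by near: x; apply: (cvgr_ge _ (cf x0)).
  apply/andP; split; near: x.
  - by apply: (cvgr_ge (f := id) x0).
  - by apply: (cvgr_le (f := id) x0).
case/nbhs_ballP: H => e /= e0 He.
have He' y : [set` `[x0, x0 + e / 2]] y -> (f x0 / 2 <= f y) /\ a <= y <= b.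
  rewrite /= in_itv /= => /andP[y1 y2]; apply: He; rewrite /ball /=.
  by rewrite ler0_norm ?opprB; lra.
have sub : [set` `[x0, x0 + e / 2]] `<=` [set` `[a, b]].
  by move=> y /He' [_]; rewrite /= in_itv.
have fi : mu.-integrable `[a, b] (EFin \o f) by exact: itv_integrable.
apply: (@lt_le_trans _ _ (\int[mu]_(x in `[x0, x0 + e / 2]) f x)); last first.
  rewrite /Rintegral fine_le//.
  - by apply: integrable_fin_num => //; apply: integrableS fi.
  - by apply: integrable_fin_num.
  - apply: ge0_subset_integral => //; last by move=> y _; rewrite lee_fin.
    by case/integrableP: fi.
apply: (@lt_le_trans _ _ (\int[mu]_(x in `[x0, x0 + e / 2]) (f x0 / 2))).
  rewrite itv_int_cst; last lra.
  by rewrite addrAC subrr add0r; apply: mulr_gt0; lra.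
apply: le_Rintegral => //.
- by apply: itv_integrable => x; exact: cvg_cst.
- exact: itv_integrable.
- by move=> y /He' [].
Unshelve. all: by end_near. Qed.

Lemma itv_int_FTC (F f : R -> R) a b : a <= b -> continuous f ->
  (forall x : R, is_derive x 1 F (f x)) ->
  \int[mu]_(x in `[a, b]) f x = F b - F a.
Proof.
rewrite le_eqVlt => /predU1P[<- _ _|ab cf dF].
  by rewrite set_itv1 Rintegral_set1 subrr.
have cF : continuous F.
  move=> x; apply: differentiable_continuous; apply/derivable1_diffP.
  exact: (@ex_derive _ _ _ _ _ _ _ (dF x)).
rewrite /Rintegral (@continuous_FTC2 _ f F)//.
- exact: continuous_subspaceT.
- split.
  + by move=> x _; exact: (@ex_derive _ _ _ _ _ _ _ (dF x)).
  + by apply: cvg_at_right_filter; exact: cF.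
  + by apply: cvg_at_left_filter; exact: cF.
- by move=> x _; rewrite derive1E; exact: (@derive_val _ _ _ _ _ _ _ (dF x)).
Qed.

Lemma itv_int_setT f a b : (forall x, ~~ (a <= x <= b) -> f x = 0) ->
  \int[mu]_x f x = \int[mu]_(x in `[a, b]) f x.
Proof.
move=> f0; rewrite [RHS]Rintegral_mkcond; congr Rintegral.
apply/funext => x; rewrite patchE; case: ifPn => // xK.
by apply: f0; apply: contra xK => ?; rewrite inE /= in_itv.
Qed.

(** A primitive of f on the right, translated by c, is a primitive of the
    integrand on the left. *)
Lemma itv_int_shift f a b c : a <= b -> continuous f ->
  \int[mu]_(x in `[a, b]) f (x + c) = \int[mu]_(x in `[a + c, b + c]) f x.
Proof.
move=> ab cf.
pose G x := \int[mu]_(t in `[a + c - 1, x]) f t.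
have dG (x : R) : a + c - 1 < x -> is_derive x 1 G (f x).
  move=> ax; have [|||d1 d2] := @continuous_FTC1_closed _ f (a + c - 1) x (x + 1) _ _ _ (cf x).
  - lra.
  - exact: itv_integrable.
  - by [].
  by apply: DeriveDef; [exact: d1|rewrite -derive1E; exact: d2].
have [->|ab'] := eqVneq a b; first by rewrite !set_itv1 !Rintegral_set1.
have {ab'}ab' : a < b by rewrite lt_neqAle ab'.
have cG (x : R) : a + c - 1 < x -> {for x, continuous G}.
  move=> ax; apply: differentiable_continuous; apply/derivable1_diffP.
  exact: (@ex_derive _ _ _ _ _ _ _ (dG x ax)).
rewrite {2}/Rintegral (@continuous_FTC2 _ f G)//; last first.
- move=> x; rewrite in_itv /= => /andP[x1 _]; rewrite derive1E.
  have /dG H : a + c - 1 < x by apply: lt_trans x1; lra.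
    exact: (@derive_val _ _ _ _ _ _ _ H).
- split.
  + move=> x; rewrite in_itv /= => /andP[x1 _].
    have /dG H : a + c - 1 < x by apply: lt_trans x1; lra.
    exact: (@ex_derive _ _ _ _ _ _ _ H).
  + by apply: cvg_at_right_filter; apply: cG; lra.
  + by apply: cvg_at_left_filter; apply: cG; lra.
- exact: continuous_subspaceT.
- lra.
have dGc (x : R) : a - 1 < x -> is_derive x 1 (fun y => G (y + c)) (f (x + c)).
  move=> ax; have H : is_derive (x + c) 1 G (f (x + c)) by apply: dG; lra.
  have H2 : is_derive x 1 (fun y : R => y + c) 1.
    by apply: is_derive_eq (is_deriveD (is_derive_id x 1) (is_derive_cst c x 1)) _; rewrite addr0.
  by have := @is_derive1_comp _ G (fun y => y + c) x _ _ H H2; rewrite mulr1.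
have cGc (x : R) : a - 1 < x -> {for x, continuous (fun y => G (y + c))}.
  move=> ax; apply: differentiable_continuous; apply/derivable1_diffP.
  exact: (@ex_derive _ _ _ _ _ _ _ (dGc x ax)).
rewrite /Rintegral (@continuous_FTC2 _ (fun x => f (x + c)) (fun x => G (x + c)))//.
- apply: continuous_subspaceT => x; apply: (@cvg_comp _ _ _ (fun y => y + c) f _ (nbhs (x + c))).
    by apply: cvgD => //; exact: cvg_cst.
  exact: cf.
- split.
  + move=> x; rewrite in_itv /= => /andP[x1 _].
    have /dGc H : a - 1 < x by apply: lt_trans x1; lra.
    exact: (@ex_derive _ _ _ _ _ _ _ H).
  + by apply: cvg_at_right_filter; apply: cGc; lra.
  + by apply: cvg_at_left_filter; apply: cGc; lra.
- move=> x; rewrite in_itv /= => /andP[x1 _]; rewrite derive1E.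
  have /dGc H : a - 1 < x by apply: lt_trans x1; lra.
    exact: (@derive_val _ _ _ _ _ _ _ H).
Qed.

End IntervalIntegral.

(** * Iterated integrals *)

Lemma continuous_local (T U : topologicalType) (f : T -> U) :
  (forall t : T, exists g : T -> U, continuous g /\ \forall s \near t, f s = g s) ->
  continuous f.
Proof.
move=> H t; have [g [cg fg]] := H t.
rewrite /continuous_at (nbhs_singleton fg); apply: cvg_trans (cg t).
by apply: near_eq_cvg; near=> s; apply/esym; near: s.
Unshelve. all: by end_near. Qed.

Lemma near_all (T : topologicalType) (I : finType) (P : I -> T -> Prop) (t : T) :
  (forall i, \forall s \near t, P i s) -> \forall s \near t, forall i, P i s.
Proof. exact: filter_forall. Qed.

Lemma continuous_neq0 (R : realType) (T : topologicalType) (f : T -> R) (t : T) :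
  continuous f -> f t != 0 -> \forall s \near t, f s != 0.
Proof. by move=> cf ft; exact: (cvgr_neq0 (f t) (cf t) ft). Qed.

Lemma continuous_near_le (R : realType) (T : topologicalType) (f : T -> R) (t : T) e :
  continuous f -> 0 < e -> \forall s \near t, `|f s - f t| <= e.
Proof.
move=> cf e0; have /cvgrPdist_le/(_ _ e0) : f s @[s --> t] --> f t by exact: cf.
by apply: filterS => s; rewrite distrC.
Qed.

Lemma continuous_compose (T U V : topologicalType) (f : T -> U) (g : U -> V) :
  continuous f -> continuous g -> continuous (fun t => g (f t)).
Proof. by move=> cf cg t; apply: (@cvg_comp _ _ _ f g _ (nbhs (f t))); [exact: cf|exact: cg]. Qed.

Lemma continuous_pair (T P Q : topologicalType) (f : T -> P) (g : T -> Q) :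
  continuous f -> continuous g -> continuous (fun t => (f t, g t)).
Proof. by move=> cf cg t; exact: (cvg_pair (cf t) (cg t)). Qed.

Lemma continuous_comp2 (T P Q U : topologicalType) (f : T -> P) (g : T -> Q)
  (F : P * Q -> U) : continuous f -> continuous g -> continuous F ->
  continuous (fun t => F (f t, g t)).
Proof.
move=> cf cg cF t; apply: (@cvg_comp _ _ _ (fun t => (f t, g t)) F _ (nbhs (f t, g t))).
  exact: continuous_pair.
exact: cF.
Qed.

(** A directional derivative only sees the restriction to a line. *)
Lemma is_derive_lineP (R : realType) (V : normedModType R) (f : V -> R) (u v : V) df :
  is_derive u v f df <-> is_derive (0 : R) (1 : R) (fun t : R => f (t *: v + u)) df.
Proof.
have E : (fun h : R => h^-1 *: ((f \o shift u) (h *: v) - f u)) =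
    (fun h : R => h^-1 *: (((fun t : R => f (t *: v + u)) \o shift 0) (h *: 1) -
                          (fun t : R => f (t *: v + u)) 0)).
  by apply/funext => h /=; rewrite addr0 scale0r add0r /GRing.scale /= mulr1.
have dE : derivable f u v = derivable (fun t : R => f (t *: v + u)) 0 1.
  by rewrite /derivable E.
have DE : 'D_v f u = 'D_1 (fun t : R => f (t *: v + u)) 0 by rewrite /derive E.
by split=> -[d1 d2]; split; rewrite ?dE -?DE// -?dE// DE.
Qed.

Section IteratedIntegral.
Context {R : realType}.
Notation mu := (@lebesgue_measure R).

(** The topology of row vectors is the product topology. *)
Lemma continuous_row (T : topologicalType) n (f : T -> 'rV[R]_n) :
  (forall i, continuous (fun t => f t 0 i)) -> continuous f.
Proof.
move=> cf t A [P PM sPA]; apply: (@filterS _ (nbhs t) _ [set s | forall i, P 0 i (f s 0 i)]).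
  by move=> s Ps; apply: sPA => i j; rewrite ord1.
apply: filter_forall => i; exact: (cf i t (P 0 i) (PM 0 i)).
Qed.

(** The recursion in [iter_int] splits off the first coordinate. *)
Lemma row_consE m (a : R) (v : 'rV[R]_m) (i : 'I_m.+1) :
  (row_mx (a%:M : 'rV_1) v : 'rV_m.+1) 0 i = if unlift ord0 i is Some j then v 0 j else a.
Proof.
case: unliftP => [j|] ->.
  transitivity ((row_mx (a%:M : 'rV_1) v) 0 (rshift 1 j)); last by rewrite row_mxEr.
  by congr (row_mx _ _ _ _); exact: val_inj.
transitivity ((row_mx (a%:M : 'rV_1) v) 0 (lshift m ord0)).
  by congr (row_mx _ _ _ _); exact: val_inj.
by rewrite row_mxEl mxE eqxx mulr1n.
Qed.

Lemma continuous_row_cons (T : topologicalType) m (a : T -> R) (v : T -> 'rV[R]_m) :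
  continuous a -> continuous v ->
  continuous (fun t => row_mx ((a t)%:M : 'rV_1) (v t) : 'rV_m.+1).
Proof.
move=> ca cv; apply: continuous_row => i.
under eq_fun do rewrite row_consE.
case: unliftP => // j _ t; apply: (@cvg_comp _ _ _ v (fun w : 'rV_m => w 0 j) _ (nbhs (v t))); first exact: cv.
exact: coord_continuous.
Qed.

Lemma eq_iter_int (D : set R) n (f g : 'rV[R]_n -> R) :
  (forall v : 'rV_n, (forall i, D (v 0 i)) -> f v = g v) -> iter_int D f = iter_int D g.
Proof.
elim: n f g => [|n IH] f g fg /=; first by apply: fg; case.
apply: eq_Rintegral => a /set_mem Da; apply: IH => v Dv; apply: fg => i.
by rewrite row_consE; case: unliftP.
Qed.

Lemma iter_int_ge0 (D : set R) n (f : 'rV[R]_n -> R) :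
  (forall v, 0 <= f v) -> 0 <= iter_int D f.
Proof.
elim: n f => [|n IH] f f0 //=.
by apply: Rintegral_ge0 => y _; apply: IH => v; exact: f0.
Qed.

Lemma iter_int0 (D : set R) n : iter_int D (fun _ : 'rV[R]_n => 0) = 0.
Proof.
elim: n => [|n IH] //=; have -> : (fun a : R => iter_int D (fun _ : 'rV[R]_n => 0)) = cst 0 by apply/funext => x; exact: IH.
by rewrite /Rintegral integral0.
Qed.

Section Box.
Variables (a b : R).
Hypothesis ab : a <= b.

Lemma iter_int_continuous n (P : topologicalType) (F : P -> 'rV[R]_n -> R) :
  continuous (fun z : P * 'rV_n => F z.1 z.2) ->
  continuous (fun p => iter_int `[a, b] (F p)).
Proof.
elim: n P F => [|n IH] P F cF /=.
  have c0 : continuous (cst 0 : P -> 'rV[R]_0) by exact: cst_continuous.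
  have ci : continuous (id : P -> P) by move=> x; exact: cvg_id.
  exact: (continuous_comp2 ci c0 cF).
apply: (itv_int_continuous ab) => /=.
apply: (IH (P * R)%type (fun z v => F z.1 (row_mx (z.2%:M : 'rV_1) v))) => /=.
apply: (@continuous_comp2 _ _ _ _ (fun z : P * R * 'rV_n => z.1.1)
   (fun z => row_mx (z.1.2%:M : 'rV_1) z.2 : 'rV_n.+1) (fun z => F z.1 z.2)) => //.
  by move=> z; apply: cvg_comp; exact: cvg_fst.
apply: continuous_row_cons => z; last exact: cvg_snd.
by apply: cvg_comp; [exact: cvg_fst|exact: cvg_snd].
Qed.

Lemma continuous_row_head n (f : 'rV[R]_n.+1 -> R) : continuous f ->
  continuous (fun z : R * 'rV_n => f (row_mx (z.1%:M : 'rV_1) z.2)).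
Proof.
move=> cf z; apply: (@cvg_comp _ _ _ (fun z : R * 'rV_n => row_mx (z.1%:M : 'rV_1) z.2 : 'rV_n.+1) f _
  (nbhs (row_mx (z.1%:M : 'rV_1) z.2 : 'rV_n.+1))); last exact: cf.
by apply: continuous_row_cons => w; [exact: cvg_fst|exact: cvg_snd].
Qed.

Lemma continuous_row_tail n (f : 'rV[R]_n.+1 -> R) x : continuous f ->
  continuous (fun v : 'rV_n => f (row_mx (x%:M : 'rV_1) v)).
Proof. by move=> /continuous_row_head cf; exact: (continuous_slice (F := fun x v => f (row_mx (x%:M : 'rV_1) v))). Qed.

Lemma iter_int_head n (f : 'rV[R]_n.+1 -> R) : continuous f ->
  continuous (fun x => iter_int `[a, b] (fun v : 'rV_n => f (row_mx (x%:M : 'rV_1) v))).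
Proof. by move=> cf; apply: iter_int_continuous; exact: continuous_row_head. Qed.

Lemma iter_int_lin n (f g : 'rV[R]_n -> R) c : continuous f -> continuous g ->
  iter_int `[a, b] (fun v => c * f v + g v) =
  c * iter_int `[a, b] f + iter_int `[a, b] g.
Proof.
elim: n f g => [|n IH] f g cf cg //=.
rewrite -itv_int_lin; try exact: iter_int_head.
by apply: eq_Rintegral => x _; apply: IH; exact: continuous_row_tail.
Qed.

(** Positivity is propagated one variable at a time, the outer integrand being
    positive at the first coordinate of v0. *)
Lemma iter_int_gt0 n (f : 'rV[R]_n -> R) (v0 : 'rV_n) : continuous f ->
  (forall v, 0 <= f v) -> (forall i, a < v0 0 i < b) -> 0 < f v0 ->
  0 < iter_int `[a, b] f.
Proof.
elim: n f v0 => [|n IH] f v0 cf f0 v0D fv0 /=.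
  by rewrite (_ : 0 = v0) //; apply/rowP; case.
have v0E : v0 = row_mx ((v0 0 ord0)%:M : 'rV_1) (\row_j v0 0 (lift ord0 j)).
  by apply/rowP => i; rewrite row_consE; case: unliftP => [j|] ->; rewrite ?mxE.
apply: (@itv_int_gt0 _ _ _ _ (v0 0 ord0)).
- exact: v0D.
- exact: iter_int_head.
- by move=> x; apply: iter_int_ge0 => v; exact: f0.
- apply: (IH _ (\row_j v0 0 (lift ord0 j))) => [|v|i|].
  + exact: continuous_row_tail.
  + exact: f0.
  + by rewrite mxE.
  + by rewrite -v0E.
Qed.

Lemma iter_int_derive n (f f' : R -> 'rV[R]_n -> R) (h0 : R) :
  continuous (fun z : R * 'rV_n => f z.1 z.2) ->
  continuous (fun z : R * 'rV_n => f' z.1 z.2) ->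
  (forall (h : R) v, is_derive h 1 (f ^~ v) (f' h v)) ->
  is_derive h0 1 (fun h => iter_int `[a, b] (f h)) (iter_int `[a, b] (f' h0)).
Proof.
have reassoc m (F : R -> 'rV[R]_m.+1 -> R) : continuous (fun z : R * 'rV_m.+1 => F z.1 z.2) ->
   continuous (fun z : R * R * 'rV_m => F z.1.1 (row_mx (z.1.2%:M : 'rV_1) z.2)).
  move=> cF; apply: (@continuous_comp2 _ _ _ _ (fun z : R * R * 'rV_m => z.1.1)
   (fun z => row_mx (z.1.2%:M : 'rV_1) z.2 : 'rV_m.+1) (fun z => F z.1 z.2)) => //.
    by move=> z; apply: cvg_comp; exact: cvg_fst.
  apply: continuous_row_cons => z; last exact: cvg_snd.
  by apply: cvg_comp; [exact: cvg_fst|exact: cvg_snd].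
elim: n f f' h0 => [|n IH] f f' h0 cf cf' df /=; first exact: df.
apply: (@itv_int_derive _ (fun h x => iter_int `[a, b] (fun v : 'rV_n => f h (row_mx (x%:M : 'rV_1) v)))
  (fun h x => iter_int `[a, b] (fun v : 'rV_n => f' h (row_mx (x%:M : 'rV_1) v)))) => //.
- apply: (@iter_int_continuous _ (R * R)%type (fun z v => f z.1 (row_mx (z.2%:M : 'rV_1) v))).
  exact: reassoc.
- apply: (@iter_int_continuous _ (R * R)%type (fun z v => f' z.1 (row_mx (z.2%:M : 'rV_1) v))).
  exact: reassoc.
- move=> h x /=.
  apply: (IH (fun h v => f h (row_mx (x%:M : 'rV_1) v)) (fun h v => f' h (row_mx (x%:M : 'rV_1) v))).
  + apply: (@continuous_comp2 _ _ _ _ fst (fun z : R * 'rV_n => row_mx (x%:M : 'rV_1) z.2 : 'rV_n.+1) (fun z => f z.1 z.2)) => //.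
      by move=> z; exact: cvg_fst.
    by apply: continuous_row_cons => z; [exact: cvg_cst|exact: cvg_snd].
  + apply: (@continuous_comp2 _ _ _ _ fst (fun z : R * 'rV_n => row_mx (x%:M : 'rV_1) z.2 : 'rV_n.+1) (fun z => f' z.1 z.2)) => //.
      by move=> z; exact: cvg_fst.
    by apply: continuous_row_cons => z; [exact: cvg_cst|exact: cvg_snd].
Qed.

End Box.

Lemma iter_int_norm n (f : 'rV[R]_n -> R) M : continuous f ->
  (forall v : 'rV_n, (forall i, 0 <= v 0 i <= 1) -> `|f v| <= M) ->
  `|iter_int `[0, 1] f| <= M.
Proof.
elim: n f => [|n IH] f cf fM /=; first by apply: fM; case.
rewrite -[M]mulr1 -[X in M * X]subr0; apply: itv_int_norm => //.
  exact: iter_int_head.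
move=> x x01; apply: IH; first exact: continuous_row_tail.
by move=> v v01; apply: fM => i; rewrite row_consE; case: unliftP.
Qed.

Lemma iter_int_setT n (f : 'rV[R]_n -> R) K : 0 <= K -> continuous f ->
  (forall (v : 'rV_n) i, K < `|v 0 i| -> f v = 0) ->
  iter_int setT f = iter_int `[- K, K] f.
Proof.
move=> K0; have KK : - K <= K by rewrite ge0_cp.
elim: n f => [|n IH] f cf f0 //=.
transitivity (\int[mu]_x iter_int `[- K, K] (fun v : 'rV_n => f (row_mx (x%:M : 'rV_1) v))).
  apply: eq_Rintegral => x _; apply: IH; first exact: continuous_row_tail.
  by move=> v i Ki; apply: (f0 _ (lift ord0 i)); rewrite row_consE liftK.
apply: itv_int_setT => x Kx; rewrite -[RHS](iter_int0 `[- K, K] n).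
apply: eq_iter_int => v _; apply: (f0 _ ord0); rewrite row_consE unlift_none.
by rewrite ltNge ler_norml.
Qed.

(** The derivative under the integral sign reduces the outermost variable to
    the fundamental theorem of calculus. *)
Lemma iter_int_periodic_derive n (i : 'I_n) (f f' : 'rV[R]_n -> R) :
  continuous f -> continuous f' ->
  (forall v, is_derive v (delta_mx 0 i) f (f' v)) ->
  (forall v, f (v + delta_mx 0 i) = f v) ->
  iter_int `[0, 1] f' = 0.
Proof.
elim: n i f f' => [|n IH] i f f' cf cf' df pf /=; first by case: i {df pf}.
case: (unliftP ord0 i) => [j ij|i0].
- have rowD (x : R) (v : 'rV_n) (t : R) : t *: delta_mx 0 i + row_mx (x%:M : 'rV_1) v =
      row_mx (x%:M : 'rV_1) (t *: delta_mx 0 j + v) :> 'rV_n.+1.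
    apply/rowP => l; rewrite [LHS]mxE [X in X + _]mxE [X in _ * X]mxE !row_consE ij /=.
    by case: unliftP => [l' ->|->]; rewrite ?mxE ?(inj_eq (@lift_inj _ ord0))//= mulr0 add0r.
  transitivity (\int[mu]_(x in `[0, 1]) (0 : R)); last by rewrite itv_int_cst// mul0r.
  apply: eq_Rintegral => x _.
  apply: (IH j (fun v => f (row_mx (x%:M : 'rV_1) v))).
  + exact: continuous_row_tail.
  + exact: continuous_row_tail.
  + move=> v; apply/is_derive_lineP; have /is_derive_lineP := df (row_mx (x%:M : 'rV_1) v).
    by under eq_fun do rewrite rowD.
  + move=> v; rewrite -(pf (row_mx (x%:M : 'rV_1) v : 'rV_n.+1)); congr f.
    by have := rowD x v 1; rewrite !scale1r addrC => ->; rewrite addrC.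
- have rowD (x : R) (v : 'rV_n) (t : R) : t *: delta_mx 0 i + row_mx (x%:M : 'rV_1) v =
      row_mx ((t + x)%:M : 'rV_1) v :> 'rV_n.+1.
    apply/rowP => l; rewrite [LHS]mxE [X in X + _]mxE [X in _ * X]mxE !row_consE i0 /=.
    by case: unliftP => [l' ->|->]; rewrite ?mxE ?eqxx/= ?mulr1 ?mulr0 ?add0r.
  have cF : continuous (fun x => iter_int `[0, 1] (fun v : 'rV_n => f' (row_mx (x%:M : 'rV_1) v))).
    exact: iter_int_head.
  have dF (x : R) : is_derive x 1 (fun x => iter_int `[0, 1] (fun v : 'rV_n => f (row_mx (x%:M : 'rV_1) v)))
      (iter_int `[0, 1] (fun v : 'rV_n => f' (row_mx (x%:M : 'rV_1) v))).
    apply: (iter_int_derive ler01 (f := fun x v => f (row_mx (x%:M : 'rV_1) v))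
      (f' := fun x v => f' (row_mx (x%:M : 'rV_1) v))).
    + exact: continuous_row_head.
    + exact: continuous_row_head.
    + move=> h v; apply/is_derive_lineP; have /is_derive_lineP := df (row_mx (h%:M : 'rV_1) v).
      under eq_fun do rewrite rowD.
      by under [X in _ -> is_derive _ _ X _]eq_fun do rewrite /GRing.scale /= mulr1.
  rewrite (itv_int_FTC ler01 cF dF); apply/eqP; rewrite subr_eq0; apply/eqP.
  apply: eq_iter_int => v _.
  rewrite -(pf (row_mx (0%:M : 'rV_1) v : 'rV_n.+1)) addrC; congr f.
  by have := rowD 0 v 1; rewrite scale1r addr0 => ->.
Qed.

(** Compact support turns the integrals over the line into integrals over
    segments large enough to contain the support and its translate. *)
Lemma iter_int_translate n (f : 'rV[R]_n -> R) K (c : 'rV[R]_n) : 0 <= K -> continuous f ->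
  (forall (v : 'rV_n) i, K < `|v 0 i| -> f v = 0) ->
  iter_int setT (fun v => f (v + c)) = iter_int setT f.
Proof.
move=> K0; have KK : - K <= K by rewrite ge0_cp.
elim: n f c => [|n IH] f c cf f0 /=; first by congr f; apply/rowP; case.
have rowD (x : R) (v : 'rV_n) : row_mx (x%:M : 'rV_1) v + c =
    row_mx ((x + c 0 ord0)%:M : 'rV_1) (v + \row_j c 0 (lift ord0 j)) :> 'rV_n.+1.
  apply/rowP => l; rewrite [LHS]mxE !row_consE.
  by case: unliftP => [l' ->|->]; rewrite ?mxE.
pose F x := iter_int setT (fun v : 'rV_n => f (row_mx (x%:M : 'rV_1) v)).
have FE x : F x = iter_int `[- K, K] (fun v : 'rV_n => f (row_mx (x%:M : 'rV_1) v)).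
  apply: iter_int_setT => //; first exact: continuous_row_tail.
  by move=> v i Ki; apply: (f0 _ (lift ord0 i)); rewrite row_consE liftK.
have cF : continuous F by rewrite (funext FE); exact: iter_int_head.
transitivity (\int[mu]_x F (x + c 0 ord0)).
  apply: eq_Rintegral => x _.
  have -> : (fun v : 'rV_n => f (row_mx (x%:M : 'rV_1) v + c)) =
      (fun v => (fun w => f (row_mx ((x + c 0 ord0)%:M : 'rV_1) w)) (v + \row_j c 0 (lift ord0 j))).
    by apply/funext => v; rewrite rowD.
  apply: IH.
  - exact: continuous_row_tail.
  - by move=> v i Ki; apply: (f0 _ (lift ord0 i)); rewrite row_consE liftK.
have F0 x : K < `|x| -> F x = 0.
  move=> Kx; rewrite /F -[RHS](iter_int0 setT n); apply: eq_iter_int => v _.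
  by apply: (f0 _ ord0); rewrite row_consE unlift_none.
have c0 := normr_ge0 (c 0 ord0).
rewrite -/F (@itv_int_setT _ F (- (K + `|c 0 ord0|) + c 0 ord0) (K + `|c 0 ord0| + c 0 ord0)); last first.
  move=> x xK; apply: F0; rewrite ltNge; apply: contra xK.
  have := ler_norm (c 0 ord0); have := ler_norm (- c 0 ord0); rewrite normrN; rewrite !ler_norml; lra.
rewrite (@itv_int_setT _ (fun x => F (x + c 0 ord0)) (- (K + `|c 0 ord0|)) (K + `|c 0 ord0|)).
  by rewrite itv_int_shift//; lra.
move=> x xK; apply: F0; rewrite ltNge; apply: contra xK.
have := ler_norm (c 0 ord0); have := ler_norm (- c 0 ord0); rewrite normrN; rewrite !ler_norml; lra.
Qed.

End IteratedIntegral.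

(** * Complex integrals and functions of class C^k *)

Section ComplexIntegral.
Context {R : realType}.

(** Continuity in terms of the components, in which the integral of a complex
    function is defined. *)
Definition ccontinuous (T : topologicalType) (F : T -> R[i]) : Prop :=
  continuous (fun t => complex.Re (F t)) /\ continuous (fun t => complex.Im (F t)).

Lemma smooth_ccontinuous N (F : 'rV[R]_N -> R[i]) : smooth F -> ccontinuous F.
Proof. by move=> /(_ 0%N) [/Ck_cont cR /Ck_cont cI]. Qed.

Lemma ccontinuous_cst (T : topologicalType) (c : R[i]) : ccontinuous (fun _ : T => c).
Proof. by split; exact: cst_continuous. Qed.

Lemma ccontinuousD (T : topologicalType) (F G : T -> R[i]) :
  ccontinuous F -> ccontinuous G -> ccontinuous (fun t => F t + G t).
Proof.
move=> [F1 F2] [G1 G2]; split.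
- rewrite (_ : (fun t => _) = (fun t => complex.Re (F t) + complex.Re (G t))).
    by move=> t; exact: (cvgD (F1 t) (G1 t)).
  by apply/funext => t; case: (F t) (G t) => [? ?] [].
- rewrite (_ : (fun t => _) = (fun t => complex.Im (F t) + complex.Im (G t))).
    by move=> t; exact: (cvgD (F2 t) (G2 t)).
  by apply/funext => t; case: (F t) (G t) => [? ?] [].
Qed.

Lemma ccontinuousM (T : topologicalType) (F G : T -> R[i]) :
  ccontinuous F -> ccontinuous G -> ccontinuous (fun t => F t * G t).
Proof.
move=> [F1 F2] [G1 G2]; split.
- rewrite (_ : (fun t => _) = (fun t => complex.Re (F t) * complex.Re (G t)
     - complex.Im (F t) * complex.Im (G t))).
    by move=> t; exact: (cvgB (cvgM (F1 t) (G1 t)) (cvgM (F2 t) (G2 t))).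
  by apply/funext => t; case: (F t) (G t) => [? ?] [].
- rewrite (_ : (fun t => _) = (fun t => complex.Re (F t) * complex.Im (G t)
     + complex.Im (F t) * complex.Re (G t))).
    by move=> t; exact: (cvgD (cvgM (F1 t) (G2 t)) (cvgM (F2 t) (G1 t))).
  by apply/funext => t; case: (F t) (G t) => [? ?] [].
Qed.

Lemma ccontinuous_comp (T U : topologicalType) (g : T -> U) (F : U -> R[i]) :
  continuous g -> ccontinuous F -> ccontinuous (fun t => F (g t)).
Proof.
move=> cg [F1 F2]; split=> t.
- exact: (@cvg_comp _ _ _ g (fun u => complex.Re (F u)) _ (nbhs (g t)) _ (cg t) (F1 _)).
- exact: (@cvg_comp _ _ _ g (fun u => complex.Im (F u)) _ (nbhs (g t)) _ (cg t) (F2 _)).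
Qed.

Lemma complex_eta (z : R[i]) : complex.Re z +i* complex.Im z = z.
Proof. by case: z. Qed.

Lemma eq_cint (D : set R) n (F G : 'rV[R]_n -> R[i]) :
  (forall v : 'rV_n, (forall i, D (v 0 i)) -> F v = G v) -> cint D F = cint D G.
Proof.
by move=> FG; congr (_ +i* _); apply: eq_iter_int => v Dv; rewrite (FG v Dv).
Qed.

Lemma cint0 (D : set R) n : cint D (fun _ : 'rV[R]_n => 0) = 0.
Proof. by rewrite /cint /= !iter_int0. Qed.

Lemma cint_lin a b n (F G : 'rV[R]_n -> R[i]) c : a <= b -> ccontinuous F -> ccontinuous G ->
  cint `[a, b] (fun v => c * F v + G v) = c * cint `[a, b] F + cint `[a, b] G.
Proof.
move=> ab [F1 F2] [G1 G2]; case: c => c d.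
rewrite /cint; apply/eqP; rewrite eq_complex /=; apply/andP; split; apply/eqP.
- transitivity (iter_int `[a, b] (fun v => c * complex.Re (F v) +
     (- d * complex.Im (F v) + complex.Re (G v)))).
    by congr iter_int; apply/funext => v; case: (F v) (G v) => [? ?] [? ?] /=; ring.
  rewrite !iter_int_lin//; first by ring.
  by move=> v; exact: (cvgD (cvgM (cvg_cst _) (F2 v)) (G1 v)).
- transitivity (iter_int `[a, b] (fun v => c * complex.Im (F v) +
     (d * complex.Re (F v) + complex.Im (G v)))).
    by congr iter_int; apply/funext => v; case: (F v) (G v) => [? ?] [? ?] /=; ring.
  rewrite !iter_int_lin//; first by ring.
  by move=> v; exact: (cvgD (cvgM (cvg_cst _) (F1 v)) (G2 v)).
Qed.

Lemma cintZ a b n (F : 'rV[R]_n -> R[i]) c : a <= b -> ccontinuous F ->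
  cint `[a, b] (fun v => c * F v) = c * cint `[a, b] F.
Proof.
move=> ab cF; have := cint_lin c ab cF (ccontinuous_cst _ 0).
by rewrite cint0 addr0 => <-; congr cint; apply/funext => v; rewrite addr0.
Qed.

Lemma cint_sum a b n (I : Type) (r : seq I) (F : I -> 'rV[R]_n -> R[i]) : a <= b ->
  (forall i, ccontinuous (F i)) ->
  cint `[a, b] (fun v => \sum_(i <- r) F i v) = \sum_(i <- r) cint `[a, b] (F i).
Proof.
move=> ab cF; suff [] : ccontinuous (fun v => \sum_(i <- r) F i v) /\
    cint `[a, b] (fun v => \sum_(i <- r) F i v) = \sum_(i <- r) cint `[a, b] (F i) by [].
elim: r => [|i r [IH1 IH2]].
  by under eq_fun do rewrite big_nil; rewrite big_nil cint0; split; first exact: ccontinuous_cst.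
under eq_fun do rewrite big_cons; rewrite big_cons; split; first exact: ccontinuousD.
rewrite -IH2 -[X in _ = X + _]mul1r -cint_lin//.
by congr cint; apply/funext => v; rewrite mul1r.
Qed.

(** The constant 2 comes from bounding the real and the imaginary part
    separately. *)
Lemma cint_norm n (F : 'rV[R]_n -> R[i]) M : ccontinuous F ->
  (forall v : 'rV_n, (forall i, 0 <= v 0 i <= 1) -> `|F v| <= M%:C) ->
  `|cint `[0, 1] F| <= (2 * M)%:C.
Proof.
move=> [F1 F2] FM; rewrite /cint; set x := iter_int _ _; set y := iter_int _ _.
have xM : `|x| <= M.
  apply: iter_int_norm => // v /FM; rewrite -lecR; apply: le_trans.
  exact: normc_ge_Re.
have yM : `|y| <= M.
  apply: iter_int_norm => // v /FM; rewrite -lecR; apply: le_trans.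
  by case: (F v) => p q; rewrite normc_def lecR /= -sqrtr_sqr ler_wsqrtr// lerDr sqr_ge0.
have -> : x +i* y = x%:C + 'i * y%:C by apply/eqP; rewrite eq_complex /= !(mul0r, mulr0, mul1r, subr0, addr0, add0r) !eqxx.
apply: (le_trans (ler_normD _ _)); rewrite normrM normCi mul1r.
by rewrite !normc_def /= !expr0n !addr0 !sqrtr_sqr -rmorphD lecR mulr_natl mulr2n lerD.
Qed.

(** Integration by parts over a torus. *)
Lemma cint_periodic_derive n (i : 'I_n) (F : 'rV[R]_n -> R[i]) : smooth F ->
  (forall v, F (v + evec i) = F v) -> cint `[0, 1] (pdiff i F) = 0.
Proof.
move=> sF pF; have sdF := smooth_pdiff i sF.
have [c1 c2] := smooth_ccontinuous sF; have [d1 d2] := smooth_ccontinuous sdF.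
have dR v : is_derive v (evec i) (fun u => complex.Re (F u)) (complex.Re (pdiff i F v)).
  by have [? _] := smooth_derivable i v sF; exact/derivableP.
have dI v : is_derive v (evec i) (fun u => complex.Im (F u)) (complex.Im (pdiff i F v)).
  by have [_ ?] := smooth_derivable i v sF; exact/derivableP.
by rewrite /cint (iter_int_periodic_derive c1 d1 dR) ?(iter_int_periodic_derive c2 d2 dI)// => v;
  rewrite -/(evec i) pF.
Qed.

End ComplexIntegral.

Section CkTools.
Context {R : realType} {N : nat}.
Implicit Types (f g : 'rV[R]_N -> R) (F G : 'rV[R]_N -> R[i]) (i : 'I_N).

(** Being C^k is a local property: this is how functions given by different
    formulas in different regions are shown to be smooth. *)
Lemma Ck_local m f :
  (forall u : 'rV[R]_N, exists g, Ck m g /\ \forall v \near u, f v = g v) -> Ck m f.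
Proof.
elim: m f => [|m IH] f H; split=> //; try (apply: continuous_local => u;
  by have [g [/Ck_cont cg fg]] := H u; exists g).
move=> i; split.
  move=> u; have [g [[_ cg] fg]] := H u; have [dg _] := cg i.
  by apply: near_eq_derivable (dg u); apply: filterS fg => v ->.
apply: IH => u; have [g [[_ cg] fg]] := H u; have [dg ddg] := cg i.
exists (fun u => 'D_(evec i) g u); split=> //.
by apply: filterS (near_join fg) => v gv; exact: near_eq_derive.
Qed.

Lemma smooth_local F :
  (forall u : 'rV[R]_N, exists G, smooth G /\ \forall v \near u, F v = G v) -> smooth F.
Proof.
move=> H m; split; apply: Ck_local => u; have [G [/(_ m) [G1 G2] FG]] := H u.
  by exists (fun v => complex.Re (G v)); split=> //; apply: filterS FG => v ->.
by exists (fun v => complex.Im (G v)); split=> //; apply: filterS FG => v ->.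
Qed.

Lemma Ck_inv m f : (forall u, 0 < f u) -> Ck m f -> Ck m (fun u => (f u)^-1).
Proof.
move=> f0; elim: m => [|m IH] Hf0; case: (Hf0) => cf Hf.
  by split=> // u; exact: (cvgV (lt0r_neq0 (f0 u)) (cf u)).
have If := IH (CkW Hf0); split; first exact: (Ck_cont If).
move=> i; have [df Ddf] := Hf i.
have D u : is_derive u (evec i) (fun v => (f v)^-1) (- (f u ^- 2) * 'D_(evec i) f u).
  apply: (is_derive_comp1 (h := GRing.inv)); last exact/derivableP.
  have f1 : (@id R (f u)) != 0 by exact: lt0r_neq0.
  by apply: is_derive_eq (@is_deriveV _ id (f u) 1 1 f1 _) _; rewrite /GRing.scale /= mulr1.
split; first by move=> u; exact: (@ex_derive _ _ _ _ _ _ _ (D u)).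
apply: Ck_ext (CkM (CkN (CkM If If)) Ddf) => u /=.
by rewrite (@derive_val _ _ _ _ _ _ _ (D u)) expr2 invfM.
Qed.

Lemma Ck_prod m (I : Type) (r : seq I) (f : I -> 'rV[R]_N -> R) :
  (forall j, Ck m (f j)) -> Ck m (fun u => \prod_(j <- r) f j u).
Proof.
move=> Hf; elim: r => [|j r IH].
  by apply: Ck_ext (Ck_cst m 1) => u; rewrite big_nil.
by apply: Ck_ext (CkM (Hf j) IH) => u; rewrite big_cons.
Qed.

Lemma Ck_le1 m f : Ck m.+1 f -> Ck 1 f.
Proof. by elim: m => // m IH /CkW. Qed.

Section Parametric.
Variables (a b : R -> 'I_N -> R).
Hypotheses (ca : forall i, continuous (a ^~ i)) (cb : forall i, continuous (b ^~ i)).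

Let L (u : 'rV[R]_N) x : 'rV[R]_N := \row_i (a x i * u 0 i + b x i).

Let cL : continuous (fun z : 'rV[R]_N * R => L z.1 z.2).
Proof.
apply: continuous_row => i; under eq_fun do rewrite mxE; move=> z.
apply: (@cvgD _ R^o); [apply: (@cvgM R)|].
- by apply: (@cvg_comp _ _ _ snd (a ^~ i) _ (nbhs z.2)); [exact: cvg_snd|exact: ca].
- apply: (@cvg_comp _ _ _ fst (fun u : 'rV_N => u 0 i) _ (nbhs z.1)); first exact: cvg_fst.
  exact: coord_continuous.
- by apply: (@cvg_comp _ _ _ snd (b ^~ i) _ (nbhs z.2)); [exact: cvg_snd|exact: cb].
Qed.

Let cG (c : R -> R) g : continuous c -> continuous g ->
  continuous (fun z : 'rV[R]_N * R => c z.2 * g (L z.1 z.2)).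
Proof.
move=> cc cg z; apply: (@cvgM R).
  by apply: (@cvg_comp _ _ _ snd c _ (nbhs z.2)); [exact: cvg_snd|exact: cc].
apply: (@cvg_comp _ _ _ (fun z : 'rV[R]_N * R => L z.1 z.2) g _ (nbhs (L z.1 z.2))).
  exact: cL.
exact: cg.
Qed.

Lemma continuous_param (c : R -> R) g (u : 'rV[R]_N) : continuous c -> continuous g ->
  continuous (fun x => c x * g (\row_i (a x i * u 0 i + b x i))).
Proof. by move=> cc cg; exact: (continuous_slice (F := fun u x => c x * g (L u x)) (p := u) (cG cc cg)). Qed.

(** Affine changes of variables acting coordinatewise, with coefficients that
    depend on the integration variable, cover circle averages, primitives along
    a coordinate and the integral formula in Hadamard's lemma. *)
Lemma param_derive (c : R -> R) f i (u : 'rV[R]_N) : continuous c -> Ck 1 f ->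
  is_derive u (evec i)
    (fun u => \int[lebesgue_measure]_(x in `[0, 1])
       (c x * f (\row_i (a x i * u 0 i + b x i))))
    (\int[lebesgue_measure]_(x in `[0, 1])
       (c x * a x i * 'D_(evec i) f (\row_i (a x i * u 0 i + b x i)))).
Proof.
move=> cc [cf /(_ i) [df Ddf]].
apply/is_derive_lineP.
have cl : continuous (fun h : R => h *: evec i + u : 'rV[R]_N).
  by move=> h'; apply: cvgD; [exact: (cvgZl cvg_id)|exact: cvg_cst].
have cl2 : continuous (fun z : R * R => (z.1 *: evec i + u, z.2) : 'rV[R]_N * R).
  apply: continuous_pair => z; last exact: cvg_snd.
  by apply: (@cvg_comp _ _ _ fst (fun h : R => h *: evec i + u : 'rV[R]_N) _ (nbhs z.1)); [exact: cvg_fst|exact: cl].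
have := @itv_int_derive _ (fun h x => c x * f (L (h *: evec i + u) x))
   (fun h x => c x * a x i * 'D_(evec i) f (L (h *: evec i + u) x)) 0 1 0 ler01.
rewrite scale0r add0r; apply.
- exact: (continuous_compose cl2 (cG cc cf)).
- have cca : continuous (fun x => c x * a x i).
    by move=> x; apply: (@cvgM R); [exact: cc|exact: ca].
  exact: (continuous_compose cl2 (cG cca Ddf.1)).
- move=> h x.
  have Lh t : L (t *: evec i + u) x = (a x i * t) *: evec i + L u x.
    by apply/rowP => j; rewrite !mxE eqxx /=; case: (eqVneq j i) => [->|_] /=; ring.
  have D1 (s : R) : is_derive s 1 (fun t : R => f (t *: evec i + L u x)) ('D_(evec i) f (s *: evec i + L u x)).
    apply/is_derive_lineP; have /is_derive_lineP := derivableP (df (s *: evec i + L u x)).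
    rewrite (_ : (fun t => f (t *: evec i + _)) = (fun t : R => f ((t *: 1 + s) *: evec i + L u x)))//.
    by apply/funext => t; rewrite addrA -scalerDl /GRing.scale /= mulr1.
  have D2 : is_derive h 1 (fun t : R => a x i * t) (a x i).
    by apply: is_derive_eq (is_deriveZ (a x i) (is_derive_id h 1)) _; rewrite /GRing.scale /= mulr1.
  have D3 := @is_derive1_comp _ (fun t : R => f (t *: evec i + L u x)) (fun t : R => a x i * t) h _ _ (D1 _) D2.
  have D4 := is_deriveZ (c x) D3.
  rewrite (_ : (fun _ => _) = (c x *: (fun t : R => f (a x i * t *: evec i + L u x)))).
    by apply: is_derive_eq D4 _; rewrite Lh /GRing.scale /=; ring.
  by apply/funext => t; rewrite Lh.
Qed.

Lemma Ck_param m (c : R -> R) f : continuous c -> Ck m f ->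
  Ck m (fun u => \int[lebesgue_measure]_(x in `[0, 1])
          (c x * f (\row_i (a x i * u 0 i + b x i)))).
Proof.
elim: m c f => [|m IH] c f cc Hf; split=> //;
  try (apply: (itv_int_continuous (F := fun u x => c x * f (L u x)));
    [exact: ler01 | apply: cG => //; exact: Ck_cont Hf]).
move=> i; have D u := param_derive i u cc (Ck_le1 Hf).
split; first by move=> u; exact: (@ex_derive _ _ _ _ _ _ _ (D u)).
apply: Ck_ext (IH (fun x => c x * a x i) _ _ (Hf.2 i).2) => [u|].
  by rewrite (@derive_val _ _ _ _ _ _ _ (D u)).
by move=> x; apply: (@cvgM R); [exact: cc|exact: ca].
Qed.

End Parametric.

Lemma itv01_int_cst (c : R) : \int[lebesgue_measure]_(x in `[0, 1]) c = c.
Proof. by rewrite itv_int_cst// subr0 mulr1. Qed.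

(** The case of a parametric integral with constant integrand. *)
Lemma Ck_diag m (a b : 'I_N -> R) f : Ck m f ->
  Ck m (fun u => f (\row_i (a i * u 0 i + b i))).
Proof.
have cc (x : R) : continuous (fun _ : R => x) by exact: cst_continuous.
move=> Hf; have := @Ck_param (fun=> a) (fun=> b) (fun i => cc (a i)) (fun i => cc (b i)) m (fun=> 1) f (cc 1) Hf.
by apply: Ck_ext => u; rewrite itv01_int_cst mul1r.
Qed.

Definition upd (u : 'rV[R]_N) i (x : R) : 'rV[R]_N :=
  \row_l (if l == i then x else u 0 l).

Lemma upd_id u i : upd u i (u 0 i) = u.
Proof. by apply/rowP => l; rewrite mxE; case: eqP => // ->. Qed.

Lemma is_derive_upd f u i x d : is_derive (upd u i x) (evec i) f d ->
  is_derive x 1 (fun y => f (upd u i y)) d.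
Proof.
move=> /is_derive_lineP H; apply/is_derive_lineP.
rewrite (_ : (fun t : R => _) = (fun t : R => f (t *: evec i + upd u i x)))//.
apply/funext => t; congr f; apply/rowP => l; rewrite !mxE eqxx /GRing.scale /=.
by case: eqP => _ /=; rewrite ?mulr1// mulr0 add0r.
Qed.

(** Hadamard's lemma: the quotient is the integral of the i-th partial derivative
    along the segment from upd u i a to u. *)
Lemma Hadamard f i a : (forall m, Ck m f) -> (forall u, f (upd u i a) = 0) ->
  exists g, [/\ forall m, Ck m g, forall u, f u = (u 0 i - a) * g u &
    forall u, g (upd u i a) = 'D_(evec i) f (upd u i a)].
Proof.
move=> Hf f0.
(* The segment, parametrized by x in [0, 1]. *)
pose A (x : R) (l : 'I_N) : R := if l == i then x else 1.
pose B (x : R) (l : 'I_N) : R := if l == i then a * (1 - x) else 0.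
have cA l : continuous (A ^~ l).
  by rewrite /A; case: eqP => _; [move=> x; exact: cvg_id|exact: cst_continuous].
have cB l : continuous (B ^~ l).
  rewrite /B; case: eqP => _; last exact: cst_continuous.
  by move=> x; apply: cvgM; [exact: cvg_cst|apply: cvgB; [exact: cvg_cst|exact: cvg_id]].
have LE (u : 'rV[R]_N) x : \row_l (A x l * u 0 l + B x l) = upd u i (a + x * (u 0 i - a)).
  by apply/rowP => l; rewrite !mxE /A /B; case: eqP => [->|_]; ring.
have Hd m : Ck m ('D_(evec i) f) by have [_ /(_ i) []] := Hf m.+1.
pose g (u : 'rV[R]_N) := \int[lebesgue_measure]_(x in `[0, 1]) (1 * 'D_(evec i) f (\row_l (A x l * u 0 l + B x l))).
exists g; split.
- by move=> m; apply: (Ck_param cA cB (c := cst 1) _ (Hd m)); exact: cst_continuous.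
- move=> u.
  pose h x := (u 0 i - a) * (1 * 'D_(evec i) f (\row_l (A x l * u 0 l + B x l))).
  have ch0 : continuous (fun x => 1 * 'D_(evec i) f (\row_l (A x l * u 0 l + B x l))).
    have c1 : continuous (fun _ : R => 1 : R) by exact: cst_continuous.
    have cD : continuous ('D_(evec i) f) := Ck_cont (Hd 0%N).
    exact: (continuous_param (u := u) cA cB c1 cD).
  have ch : continuous h by move=> x; apply: cvgM; [exact: cvg_cst|exact: ch0].
  have dh (x : R) : is_derive x 1 (fun x => f (upd u i (a + x * (u 0 i - a)))) (h x).
    have D1 : is_derive x 1 (fun x : R => a + x * (u 0 i - a)) (u 0 i - a).
      apply: is_derive_eq (is_deriveD (is_derive_cst a x 1) (is_deriveM (is_derive_id x 1) (is_derive_cst (u 0 i - a) x 1))) _.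
      by rewrite /GRing.scale /=; ring.
    have D2 : is_derive (a + x * (u 0 i - a)) 1 (fun y => f (upd u i y)) ('D_(evec i) f (upd u i (a + x * (u 0 i - a)))).
      apply: is_derive_upd; apply/derivableP.
      by have [_ /(_ i) []] := Hf 1%N.
    have D3 := @is_derive1_comp _ (fun y => f (upd u i y)) (fun x => a + x * (u 0 i - a)) x _ _ D2 D1.
    by apply: is_derive_eq D3 _; rewrite /h LE; ring.
  have := itv_int_FTC ler01 ch dh.
  rewrite mul0r addr0 f0 subr0 mul1r (addrC a) subrK upd_id => <-.
  have := itv_int_lin 0 1 (u 0 i - a) ch0 (@cst_continuous _ _ (0 : R)).
  rewrite /cst itv_int_cst// mul0r addr0 => <-.
  by apply: eq_Rintegral => x _; rewrite /h addr0.
- move=> u; rewrite /g.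
  under eq_Rintegral => x _ do rewrite LE.
  have E x : upd (upd u i a) i (a + x * (upd u i a 0 i - a)) = upd u i a.
    by apply/rowP => l; rewrite !mxE eqxx; case: eqP => // _; ring.
  by under eq_Rintegral => x _ do rewrite E mul1r; rewrite itv01_int_cst.
Qed.

End CkTools.

(** * Smooth plateaus and smooth quotients *)

Section Plateau.
Context {R : realType}.

(** The functions x^(-n) exp(-1/x), extended by 0: a family stable under
    differentiation up to linear combinations ([flat_derive]), so that all its
    members are smooth. *)
Definition flat (n : nat) (x : R) : R := if 0 < x then x^-1 ^+ n * expR (- x^-1) else 0.

Lemma flatN n x : x <= 0 -> flat n x = 0.
Proof. by rewrite /flat ltNge => ->. Qed.

Lemma flat_ge0 n x : 0 <= flat n x.
Proof.
rewrite /flat; case: ifPn => // x0.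
by rewrite mulr_ge0 ?expR_ge0// exprn_ge0// invr_ge0 ltW.
Qed.

(** From exp(t) >= t^(n+1) / (n+1)! at t = 1/x; the factor |x| gives both the
    continuity at 0 and the vanishing derivative there. *)
Lemma flat_le n x : flat n x <= n.+1`!%:R * `|x|.
Proof.
rewrite /flat; case: ifPn => x0; last by rewrite mulr_ge0.
rewrite (gtr0_norm x0).
have y0 : 0 <= x^-1 by rewrite invr_ge0 ltW.
have := expR_ge1Dxn n y0; rewrite expRN => H.
have f0 : 0 < n.+1`!%:R :> R by rewrite ltr0n fact_gt0.
rewrite ler_pdivrMr ?expR_gt0//.
have -> : x^-1 ^+ n = x * x^-1 ^+ n.+1 by rewrite exprS mulrA divff ?lt0r_neq0// mul1r.
rewrite -mulrA mulrCA ler_pM2l// mulrC -ler_pdivrMr//.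
by apply: le_trans H; rewrite lerDr ler01.
Qed.

Lemma flat_cvg0 n : flat n x @[x --> (0 : R)] --> (0 : R).
Proof.
apply: (@squeeze_cvgr _ _ _ _ (cst 0) (fun x => n.+1`!%:R * `|x|)).
- by apply: nearW => x; rewrite flat_ge0 flat_le.
- exact: cvg_cst.
- rewrite -[X in _ --> X](mulr0 (n.+1`!%:R)); apply: cvgM; first exact: cvg_cst.
  by rewrite -[X in _ --> X](@normr0 _ R); apply: cvg_norm; exact: cvg_id.
Qed.

Lemma flat_derive n (x : R) :
  is_derive x 1 (flat n) (- n%:R * flat n.+1 x + flat n.+2 x).
Proof.
case: (ltgtP x 0) => [x0|x0|->].
- apply: (@near_eq_is_derive _ _ _ (cst 0)).
    near=> y; rewrite flatN//.
    by near: y; apply: (cvgr_le (f := id) x) => //.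
  by have := is_derive_cst (0 : R) x (1 : R); rewrite !flatN ?(ltW x0)// mulr0 addr0.
- apply: (@near_eq_is_derive _ _ _ (fun y : R => y^-1 ^+ n * expR (- y^-1))).
    near=> y; rewrite /flat ifT//.
    by near: y; apply: (cvgr_gt (f := id) x) => //.
  have xn0 : x != 0 by exact: lt0r_neq0.
  have Di : is_derive x 1 (fun y : R => y^-1) (- x ^- 2).
    apply: is_derive_eq (@is_deriveV _ id x 1 1 xn0 _) _.
    by rewrite /GRing.scale /= mulr1.
  have Dn : is_derive x 1 (fun y : R => - y^-1) (x ^- 2).
    by apply: is_derive_eq (is_deriveN Di) _; rewrite opprK.
  have De := @is_derive1_comp _ expR (fun y => - y^-1) x _ _ (is_derive_expR _) Dn.
  have Dp k : is_derive x 1 (fun y : R => y^-1 ^+ k) (- k%:R * x^-1 ^+ k.+1).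
    elim: k => [|k IH]; first by rewrite mulr0n oppr0 mul0r; exact: is_derive_cst.
    rewrite (_ : (fun y : R => _) = (fun y : R => y^-1 * y^-1 ^+ k)); last first.
      by apply/funext => y; rewrite exprS.
    apply: is_derive_eq (is_deriveM Di IH) _.
    by rewrite /GRing.scale /= !exprS; field.
  have H := is_deriveM (Dp n) De.
  by apply: is_derive_eq H _; rewrite /flat !x0 /GRing.scale /= !exprS; field.
- rewrite !flatN// mulr0 addr0.
  have H : h^-1 *: ((flat n \o shift 0) (h *: 1) - flat n 0) @[h --> 0^'] --> (0 : R).
    have H0 : flat n.+1 h @[h --> 0^'] --> (0 : R).
      by apply: cvg_within_filter; exact: flat_cvg0.
    apply: cvg_trans H0.
    apply: near_eq_cvg; near=> h.
    have h0 : h != 0 by near: h; exact: nbhs_dnbhs_neq.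
    rewrite /= addr0 /GRing.scale /= mulr1 [flat n 0]flatN// subr0 /flat.
    by case: ifP; rewrite ?mulr0// mulrA exprS.
  split; first by apply/cvg_ex; exists 0.
  exact: cvg_lim H.
Unshelve. all: by end_near. Qed.

Lemma Ck_flat N m n (f : 'rV[R]_N -> R) : Ck m f -> Ck m (fun u => flat n (f u)).
Proof.
elim: m n f => [|m IH] n f Hf0; case: (Hf0) => cf Hf.
all: have cflat k : continuous (flat k) by (move=> x;
  apply: differentiable_continuous; apply/derivable1_diffP;
  exact: (@ex_derive _ _ _ _ _ _ _ (flat_derive k x))).
all: split; first by move=> u; apply: (@cvg_comp _ _ _ f (flat n) _ (nbhs (f u))); [exact: cf|exact: cflat].
  by [].
move=> i; have [df Ddf] := Hf i.
have D u := is_derive_comp1 (flat_derive n (f u)) (derivableP (df u)).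
split; first by move=> u; exact: (@ex_derive _ _ _ _ _ _ _ (D u)).
apply: Ck_ext (CkM (CkD (CkM (Ck_cst _ (- n%:R)) (IH n.+1 f (CkW Hf0))) (IH n.+2 f (CkW Hf0))) Ddf) => u /=.
by rewrite (@derive_val _ _ _ _ _ _ _ (D u)).
Qed.

Lemma flat0_le (x y : R) : 0 < x -> x <= y -> flat 0 x <= flat 0 y.
Proof.
move=> x0 xy; have y0 := lt_le_trans x0 xy.
by rewrite /flat x0 y0 !expr0 !mul1r ler_expR lerN2 lef_pV2.
Qed.

(** A smooth function equal to 1 on [-1/2, 1/2] and to 0 outside ]-1, 1[: the
    inner [flat] vanishes where |t| <= 1/2 and reaches flat 0 3 at |t| = 1,
    from where on the outer one vanishes. *)
Definition plateau (t : R) : R :=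
  flat 0 (flat 0 3 - flat 0 (4 * t ^+ 2 - 1)) / flat 0 (flat 0 3).

Lemma flat0_gt0 (x : R) : 0 < x -> 0 < flat 0 x.
Proof. by move=> x0; rewrite /flat x0 expr0 mul1r expR_gt0. Qed.

Lemma plateau1 t : `|t| <= 2^-1 -> plateau t = 1.
Proof.
move=> t2; rewrite /plateau [X in _ - X]flatN ?subr0 ?divff//.
  by apply: lt0r_neq0; rewrite !flat0_gt0.
rewrite subr_le0 -real_normK ?num_real//.
have := normr_ge0 t; nra.
Qed.

Lemma plateau0 t : 1 <= `|t| -> plateau t = 0.
Proof.
move=> t1; rewrite /plateau {1}/flat ifF ?mul0r//.
apply/negbTE; rewrite -leNgt subr_le0 flat0_le//.
rewrite -real_normK ?num_real//; nra.
Qed.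

Lemma plateau_ge0 t : 0 <= plateau t.
Proof. by rewrite mulr_ge0 ?invr_ge0 ?flat_ge0. Qed.

Lemma Ck_plateau N m (f : 'rV[R]_N -> R) : Ck m f -> Ck m (fun u => plateau (f u)).
Proof.
move=> Hf; apply: CkM; last exact: Ck_cst.
apply: Ck_flat; apply: CkD; first exact: Ck_cst.
apply: CkN; apply: Ck_flat; apply: CkD; last exact: Ck_cst.
by apply: CkM; [exact: Ck_cst|rewrite /=; exact: CkM].
Qed.

Definition plateau_box n (y0 : 'rV[R]_n) (e : R) (y : 'rV[R]_n) : R :=
  \prod_i plateau ((y 0 i - y0 0 i) / e).

Lemma Ck_plateau_box n (y0 : 'rV[R]_n) e m : Ck m (plateau_box y0 e).
Proof.
apply: Ck_prod => i; apply: Ck_plateau; apply: CkM; last exact: Ck_cst.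
by apply: CkD; [exact: Ck_coord|exact: Ck_cst].
Qed.

Lemma plateau_box_ge0 n (y0 : 'rV[R]_n) e y : 0 <= plateau_box y0 e y.
Proof. by apply: prodr_ge0 => i _; exact: plateau_ge0. Qed.

Lemma plateau_box0 n (y0 : 'rV[R]_n) e (y : 'rV[R]_n) i : 0 < e -> e <= `|y 0 i - y0 0 i| -> plateau_box y0 e y = 0.
Proof.
move=> e0 yi; rewrite /plateau_box (bigD1 i)//= plateau0 ?mul0r//.
by rewrite normrM normfV (gtr0_norm e0) ler_pdivlMr// mul1r.
Qed.

Lemma plateau_box1 n (y0 : 'rV[R]_n) e (y : 'rV[R]_n) : 0 < e ->
  (forall i, `|y 0 i - y0 0 i| <= e / 2) -> plateau_box y0 e y = 1.
Proof.
move=> e0 yi; rewrite /plateau_box big1// => i _; rewrite plateau1//.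
by rewrite normrM normfV (gtr0_norm e0) ler_pdivrMr// mulrC.
Qed.

Lemma plateau_box_near n (y0 : 'rV[R]_n) e : 0 < e -> \forall y \near y0, plateau_box y0 e y = 1.
Proof.
move=> e0; have e2 : 0 < e / 2 by rewrite divr_gt0.
have H : nbhs y0 [set y : 'rV[R]_n | forall i, `|y 0 i - y0 0 i| <= e / 2].
  apply: (@near_all 'rV[R]_n 'I_n (fun i y => `|y 0 i - y0 0 i| <= e / 2)) => i.
  apply: (continuous_near_le (f := fun y : 'rV[R]_n => y 0 i)) => //.
  exact: coord_continuous.
by apply: filterS H => y Hy; exact: plateau_box1.
Qed.

(** The supports of plateaus form a basis of neighbourhoods. *)
Lemma plateau_box_small n (y0 : 'rV[R]_n) (U : set 'rV[R]_n) : nbhs y0 U ->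
  exists2 e, 0 < e & forall y, plateau_box y0 e y != 0 -> U y.
Proof.
case=> P PM sPU.
have [e e0 He] : exists2 e : R, 0 < e & forall i (z : R), `|z - y0 0 i| < e -> P 0 i z.
  have H i : \forall e \near (0 : R)^'+, forall z : R, `|z - y0 0 i| < e -> P 0 i z.
    have /nbhs_ballP[e /= e0 He] := PM 0 i.
    near=> d => z zd; apply: He; rewrite /ball /= distrC; apply: lt_trans zd _.
    by near: d; exact: nbhs_right_lt.
  have H2 : \forall e \near (0 : R)^'+, forall i (z : R), `|z - y0 0 i| < e -> P 0 i z.
    exact: filter_forall.
  have H3 : \forall e \near (0 : R)^'+, 0 < e by exact: nbhs_right_gt.
  by have [e [? ?]] := filter_ex (filterI H3 H2); exists e.
exists e => // y yn0; apply: sPU => j i; rewrite ord1; apply: He.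
rewrite ltNge; apply: contra yn0 => h; apply/eqP; exact: plateau_box0 h.
Unshelve. all: by end_near. Qed.

(** In F / S = F S / S^2 the denominator is replaced by S^2 + (1 - chi)^2, for a
    plateau chi supported where S does not vanish: this is positive everywhere and
    equal to S^2 near u0. *)
Lemma Ck_local_div N m (F S : 'rV[R]_N -> R) u0 : (forall m, Ck m F) -> (forall m, Ck m S) ->
  S u0 != 0 -> exists g, Ck m g /\ \forall u \near u0, F u / S u = g u.
Proof.
move=> HF HS S0.
have [e e0 He] : exists2 e, 0 < e & forall u, plateau_box u0 e u != 0 -> S u != 0.
  apply: (plateau_box_small (U := [set u | S u != 0])).
  exact: (continuous_neq0 (Ck_cont (HS 0%N)) S0).
pose q u := S u * S u + (1 - plateau_box u0 e u) * (1 - plateau_box u0 e u).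
have q0 u : 0 < q u.
  have [b0|b1] := eqVneq (plateau_box u0 e u) 0; rewrite /q.
    by rewrite b0 subr0 mulr1 ltr_wpDl// -expr2 sqr_ge0.
  by rewrite -!expr2 ltr_wpDr ?sqr_ge0// exprn_even_gt0//= He.
have Hq : Ck m q.
  have Hb : Ck m (fun u => 1 - plateau_box u0 e u).
    by apply: CkD; [exact: Ck_cst|apply: CkN; exact: Ck_plateau_box].
  by apply: CkD; apply: CkM.
exists (fun u => F u * S u * (q u)^-1); split.
  by apply: CkM; [exact: CkM|exact: Ck_inv].
have H1 := plateau_box_near u0 e0.
have H2 : \forall u \near u0, S u != 0.
  exact: (continuous_neq0 (Ck_cont (HS 0%N)) S0).
apply: filterS (filterI H1 H2) => u [b1 Su]; rewrite /q b1 subrr mulr0 addr0.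
by field.
Qed.

Lemma Ck_sin_coord N m (c : R) (i : 'I_N) : Ck m (fun u : 'rV[R]_N => sin (c * u 0 i)).
Proof. by apply: (proj2 (Ck_trig _)); apply: CkM; [exact: Ck_cst|exact: Ck_coord]. Qed.

Lemma derive_sin_coord N (c : R) (i : 'I_N) (u : 'rV[R]_N) :
  is_derive u (evec i) (fun u : 'rV[R]_N => sin (c * u 0 i)) (c * cos (c * u 0 i)).
Proof.
have D : is_derive u (evec i) (fun u : 'rV[R]_N => c * u 0 i) c.
  apply: is_derive_eq (linear_is_derive (f := fun u : 'rV[R]_N => c * u 0 i) u (evec i) _) _.
    by move=> h w z; rewrite !mxE; ring.
  by rewrite mxE !eqxx mulr1.
by apply: is_derive_eq (is_derive_comp1 (is_derive_sin _) D) _; rewrite mulrC.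
Qed.

(** Both F and the sine vanish on the hyperplanes c u_i in pi Z, the sine to
    first order, so Hadamard's lemma makes the quotient smooth across them. *)
Lemma Ck_div_sin N (c : R) (i : 'I_N) (F : 'rV[R]_N -> R) : c != 0 ->
  (forall m, Ck m F) -> (forall u : 'rV_N, sin (c * u 0 i) = 0 -> F u = 0) ->
  forall m, Ck m (fun u => if sin (c * u 0 i) == 0 then 'D_(evec i) F u / (c * cos (c * u 0 i))
                           else F u / sin (c * u 0 i)).
Proof.
move=> c0 HF F0 m; apply: Ck_local => u0.
have HS m' : Ck m' (fun u : 'rV[R]_N => sin (c * u 0 i)) by exact: Ck_sin_coord.
have [s0|sn0] := eqVneq (sin (c * u0 0 i)) 0; last first.
  have [g [Hg Eg]] := Ck_local_div m HF HS sn0; exists g; split=> //.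
  have H2 : nbhs u0 [set u : 'rV[R]_N | sin (c * u 0 i) != 0].
    exact: (continuous_neq0 (Ck_cont (HS 0%N)) sn0).
  by apply: filterS (filterI Eg H2) => u [<- /negbTE ->].
pose a := u0 0 i.
have updi u : upd u i a 0 i = a by rewrite mxE eqxx.
have [G [HG FG GD]] := Hadamard HF (fun u => F0 (upd u i a) ltac:(by rewrite updi)).
have [S [HS' SS SD]] := Hadamard HS (fun u => ltac:(by rewrite updi) : sin (c * upd u i a 0 i) = 0).
have ccos0 : c * cos (c * a) != 0.
  rewrite mulf_neq0//; apply/eqP => cc0.
  by have := cos2Dsin2 (c * a); rewrite cc0 s0 expr0n addr0 => /eqP; rewrite eq_sym oner_eq0.
have Sa (u : 'rV[R]_N) : u 0 i = a -> S u = c * cos (c * a).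
  move=> ua; rewrite -(upd_id u i) ua SD.
  by rewrite (@derive_val _ _ _ _ _ _ _ (derive_sin_coord c i _)) updi.
have Su0 : S u0 != 0 by rewrite Sa.
have [g [Hg Eg]] := Ck_local_div m HG HS' Su0; exists g; split=> //.
have H2 : \forall u \near u0, S u != 0.
  exact: (continuous_neq0 (Ck_cont (HS' 0%N)) Su0).
apply: filterS (filterI Eg H2) => u [<- Su].
rewrite SS mulf_eq0 (negbTE Su) orbF subr_eq0.
case: eqP => [ua|/eqP ua].
  by have Eu : upd u i a = u by [rewrite -ua upd_id]; rewrite ua Sa// -[in RHS]Eu GD Eu.
have d0 : u 0 i - a != 0 by [rewrite subr_eq0]; by rewrite FG -mulf_div divff// mul1r.
Qed.

End Plateau.

(** * A gauge adapted to the derivatives along x, and the Weil-Brezin transform *)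

Section Phase.
Context {R : realType}.

Lemma cis0 : cis 0 = 1 :> R[i].
Proof. by rewrite /cis cos0 sin0. Qed.

Lemma cisN (a : R) : cis a * cis (- a) = 1.
Proof. by rewrite -cisD subrr cis0. Qed.

Lemma cis_natr (a : R) m : cis (m%:R * a) = cis a ^+ m.
Proof.
elim: m => [|m IH]; first by rewrite mul0r cis0 expr0.
by rewrite -natr1 mulrDl mul1r cisD IH exprSr.
Qed.

Lemma cis_conj (a : R) : (cis a)^* = cis (- a).
Proof. by rewrite /cis cosN sinN. Qed.

Lemma expi2pi_conj (a : R) : (expi2pi a)^* = expi2pi (- a).
Proof. by rewrite /expi2pi cis_conj mulrN. Qed.

Lemma norm_cis (a : R) : `|cis a| = 1.
Proof. by rewrite normc_def /= cos2Dsin2 sqrtr1. Qed.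

(** The sign alpha of the multiplier is exp(pi sqrt(-1) z) for an integer z. *)
Lemma exprz_cis (z : int) : (-1) ^ z * cis (- (pi * z%:~R)) = 1 :> R[i].
Proof.
have H (m : nat) : (-1) ^+ m = cis (pi * m%:R) :> R[i].
  by rewrite mulrC cis_natr; congr (_ ^+ _); rewrite /cis cospi sinpi; apply/eqP; rewrite eq_complex /= oppr0 !eqxx.
case: z => m; first by rewrite -exprnP H -pmulrn cisN.
have -> : (Negz m)%:~R = - m.+1%:R :> R by rewrite NegzE mulrNz -pmulrn.
rewrite -[(-1) ^ _]/(((-1) ^+ m.+1)^-1) mulrN opprK H.
have := cisN (pi * m.+1%:R : R); set a := cis _; set b := cis (- _) => ab.
have a0 : a != 0 by apply/eqP => a0; move: ab; rewrite a0 mul0r => /eqP; rewrite eq_sym oner_eq0.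
by rewrite mulVf.
Qed.

End Phase.

Lemma is_derive_affine {R : realType} (a b x : R) :
  is_derive x 1 (fun t : R => t * a + b) a.
Proof.
apply: is_derive_eq (is_deriveD (is_deriveM (is_derive_id x 1) (is_derive_cst a x 1)) (is_derive_cst b x 1)) _.
by rewrite /GRing.scale /=; ring.
Qed.

Section WForm.
Context {R : realType} {n k : nat}.
Implicit Types (u v : 'rV[R]_(n + n)) (w : 'rV[R]_(n + n) -> R[i]) (l : 'rV[int]_(n + n)).
Notation lx := (lshift n).
Notation ry := (rshift n).

Definition dxy u : R := \sum_(i < n) u 0 (lx i) * u 0 (ry i).

Definition ldot l u : R := \sum_(i < n) (l 0 (lx i))%:~R * u 0 (ry i).

(** In the gauge where the connection form is a multiple of sum_j x^j dy^j the
    covariant derivative along x^j is the partial derivative, and sections become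
    functions periodic in y. *)
Definition wsection w : Prop :=
  smooth w /\ forall u l, w (u + intvec l) = expi2pi (- (k%:R * ldot l u)) * w u.

Definition wform w : 'rV[R]_(n + n) -> R[i] :=
  fun u => cis (- (k%:R * pi) * dxy u) * w u.

Lemma Ck_dxy m (c : R) : Ck m (fun u => c * dxy u).
Proof.
apply: CkM; first exact: Ck_cst.
by apply: Ck_sum => i; apply: CkM; exact: Ck_coord.
Qed.

Lemma smooth_cis_dxy (c : R) : smooth (fun u => cis (c * dxy u)).
Proof. by apply: smooth_cis => m; exact: Ck_dxy. Qed.

Lemma dxyD u l : dxy (u + intvec l) =
  dxy u + ldot l u + \sum_(i < n) u 0 (lx i) * (l 0 (ry i))%:~R
  + (\sum_(i < n) l 0 (lx i) * l 0 (ry i))%:~R.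
Proof.
rewrite /dxy /ldot [in RHS]rmorph_sum -!big_split /=; apply: eq_bigr => i _.
by rewrite !mxE rmorphM /=; ring.
Qed.

Lemma omega_intvec u l : omega u (intvec l) =
  ldot l u - \sum_(i < n) u 0 (lx i) * (l 0 (ry i))%:~R.
Proof.
rewrite /omega /ldot -sumrB; apply: eq_bigr => i _.
by rewrite !mxE; ring.
Qed.

(** The quadratic gauge factor absorbs the sign alpha and the part of the
    multiplier that depends on x. *)
Lemma gauge_factor u l :
  cis (- (k%:R * pi) * dxy (u + intvec l)) *
  (alpha l ^+ k * cis (- (k%:R * pi) * omega u (intvec l))) =
  expi2pi (- (k%:R * ldot l u)) * cis (- (k%:R * pi) * dxy u) :> R[i].
Proof.
rewrite dxyD omega_intvec; set S := \sum_(i < n) l _ _ * _; set T := \sum_(i < n) u _ _ * _.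
have E : alpha l ^+ k * cis (- (k%:R * pi) * S%:~R) = 1 :> R[i].
  rewrite (_ : - (k%:R * pi) * S%:~R = k%:R * - (pi * S%:~R)); last by ring.
  by rewrite cis_natr -exprMn /alpha -/S exprz_cis expr1n.
transitivity (alpha l ^+ k * cis (- (k%:R * pi) * S%:~R) *
   (expi2pi (- (k%:R * ldot l u)) * cis (- (k%:R * pi) * dxy u)) : R[i]); last by rewrite E mul1r.
rewrite mulrCA -mulrA; congr (_ * _); rewrite /expi2pi -!cisD; congr cis.
by ring.
Qed.

Lemma wform_section (t : section R n k) : wsection (wform t).
Proof.
split; first by apply: smoothM; [exact: smooth_cis_dxy|exact: section_smooth].
by move=> u l; rewrite /wform section_qp mulrA gauge_factor mulrA.
Qed.

Lemma wsection_quasi_periodic w : wsection w ->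
  (fun u => cis (k%:R * pi * dxy u) * w u) \in @section_pred R n k.
Proof.
move=> [sw qw]; apply/asboolP; split; first by apply: smoothM => //; exact: smooth_cis_dxy.
move=> u l; rewrite qw.
have H := gauge_factor u l; have H1 := cisN (k%:R * pi * dxy (u + intvec l)).
have H2 := cisN (k%:R * pi * dxy u); rewrite !mulNr in H H1 H2 *.
move: H H1 H2; move: (cis (k%:R * pi * dxy (u + intvec l))) (cis (- _)) => a a' H aa'.
move: (cis (k%:R * pi * dxy u)) (cis (- (k%:R * pi * dxy u))) H => b b' H bb'.
set E := _ * cis _ in H *.
transitivity (a * (expi2pi (- (k%:R * ldot l u)) * (b' * b)) * w u).
  by rewrite [b' * b]mulrC bb' mulr1; ring.
rewrite [expi2pi _ * _]mulrA -H.
transitivity ((a * a') * E * b * w u); first by ring.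
by rewrite aa' mul1r mulrA.
Qed.

Definition of_wform w (Hw : wsection w) : section R n k :=
  Section_ (wsection_quasi_periodic Hw).

Lemma wform_of_wform w (Hw : wsection w) : wform (of_wform Hw) = w.
Proof.
apply/funext => u; rewrite /wform /= mulrA mulrC mulNr.
by rewrite [cis (- _) * _]mulrC cisN mulr1.
Qed.

Lemma wformE (t : section R n k) u : t u = cis (k%:R * pi * dxy u) * wform t u.
Proof. by rewrite /wform mulrA mulNr cisN mul1r. Qed.

Lemma wform_inj (t1 t2 : section R n k) : wform t1 = wform t2 -> t1 = t2.
Proof. by move=> E; apply: val_inj; apply/funext => u /=; rewrite !wformE E. Qed.

Lemma wformZD a (t1 t2 : section R n k) u :
  wform (a *: t1 + t2) u = a * wform t1 u + wform t2 u.
Proof. by rewrite /wform /= mulrDr mulrCA. Qed.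

Lemma is_derive_dxy (c : R) (j : 'I_n) u :
  is_derive u (evec (lx j)) (fun v => c * dxy v) (c * u 0 (ry j)).
Proof.
apply/is_derive_lineP.
rewrite (_ : (fun t : R => _) = (fun t : R => t * (c * u 0 (ry j)) + c * dxy u)).
  exact: is_derive_affine.
apply/funext => t; rewrite /dxy [X in c * X](_ : _ = t * u 0 (ry j) + \sum_(i < n) u 0 (lx i) * u 0 (ry i)); first by ring.
rewrite [in RHS](bigD1 j)//= (bigD1 j)//= !mxE !eqxx /=.
rewrite (_ : (rshift n j == lshift n j) = false); last by rewrite eq_rlshift.
rewrite mulr1 mulr0 add0r addrA; congr (_ + _); first by ring.
apply: eq_bigr => i ij; rewrite !mxE eqxx /= eq_lshift (negbTE ij) eq_rlshift.
by rewrite !mulr0 !add0r.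
Qed.

(** The logarithmic derivative of the gauge factor along x_j is the value of the
    connection form on that direction. *)
Lemma wform_nabla (j : 'I_n) (t : section R n k) :
  wform (nabla_section (lx j) t) = pdiff (lx j) (wform t).
Proof.
apply/funext => u; rewrite /wform pdiffM; [|exact: smooth_cis_dxy|exact: section_smooth].
rewrite (pdiff_cis (is_derive_dxy (- (k%:R * pi)) j u)) /=.
have -> : omega u (evec (lx j)) = u 0 (ry j).
  rewrite /omega (bigD1 j)//= !mxE !eqxx /= eq_rlshift mulr1 mulr0 subr0.
  rewrite big1 ?addr0// => i ij; rewrite !mxE eqxx /= eq_lshift (negbTE ij) eq_rlshift.
  by rewrite !mulr0 subr0.
rewrite mulrBr !rmorphM rmorphN /= !rmorphM /=; ring.
Qed.

Lemma row_mx_line (x y : 'rV[R]_n) j (t : R) :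
  t *: evec (lx j) + row_mx x y = row_mx (t *: evec j + x) y.
Proof.
apply/rowP => i; case: (split_ordP i) => i' ->; rewrite [LHS]mxE ?row_mxEl ?row_mxEr !mxE eqxx /=.
  by rewrite eq_lshift.
by rewrite eq_rlshift mulr0 add0r.
Qed.

Lemma is_derive_row_mx (f : 'rV[R]_(n + n) -> R) j (x y : 'rV[R]_n) d :
  is_derive (row_mx x y) (evec (lx j)) f d ->
  is_derive x (evec j) (fun x => f (row_mx x y)) d.
Proof.
move=> /is_derive_lineP H; apply/is_derive_lineP.
by move: H; under eq_fun do rewrite row_mx_line.
Qed.

Lemma continuous_row_mx (y : 'rV[R]_n) : continuous (fun x : 'rV[R]_n => row_mx x y).
Proof.
apply: continuous_row => i; case: (split_ordP i) => i' ->.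
  by under eq_fun do rewrite row_mxEl; exact: coord_continuous.
by under eq_fun do rewrite row_mxEr; exact: cst_continuous.
Qed.

Lemma Ck_row_mx m (f : 'rV[R]_(n + n) -> R) (y : 'rV[R]_n) :
  Ck m f -> Ck m (fun x => f (row_mx x y)).
Proof.
elim: m f => [|m IH] f Hf0; case: (Hf0) => cf Hf;
  (split; first exact: (continuous_compose (@continuous_row_mx y) cf)) => // i.
have [df Ddf] := Hf (lx i).
have D x := is_derive_row_mx (derivableP (df (row_mx x y))).
split; first by move=> u; exact: (@ex_derive _ _ _ _ _ _ _ (D u)).
by apply: Ck_ext (IH _ Ddf) => x; rewrite (@derive_val _ _ _ _ _ _ _ (D x)).
Qed.

Lemma smooth_row_mx w (y : 'rV[R]_n) : smooth w -> smooth (fun x => w (row_mx x y)).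
Proof.
move=> sw m; have [? ?] := sw m; split.
  exact: (Ck_row_mx (f := fun u => complex.Re (w u))).
exact: (Ck_row_mx (f := fun u => complex.Im (w u))).
Qed.

Lemma pdiff_row_mx w j (x y : 'rV[R]_n) : smooth w ->
  pdiff j (fun x => w (row_mx x y)) x = pdiff (lx j) w (row_mx x y).
Proof.
move=> sw; have [d1 d2] := smooth_derivable (lx j) (row_mx x y) sw.
rewrite /pdiff.
by rewrite (@derive_val _ _ _ _ _ _ _ (is_derive_row_mx (derivableP d1)))
  (@derive_val _ _ _ _ _ _ _ (is_derive_row_mx (derivableP d2))).
Qed.

End WForm.

Arguments wsection {R n} k w.
Arguments wform {R n} k w.

Section WeilBrezin.
Context {R : realType} {n k : nat}.
Hypothesis k_gt0 : (0 < k)%N.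
Implicit Types (t : section R n k) (m : @Zk n k) (y : 'rV[R]_n).
Notation lx := (lshift n).
Notation ry := (rshift n).

Let k0 : k%:R != 0 :> R.
Proof. by rewrite pnatr_eq0 -lt0n. Qed.

Lemma dotC (x y : 'rV[R]_n) : dot x y = dot y x.
Proof. by apply: eq_bigr => i _; rewrite mulrC. Qed.

Lemma dotDr (x y z : 'rV[R]_n) : dot x (y + z) = dot x y + dot x z.
Proof. by rewrite /dot -big_split; apply: eq_bigr => i _; rewrite mxE mulrDr. Qed.

Lemma dotZr (x y : 'rV[R]_n) a : dot x (a *: y) = a * dot x y.
Proof. by rewrite /dot mulr_sumr; apply: eq_bigr => i _; rewrite mxE; ring. Qed.

Lemma dotNr (x y : 'rV[R]_n) : dot x (- y) = - dot x y.
Proof. by rewrite /dot -sumrN; apply: eq_bigr => i _; rewrite mxE; ring. Qed.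

Lemma dot0r (x : 'rV[R]_n) : dot x 0 = 0.
Proof. by rewrite /dot big1// => i _; rewrite mxE mulr0. Qed.

Lemma dxy_row_mx (x y : 'rV[R]_n) : dxy (row_mx x y) = dot x y.
Proof. by apply: eq_bigr => i _; rewrite row_mxEl row_mxEr. Qed.

(** The point at which the m-th Weil-Brezin coefficient samples the section. *)
Definition wb_arg m y := y + k%:R^-1 *: @repr_Zk R n k m.

Lemma weil_brezinE t m y :
  weil_brezin t m y =
  cint `[0, 1] (fun x => expi2pi (k%:R * dot x y) * wform k t (row_mx x (wb_arg m y))).
Proof.
apply: eq_cint => x _; rewrite wformE dxy_row_mx -/(wb_arg m y) mulrA mulrAC; congr (_ * _).
rewrite /expi2pi -!cisD; congr cis.
rewrite /wb_arg dotDr dotZr (dotC (repr_Zk m)).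
by field; exact: k0.
Qed.

Lemma smooth_wb t m y : smooth (fun x => expi2pi (k%:R * dot x y) * wform k t (row_mx x (wb_arg m y))).
Proof.
apply: smoothM; last by apply: smooth_row_mx; case: (wform_section t).
apply: smooth_cis => m'; apply: CkM; first exact: Ck_cst.
apply: CkM; first exact: Ck_cst.
by apply: Ck_sum => i; apply: CkM; [exact: Ck_coord|exact: Ck_cst].
Qed.

Lemma weil_brezin_lin a t1 t2 m y :
  weil_brezin (a *: t1 + t2) m y = a * weil_brezin t1 m y + weil_brezin t2 m y.
Proof.
rewrite !weil_brezinE -cint_lin//; try exact/smooth_ccontinuous/smooth_wb.
by apply: eq_cint => x _; rewrite wformZD; ring.
Qed.

Lemma weil_brezin0 t m : weil_brezin t m 0 =
  cint `[0, 1] (fun x => wform k t (row_mx x (k%:R^-1 *: repr_Zk m))).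
Proof.
rewrite weil_brezinE; apply: eq_cint => x _.
by rewrite dot0r mulr0 expi2pi0 mul1r /wb_arg add0r.
Qed.

Lemma evec_intvec j : @evec R (n + n) j = intvec (delta_mx 0 j).
Proof. by apply/rowP => i; rewrite !mxE; case: (_ && _). Qed.

(** At y_j = m_j / k the multiplier e(- k y_j) is 1, so the integrand is the
    derivative of a function periodic in x_j. *)
Lemma weil_brezin_nabla j t m : weil_brezin (nabla_section (lx j) t) m 0 = 0.
Proof.
have [sw qw] := wform_section t.
rewrite weil_brezin0 wform_nabla.
pose y := k%:R^-1 *: @repr_Zk R n k m.
rewrite -[RHS](@cint_periodic_derive _ _ j (fun x => wform k t (row_mx x y))).
- by apply: eq_cint => x _; rewrite pdiff_row_mx.
- exact: smooth_row_mx.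
- move=> x; have := row_mx_line x y j 1; rewrite !scale1r addrC evec_intvec [_ + x]addrC => <-.
  rewrite qw (_ : expi2pi _ = 1) ?mul1r//.
  rewrite (_ : - (k%:R * _) = (- (m j : nat)%:Z)%:~R) ?expi2pi_int//.
  rewrite /ldot (bigD1 j)//= row_mxEr big1 ?addr0; last first.
    by move=> i ij; rewrite !mxE eqxx /= eq_lshift (negbTE ij) mul0r.
  by rewrite !mxE !eqxx mul1r mulrA divff// mul1r mulrNz -pmulrn.
Qed.

Lemma wform_mul (f : smoothX R n) t u : wform k (mul_section f t) u = f u * wform k t u.
Proof. by rewrite /wform /= mulrCA. Qed.

Lemma weil_brezin_f i t m y : weil_brezin (mul_section (f_ i) t) m y =
  expi2pi (wb_arg m y 0 i) * weil_brezin t m y.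
Proof.
rewrite !weil_brezinE -cintZ//; last exact/smooth_ccontinuous/smooth_wb.
by apply: eq_cint => x _; rewrite wform_mul /= row_mxEr mulrCA.
Qed.

Definition pred_Zk (i : 'I_n) m : @Zk n k := [ffun j => if j == i then ord_pred (m j) else m j].

(** The cyclic predecessor subtracts 1 up to a multiple of k, which corresponds
    to a period in y. *)
Lemma ord_predE (p : 'I_k) : exists q : int, (ord_pred p)%:R = p%:R - 1 + k%:R * q%:~R :> R.
Proof.
case: p => -[|p] pk /=.
  by exists 1; rewrite add0n modn_small ?prednK// -subn1 natrB//; ring.
exists 0; rewrite modnDr modn_small ?(ltn_trans (ltnSn p) pk)// -natr1; ring.
Qed.

Lemma wform_periodic_y t (x y : 'rV[R]_n) (l : 'rV[int]_n) :
  wform k t (row_mx x (y + map_mx intr l)) = wform k t (row_mx x y).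
Proof.
have [_ qw] := wform_section t.
have -> : row_mx x (y + map_mx intr l) = row_mx x y + intvec (row_mx 0 l).
  by rewrite /intvec map_row_mx add_row_mx map_mx0 addr0.
rewrite qw (_ : ldot _ _ = 0) ?mulr0 ?oppr0 ?expi2pi0 ?mul1r//.
by rewrite /ldot big1// => i _; rewrite row_mxEl mxE mul0r.
Qed.

(** The factor e(x_i) translates y by e_i / k in the phase e(k x.y), and lowering m_i
    by one keeps the argument y + m / k of the section unchanged. *)
Lemma weil_brezin_g i t m y : weil_brezin (mul_section (g_ i) t) m y =
  weil_brezin t (pred_Zk i m) (y + k%:R^-1 *: evec i).
Proof.
rewrite !weil_brezinE; apply: eq_cint => x _; rewrite wform_mul /= row_mxEl mulrA; congr (_ * _).
  rewrite -expi2piD; congr expi2pi; rewrite dotDr dotZr mulrDr mulrA divff// mul1r; congr (_ + _).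
  rewrite /dot (bigD1 i)//= !mxE !eqxx mulr1 big1 ?addr0// => j ji.
  by rewrite !mxE eqxx (negbTE ji) mulr0.
have [q Hq] := ord_predE (m i).
rewrite -(@wform_periodic_y t x (wb_arg m y) (q *: delta_mx 0 i)); congr (wform k t (row_mx x _)).
apply/rowP => j; rewrite !mxE eqxx /= !ffunE; case: eqP => [->|_].
  by rewrite Hq mulr1 /=; field; exact: k0.
by rewrite !mulr0 !addr0.
Qed.

End WeilBrezin.

(** * Primitives of sections along one coordinate *)

Section Integral01.
Context {R : realType}.
Notation mu := (@lebesgue_measure R).

Definition cint01 (g : R -> R[i]) : R[i] :=
  \int[mu]_(x in `[0, 1]) complex.Re (g x) +i* \int[mu]_(x in `[0, 1]) complex.Im (g x).

Lemma cint01_cst c : cint01 (fun=> c) = c.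
Proof. by rewrite /cint01 !itv01_int_cst complex_eta. Qed.

Lemma cint01_lin c (g h : R -> R[i]) : ccontinuous g -> ccontinuous h ->
  cint01 (fun x => c * g x + h x) = c * cint01 g + cint01 h.
Proof.
move=> [g1 g2] [h1 h2]; case: c => c d.
rewrite /cint01; apply/eqP; rewrite eq_complex /=; apply/andP; split; apply/eqP.
- transitivity (\int[mu]_(x in `[0, 1]) (c * complex.Re (g x) + (- d * complex.Im (g x) + complex.Re (h x)))).
    by apply: eq_Rintegral => x _; case: (g x) (h x) => [? ?] [? ?] /=; ring.
  rewrite !itv_int_lin//; first by ring.
  by move=> x; exact: (cvgD (cvgM (cvg_cst _) (g2 x)) (h1 x)).
- transitivity (\int[mu]_(x in `[0, 1]) (c * complex.Im (g x) + (d * complex.Re (g x) + complex.Im (h x)))).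
    by apply: eq_Rintegral => x _; case: (g x) (h x) => [? ?] [? ?] /=; ring.
  rewrite !itv_int_lin//; first by ring.
  by move=> x; exact: (cvgD (cvgM (cvg_cst _) (g1 x)) (h2 x)).
Qed.

Lemma cint010 : cint01 (fun=> 0) = 0.
Proof. exact: cint01_cst. Qed.

Lemma cint01Z c (g : R -> R[i]) : ccontinuous g ->
  cint01 (fun x => c * g x) = c * cint01 g.
Proof.
move=> cg; have := cint01_lin c cg (ccontinuous_cst _ 0).
by rewrite cint010 addr0 => <-; congr cint01; apply/funext => v; rewrite addr0.
Qed.

Lemma ccontinuous_sum (T : topologicalType) (I : Type) (r : seq I) (g : I -> T -> R[i]) :
  (forall i, ccontinuous (g i)) -> ccontinuous (fun x => \sum_(i <- r) g i x).
Proof.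
move=> cg; elim: r => [|i r IH].
  by under eq_fun do rewrite big_nil; exact: ccontinuous_cst.
by under eq_fun do rewrite big_cons; exact: ccontinuousD.
Qed.

Lemma cint01_sum (I : Type) (r : seq I) (g : I -> R -> R[i]) :
  (forall i, ccontinuous (g i)) ->
  cint01 (fun x => \sum_(i <- r) g i x) = \sum_(i <- r) cint01 (g i).
Proof.
move=> cg; elim: r => [|i r IH].
  by under eq_fun do rewrite big_nil; rewrite big_nil cint010.
under eq_fun do rewrite big_cons; rewrite big_cons -IH -[X in _ = X + _]mul1r -cint01_lin//.
  by congr cint01; apply/funext => v; rewrite mul1r.
exact: ccontinuous_sum.
Qed.

Context {N : nat}.
Implicit Types (w : 'rV[R]_N -> R[i]) (u : 'rV[R]_N).

Section Param.
Variables (a b : R -> 'I_N -> R).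
Hypotheses (ca : forall i, continuous (a ^~ i)) (cb : forall i, continuous (b ^~ i)).

Lemma smooth_param w : smooth w ->
  smooth (fun u => cint01 (fun x => w (\row_i (a x i * u 0 i + b x i)))).
Proof.
have c1 : continuous (fun _ : R => 1 : R) by exact: cst_continuous.
move=> sw m; have [H1 H2] := sw m; split => /=.
  have := Ck_param ca cb c1 H1.
  by apply: Ck_ext => u; apply: eq_Rintegral => x _; rewrite mul1r.
have := Ck_param ca cb c1 H2.
by apply: Ck_ext => u; apply: eq_Rintegral => x _; rewrite mul1r.
Qed.

Lemma ccontinuous_param w u : smooth w ->
  ccontinuous (fun x => w (\row_i (a x i * u 0 i + b x i))).
Proof.
have c1 : continuous (fun _ : R => 1 : R) by exact: cst_continuous.
move=> /smooth_ccontinuous [H1 H2]; split.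
  rewrite (_ : (fun x => _) = (fun x => 1 * complex.Re (w (\row_i (a x i * u 0 i + b x i))))).
    exact: (continuous_param (u := u) ca cb c1 H1).
  by apply/funext => x; rewrite mul1r.
rewrite (_ : (fun x => _) = (fun x => 1 * complex.Im (w (\row_i (a x i * u 0 i + b x i))))).
  exact: (continuous_param (u := u) ca cb c1 H2).
by apply/funext => x; rewrite mul1r.
Qed.

End Param.

Lemma smooth_diag (a b : 'I_N -> R) w : smooth w ->
  smooth (fun u => w (\row_i (a i * u 0 i + b i))).
Proof.
move=> sw m; have [H1 H2] := sw m; split.
  exact: (Ck_diag a b H1).
exact: (Ck_diag a b H2).
Qed.

Section Upd.
Variable i : 'I_N.
Let a (x : R) l : R := if l == i then 0 else 1.
Let b (x : R) l : R := if l == i then x else 0.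
Let ca l : continuous (a ^~ l).
Proof. exact: cst_continuous. Qed.
Let cb l : continuous (b ^~ l).
Proof. by rewrite /b; case: eqP => _; [move=> x; exact: cvg_id|exact: cst_continuous]. Qed.
Let updE u x : upd u i x = \row_l (a x l * u 0 l + b x l).
Proof. by apply/rowP => l; rewrite !mxE /a /b; case: eqP => _; ring. Qed.

Lemma smooth_upd_int w : smooth w -> smooth (fun u => cint01 (fun x => w (upd u i x))).
Proof.
move=> sw; have := smooth_param ca cb sw.
by congr smooth; apply/funext => u; congr cint01; apply/funext => x; rewrite updE.
Qed.

Lemma ccontinuous_upd w u : smooth w -> ccontinuous (fun x => w (upd u i x)).
Proof.
move=> sw; have := ccontinuous_param ca cb u sw.
by congr ccontinuous; apply/funext => x; rewrite updE.
Qed.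

Lemma smooth_upd w x : smooth w -> smooth (fun u => w (upd u i x)).
Proof.
move=> sw; have := smooth_diag (a x) (b x) sw.
by congr smooth; apply/funext => u; rewrite updE.
Qed.
End Upd.

Lemma updD u i x l : (l != i) -> upd (u + evec l) i x = upd u i x + evec l.
Proof.
move=> li; apply/rowP => m; rewrite !mxE eqxx /=.
by case: (eqVneq m i) => // ->; rewrite eq_sym (negbTE li) addr0.
Qed.

(** prim f u is the integral of f from u_i = 0 along the i-th coordinate, with
    the segment rescaled to [0, 1]. *)
Definition prim (i : 'I_N) (f : 'rV[R]_N -> R) u : R :=
  u 0 i * \int[mu]_(x in `[0, 1]) (1 * f (\row_l ((if l == i then x else 1) * u 0 l + 0))).

Section Prim.
Variables (i : 'I_N) (f : 'rV[R]_N -> R).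
Hypothesis Hf : forall m, Ck m f.

Let a (x : R) l : R := if l == i then x else 1.
Let ca l : continuous (a ^~ l).
Proof. by rewrite /a; case: eqP => _; [move=> x; exact: cvg_id|exact: cst_continuous]. Qed.
Let cb (l : 'I_N) : continuous (fun _ : R => 0 : R).
Proof. exact: cst_continuous. Qed.
Let c1 : continuous (fun _ : R => 1 : R).
Proof. exact: cst_continuous. Qed.

Lemma Ck_prim m : Ck m (prim i f).
Proof. by apply: CkM; [exact: Ck_coord|exact: (Ck_param ca cb c1 (Hf m))]. Qed.

Let LE u x : \row_l (a x l * u 0 l + 0) = upd u i (x * u 0 i).
Proof. by apply/rowP => l; rewrite !mxE /a; case: eqP => [->|_]; ring. Qed.

(** The rescaled segment moves with u_i; differentiating under the integral
    gives the derivative of x f(x u_i) integrated over [0, 1]. *)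
Lemma derive_prim u : is_derive u (evec i) (prim i f) (f u).
Proof.
have [cf /(_ i) [df Ddf]] := Hf 1.
have Dc : is_derive u (evec i) (fun u : 'rV[R]_N => u 0 i) 1.
  apply: is_derive_eq (linear_is_derive (f := fun u : 'rV[R]_N => u 0 i) u (evec i) _) _.
    by move=> h w z; rewrite !mxE; ring.
  by rewrite mxE !eqxx.
have Dp := param_derive ca cb i u c1 (Hf 1).
have D := is_deriveM Dc Dp; apply: is_derive_eq D _; rewrite /GRing.scale /=.
have c2 : continuous (fun x => 1 * a x i : R).
  by move=> x; apply: (@cvgM R); [exact: cvg_cst|exact: ca].
have K1 := continuous_param (u := u) ca cb c1 cf.
have K2 := continuous_param (u := u) ca cb c2 Ddf.1.
pose h x := u 0 i * (1 * a x i * 'D_(evec i) f (\row_l (a x l * u 0 l + 0))) + 1 * f (\row_l (a x l * u 0 l + 0)).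
have ch : continuous h by move=> x; exact: (cvgD (cvgM (cvg_cst _) (K2 x)) (K1 x)).
have dh (x : R) : is_derive x 1 (fun x => x * f (upd u i (x * u 0 i))) (h x).
  have D1 : is_derive x 1 (fun x : R => x * u 0 i) (u 0 i).
    have := is_derive_affine (u 0 i) 0 x.
    by under [X in is_derive _ _ X _ -> _]eq_fun do rewrite addr0.
  have D2 : is_derive (x * u 0 i) 1 (fun y => f (upd u i y)) ('D_(evec i) f (upd u i (x * u 0 i))).
    by apply: is_derive_upd; apply/derivableP.
  have D3 := @is_derive1_comp _ (fun y => f (upd u i y)) (fun x => x * u 0 i) x _ _ D2 D1.
  have D4 := is_deriveM (is_derive_id x 1) D3.
  apply: is_derive_eq D4 _; rewrite /h LE /GRing.scale /= /a eqxx; ring.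
have := itv_int_FTC ler01 ch dh; rewrite mul0r subr0 !mul1r upd_id => <-.
by rewrite itv_int_lin// mulr1.
Qed.

End Prim.

End Integral01.

(** On ]0, pi[ the sine is positive; the general case follows by translating by
    the integer part. *)
Lemma sin_pi_eq0 {R : realType} (z : R) : sin (pi * z) = 0 -> exists m : int, z = m%:~R.
Proof.
have cs (m : nat) (x : R) : sin (x + pi * m%:R) = 0 -> sin x = 0.
  elim: m x => [|m IH] x; first by rewrite mulr0 addr0.
  by rewrite -natr1 mulrDr mulr1 addrA sinDpi => /eqP; rewrite oppr_eq0 => /eqP /IH.
have cz (m : int) (x : R) : sin (x + pi * m%:~R) = 0 -> sin x = 0.
  case: m => m; first by rewrite -pmulrn; exact: cs.
  rewrite NegzE mulrNz -pmulrn mulrN => H; apply/eqP; rewrite -oppr_eq0 -sinN; apply/eqP.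
  apply: (cs m.+1); apply/eqP; rewrite -oppr_eq0 -sinN; apply/eqP; rewrite -H; congr sin; ring.
move=> sz; exists (Num.floor z).
have fz := floor_le_tmp z; have zf := floorD1_gt z.
have [//|f0] := eqVneq z (Num.floor z)%:~R.
have H : sin (pi * (z - (Num.floor z)%:~R)) = 0.
  by apply: (cz (Num.floor z)); rewrite -sz; congr sin; ring.
have pi0 := pi_gt0 R.
have : 0 < sin (pi * (z - (Num.floor z)%:~R)).
  apply: sin_gt0_pi; rewrite pmulr_rgt0// gtr_pMr// subr_gt0 lt_neqAle eq_sym f0 fz /=.
  by rewrite ltrBlDl -(intrD _ _ 1).
by rewrite H ltxx.
Qed.

Lemma int_periodic {R : realType} N (T : Type) (F : 'rV[R]_N -> T) e :
  (forall u, F (u + e) = F u) -> forall (d : int) u, F (u + d%:~R *: e) = F u.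
Proof.
move=> Fe; have Fn (m : nat) u : F (u + m%:R *: e) = F u.
  elim: m u => [|m IH] u; first by rewrite scale0r addr0.
  by rewrite -natr1 scalerDl scale1r addrA Fe IH.
case=> m u; first by rewrite -pmulrn Fn.
rewrite NegzE mulrNz -pmulrn scaleNr.
by have := Fn m.+1 (u - m.+1%:R *: e); rewrite subrK => ->.
Qed.

Lemma complex_divr {R : realType} (p q r : R) : p / r +i* (q / r) = (p +i* q) / r%:C.
Proof.
by rewrite -fmorphV /=; apply/eqP; rewrite eq_complex /= !mulr0 subr0 add0r !eqxx.
Qed.

Section Gauge.
Context {R : realType} {n k : nat}.
Hypothesis k_gt0 : (0 < k)%N.
Notation lx := (lshift n).
Notation ry := (rshift n).
Implicit Types (u v : 'rV[R]_(n + n)) (w : 'rV[R]_(n + n) -> R[i]) (a : 'I_(n + n)).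

Let k0 : k%:R != 0 :> R.
Proof. by rewrite pnatr_eq0 -lt0n. Qed.

(** The quasi-periodicity factor along the generator evec a of the lattice. *)
Definition mult a u : R[i] :=
  match fintype.split a with inl i => expi2pi (- (k%:R * u 0 (ry i))) | inr _ => 1 end.

Lemma mult_lx i u : mult (lx i) u = expi2pi (- (k%:R * u 0 (ry i))).
Proof. by rewrite /mult -[lx i]/(unsplit (inl i)) unsplitK. Qed.

Lemma mult_ry i u : mult (ry i) u = 1.
Proof. by rewrite /mult -[ry i]/(unsplit (inr i)) unsplitK. Qed.

Lemma expi2piD_int (x : R) (m : int) : expi2pi (x + m%:~R) = expi2pi x.
Proof. by rewrite expi2piD expi2pi_int mulr1. Qed.

(** It suffices to check quasi-periodicity on generators, because the elements l
    of the lattice for which it holds form a group. *)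
Lemma wsectionP w : wsection k w <-> smooth w /\ forall u a, w (u + evec a) = mult a u * w u.
Proof.
split=> [[sw qw]|[sw qw]]; split=> //.
  move=> u a; rewrite evec_intvec qw /ldot; congr (_ * _).
  case: (split_ordP a) => i ->; rewrite ?mult_lx ?mult_ry.
    rewrite (bigD1 i)//= !mxE !eqxx mul1r big1 ?addr0// => j ji.
    by rewrite !mxE eqxx /= eq_lshift (negbTE ji) mul0r.
  rewrite big1 ?mulr0 ?oppr0 ?expi2pi0// => j _.
  by rewrite !mxE eqxx /= eq_lrshift mul0r.
pose P l := forall u, w (u + intvec l) = expi2pi (- (k%:R * ldot l u)) * w u.
have ldotD l l' (u : 'rV[R]_(n + n)) : ldot (l + l') u = ldot l u + ldot l' u.
  by rewrite /ldot -big_split; apply: eq_bigr => i _; rewrite mxE rmorphD /= mulrDl.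
have ldotD2 l l' (u : 'rV[R]_(n + n)) : exists m : int, ldot l (u + intvec l') = ldot l u + m%:~R.
  exists (\sum_(i < n) l 0 (lx i) * l' 0 (ry i)).
  rewrite /ldot rmorph_sum -big_split; apply: eq_bigr => i _.
  by rewrite !mxE rmorphM /= mulrDr.
have intvecD l l' : @intvec R n (l + l') = intvec l + intvec l'.
  by apply/rowP => i; rewrite !mxE rmorphD.
have expm x (m : int) : expi2pi (- (k%:R * (x + m%:~R))) = expi2pi (- (k%:R * x)) :> R[i].
  rewrite mulrDr opprD (_ : - (k%:R * m%:~R) = (- (k%:Z * m))%:~R) ?expi2piD_int//.
  by rewrite mulrNz rmorphM /= -pmulrn.
have PD l l' : P l -> P l' -> P (l + l').
  move=> Hl Hl' u; rewrite intvecD addrA Hl' Hl mulrA -expi2piD; congr (_ * _).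
  have [m ->] := ldotD2 l' l u.
  by rewrite expi2piD expm -expi2piD ldotD; congr expi2pi; ring.
have P0 : P 0.
  move=> u; rewrite (_ : ldot _ _ = 0) ?mulr0 ?oppr0 ?expi2pi0 ?mul1r.
    by congr w; apply/rowP => i; rewrite !mxE addr0.
  by rewrite /ldot big1// => i _; rewrite mxE mul0r.
have PN l : P l -> P (- l).
  move=> Hl u; have := Hl (u + intvec (- l)).
  have [m ->] := ldotD2 l (- l) u.
  have U0 : u + intvec 0 = u by apply/rowP => i; rewrite !mxE addr0.
  rewrite expm -addrA -intvecD addNr U0 => E.
  rewrite [in RHS]E mulrA -expi2piD (_ : - (k%:R * ldot (- l) u) + - (k%:R * ldot l u) = 0) ?expi2pi0 ?mul1r//.
  have : ldot (l - l) u = 0 by rewrite subrr /ldot big1// => i _; rewrite mxE mul0r.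
  by rewrite ldotD => /eqP; rewrite addr_eq0 => /eqP ->; ring.
have Pe a : P (delta_mx 0 a).
  move=> u; rewrite -evec_intvec qw; congr (_ * _); rewrite /ldot.
  case: (split_ordP a) => i ->; rewrite ?mult_lx ?mult_ry.
    rewrite (bigD1 i)//= !mxE !eqxx mul1r big1 ?addr0// => j ji.
    by rewrite !mxE eqxx /= eq_lshift (negbTE ji) mul0r.
  rewrite big1 ?mulr0 ?oppr0 ?expi2pi0// => j _.
  by rewrite !mxE eqxx /= eq_lrshift mul0r.
have PZ (z : int) l : P l -> P (z *: l).
  move=> Hl; have Pn (m : nat) : P (m%:Z *: l).
    elim: m => [|m IH]; first by rewrite scale0r.
    by rewrite (intS m) scalerDl scale1r; exact: PD.
  by case: z => m //; rewrite NegzE scaleNr; exact: PN.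
move=> u l; move: u; rewrite -/(P l) [l]row_sum_delta.
by elim/big_ind: _ => // a _; exact: PZ.
Qed.

Lemma pdiff_line a w u : (forall t : R, w (t *: evec a + u) = w u) -> pdiff a w u = 0.
Proof.
move=> wt; have D (f : 'rV[R]_(n + n) -> R) : (forall t : R, f (t *: evec a + u) = f u) -> 'D_(evec a) f u = 0.
  move=> ft; have H : is_derive u (evec a) f 0.
    apply/is_derive_lineP; under eq_fun do rewrite ft.
    exact: is_derive_cst.
  exact: (@derive_val _ _ _ _ _ _ _ H).
by rewrite /pdiff !D// => t; rewrite wt.
Qed.

Lemma line_coord (a b : 'I_(n + n)) (t : R) u : a != b -> (t *: evec a + u) 0 b = u 0 b.
Proof. by move=> ab; rewrite !mxE eqxx eq_sym (negbTE ab) mulr0 add0r. Qed.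

Lemma evec_coord (a b : 'I_(n + n)) u : a != b -> (u + evec a) 0 b = u 0 b.
Proof. by move=> ab; rewrite addrC -[evec a]scale1r line_coord. Qed.

Section Primitive.
Variables (j : 'I_n) (v : 'rV[R]_(n + n) -> R[i]).
Hypothesis Hv : wsection k v.

Let x := lx j.
Let y := ry j.

Let sv : smooth v. Proof. by case/wsectionP: Hv. Qed.
Let qv u a : v (u + evec a) = mult a u * v u. Proof. by have [_] := (wsectionP v).1 Hv. Qed.
Let vR m : Ck m (fun u => complex.Re (v u)). Proof. by have [] := sv m. Qed.
Let vI m : Ck m (fun u => complex.Im (v u)). Proof. by have [] := sv m. Qed.

Lemma mult_upd a u z : a != x -> mult a (upd u x z) = mult a u.
Proof.
by case: (split_ordP a) => i -> ax; rewrite ?mult_lx ?mult_ry// mxE eq_rlshift.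
Qed.

(** The increment of a primitive along x_j when x_j makes a turn. *)
Definition circle_int u := cint01 (fun z => v (upd u x z)).

Lemma smooth_circle_int : smooth circle_int.
Proof. exact: smooth_upd_int. Qed.

Lemma circle_intD u a : a != x -> circle_int (u + evec a) = mult a u * circle_int u.
Proof.
move=> ax; rewrite /circle_int -cint01Z; last exact: ccontinuous_upd.
by congr cint01; apply/funext => z; rewrite updD// qv mult_upd.
Qed.

Lemma upd_line u z (t : R) : upd (t *: evec x + u) x z = upd u x z.
Proof.
apply/rowP => l; rewrite !mxE eqxx /=.
by case: eqP => // _; rewrite mulr0 add0r.
Qed.

Lemma circle_int_line u (t : R) : circle_int (t *: evec x + u) = circle_int u.
Proof. by congr cint01; apply/funext => z; rewrite upd_line. Qed.

Hypothesis v0 : forall (q : 'I_k) u,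
  cint01 (fun z => v (upd (upd u x z) y (q%:R / k%:R))) = 0.

Let xy : x != y. Proof. by rewrite /x /y eq_lrshift. Qed.

(** A zero of the sine is a point with y_j in (1/k)Z, which differs by a period
    from one of the k points of the hypothesis. *)
Lemma circle_int_eq0 u : sin (k%:R * pi * u 0 y) = 0 -> circle_int u = 0.
Proof.
rewrite mulrAC mulrC => /sin_pi_eq0 [z zE].
have [q [d Hd]] : exists (q : 'I_k) (d : int), u 0 y = q%:R / k%:R + d%:~R.
  have kz : k%:Z != 0 by rewrite eqz_nat -lt0n.
  have q0 := modz_ge0 z kz; have qk := ltz_pmod z (_ : 0 < k%:Z).
  have qlt : (`|(z %% k)%Z| < k)%N by rewrite -ltz_nat gez0_abs// qk// ltz_nat.
  exists (Ordinal qlt), (z %/ k)%Z => /=.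
  have E : z%:~R = (z %/ k)%Z%:~R * k%:R + `|(z %% k)%Z|%N%:R :> R.
    have -> : `|(z %% k)%Z|%N%:R = (z %% k)%Z%:~R :> R by rewrite pmulrn gez0_abs.
    by rewrite {1}(divz_eq z k) rmorphD rmorphM /= -pmulrn.
  apply: (mulfI k0); rewrite zE E; field; exact: k0.
have Hper u' (d' : int) : circle_int (u' + d'%:~R *: evec y) = circle_int u'.
  by apply: int_periodic => u''; rewrite circle_intD ?mult_ry ?mul1r// eq_sym.
have -> : u = upd u y (q%:R / k%:R) + d%:~R *: evec y.
  apply/rowP => l; rewrite !mxE eqxx /=; case: eqP => [->|_]; first by rewrite Hd mulr1.
  by rewrite mulr0 addr0.
rewrite Hper -[RHS](v0 q u); congr cint01; apply/funext => z'; congr v.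
by apply/rowP => l; rewrite !mxE; case: eqP => // -> ; rewrite (negbTE xy).
Qed.

Let theta u : R := k%:R * pi * u 0 y.

Let c0 : k%:R * pi != 0 :> R.
Proof. by rewrite mulf_neq0// gt_eqF// pi_gt0. Qed.

Let mult_sub1 u : mult x u - 1 = cis (- theta u) * (- 2 * 'i * (sin (theta u))%:C).
Proof.
rewrite mult_lx /expi2pi (_ : 2 * pi * _ = - theta u + - theta u); last by rewrite /theta /y; ring.
rewrite cisD -[X in _ - X](cisN (theta u)) [cis (theta u) * _]mulrC -mulrBr; congr (_ * _).
rewrite /cis cosN sinN; apply/eqP; rewrite eq_complex /=; apply/andP; split; apply/eqP; ring.
Qed.

Let cis_neq0 (z : R) : cis z != 0.
Proof. by rewrite -normr_eq0 norm_cis oner_eq0. Qed.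

Let mult_eq1 u : (mult x u == 1) = (sin (theta u) == 0).
Proof.
rewrite -subr_eq0 mult_sub1 mulf_eq0 (negbTE (cis_neq0 _)) /= mulf_eq0.
rewrite mulf_eq0 oppr_eq0 pnatr_eq0 /= (negbTE (@neq0Ci _)) /=.
by rewrite eq_complex /= eqxx andbT.
Qed.

(** Adding a function of the other variables to the primitive makes it
    quasi-periodic in x_j; this requires circle_int = corr * (mult x - 1).  The first
    branch is the limit of the quotient, by l'Hospital's rule in y_j. *)
Definition corr u : R[i] :=
  if mult x u == 1 then 'i / (2 * (k%:R * pi))%:C * pdiff y circle_int u
  else circle_int u / (mult x u - 1).

Lemma corrP u : corr u * (mult x u - 1) = circle_int u.
Proof.
rewrite /corr; case: ifPn => [m1|m1]; last by rewrite divfK// subr_eq0.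
have s0 : sin (theta u) = 0 by apply/eqP; rewrite -mult_eq1.
by rewrite (eqP m1) subrr mulr0 circle_int_eq0.
Qed.

(** In the formula e(- k y_j) - 1 = - 2 sqrt(-1) e(- k y_j / 2) sin(k pi y_j) only
    the sine vanishes, and [Ck_div_sin] applies to the quotient by it. *)
Lemma smooth_corr : smooth corr.
Proof.
have I0 u : sin (theta u) = 0 -> circle_int u = 0 by exact: circle_int_eq0.
pose Q (f : 'rV[R]_(n + n) -> R) u := if sin (theta u) == 0
   then 'D_(evec y) f u / (k%:R * pi * cos (theta u)) else f u / sin (theta u).
have HQR m : Ck m (Q (fun u => complex.Re (circle_int u))).
  apply: Ck_div_sin => // [m'|u /I0 -> //]; by have [] := smooth_circle_int m'.
have HQI m : Ck m (Q (fun u => complex.Im (circle_int u))).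
  apply: Ck_div_sin => // [m'|u /I0 -> //]; by have [] := smooth_circle_int m'.
have sQ : smooth (fun u => Q (fun u => complex.Re (circle_int u)) u
                        +i* Q (fun u => complex.Im (circle_int u)) u).
  by move=> m; split; [exact: HQR|exact: HQI].
have sc : smooth (fun u => cis (theta u)).
  by apply: smooth_cis => m; apply: CkM; [exact: Ck_cst|exact: Ck_coord].
have := smoothM (smoothM (smooth_cst ('i / 2)) sc) sQ.
congr smooth; apply/funext => u; rewrite /corr mult_eq1 /Q.
case: ifPn => [/eqP s0|s0].
  have cc : cos (theta u) != 0.
    apply/eqP => cc; have := cos2Dsin2 (theta u).
    by rewrite s0 cc expr0n addr0 => /eqP; rewrite eq_sym oner_eq0.
  have aux (F : numFieldType) (i a b z : F) : a != 0 -> b != 0 ->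
      i / 2 * b * (z / (a * b)) = i / (2 * a) * z.
    by move=> a0 b0; field; rewrite a0 b0.
  rewrite /cis s0 /pdiff !complex_divr -[cos (theta u) +i* 0]/((cos (theta u))%:C).
  rewrite [in LHS]rmorphM [in RHS]rmorphM rmorph_nat; apply: aux.
    by rewrite eq_complex /= eqxx andbT.
  by rewrite eq_complex /= eqxx andbT.
have aux (F : numFieldType) (i z z' s c : F) : i * i = -1 -> z * z' = 1 -> s != 0 ->
    i / 2 * z * (c / s) = c / (z' * (- 2 * i * s)).
  move=> ii zz' s0'.
  have i0 : i != 0 by apply/eqP => i0; move: ii; rewrite i0 mul0r => /eqP; rewrite eq_sym oppr_eq0 oner_eq0.
  have z0 : z' != 0 by apply/eqP => z0; move: zz'; rewrite z0 mulr0 => /eqP; rewrite eq_sym oner_eq0.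
  have D0 : z' * (- 2 * i * s) != 0 by rewrite !mulf_neq0// oppr_eq0 pnatr_eq0.
  apply: (mulIf D0); rewrite divfK//.
  transitivity (- (i * i) * (z * z') * c * (s / s)); first by field.
  by rewrite ii zz' divff//; ring.
rewrite complex_divr complex_eta mult_sub1; apply: aux.
- by rewrite -expr2 sqr_i.
- exact: cisN.
- by rewrite eq_complex /= eqxx andbT.
Qed.

Lemma pdiff_mult (a b : 'I_(n + n)) u : (forall (t : R) u, mult a (t *: evec b + u) = mult a u) ->
  pdiff b (mult a) u = 0.
Proof. by move=> H; apply: pdiff_line => t; rewrite H. Qed.

Lemma smooth_mult a : smooth (mult a).
Proof.
case: (split_ordP a) => i ->.
  rewrite (_ : mult _ = fun u => expi2pi (- (k%:R * u 0 (ry i)))); last by apply/funext => u; rewrite mult_lx.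
  apply: smooth_cis => m; apply: CkM; first exact: Ck_cst.
  by apply: CkN; apply: CkM; [exact: Ck_cst|exact: Ck_coord].
rewrite (_ : mult _ = fun u => 1); last by apply/funext => u; rewrite mult_ry.
exact: smooth_cst.
Qed.

Lemma corrD u a : a != x -> corr (u + evec a) = mult a u * corr u.
Proof.
move=> ax; have mx : mult x (u + evec a) = mult x u.
  rewrite !mult_lx; have [->|ay] := eqVneq a y; last by rewrite evec_coord.
  rewrite !mxE !eqxx /= mulrDr mulr1 opprD (_ : - k%:R = (- k%:Z)%:~R) ?expi2piD_int//.
  by rewrite mulrNz -pmulrn.
have E : pdiff y circle_int (u + evec a) = mult a u * pdiff y circle_int u.
  rewrite -pdiff_shift.
  have -> : (fun v => circle_int (v + evec a)) = (fun v => mult a v * circle_int v).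
    by apply/funext => v'; rewrite circle_intD.
  rewrite pdiffM; [|exact: smooth_mult|exact: smooth_circle_int].
  rewrite pdiff_mult ?mul0r ?add0r// => t u'.
  move: ax; case: (split_ordP a) => i ->; rewrite ?mult_ry// !mult_lx => ax.
  by rewrite line_coord// eq_rshift eq_sym; apply: contra ax => /eqP ->.
rewrite /corr mx circle_intD// E; case: ifP => _; first exact: mulrCA.
by rewrite mulrA.
Qed.

Lemma corr_line u (t : R) : corr (t *: evec x + u) = corr u.
Proof.
have mx : mult x (t *: evec x + u) = mult x u by rewrite !mult_lx line_coord.
have E : pdiff y circle_int (t *: evec x + u) = pdiff y circle_int u.
  rewrite addrC -pdiff_shift; congr (pdiff y _ u); apply/funext => v'.
  by rewrite addrC circle_int_line.
by rewrite /corr mx circle_int_line E.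
Qed.

Definition cprim u : R[i] :=
  prim x (fun u => complex.Re (v u)) u +i* prim x (fun u => complex.Im (v u)) u.

Lemma smooth_cprim : smooth cprim.
Proof. by move=> m; split; [exact: Ck_prim|exact: Ck_prim]. Qed.

Lemma pdiff_cprim : pdiff x cprim = v.
Proof.
apply/funext => u; rewrite /pdiff /cprim /=.
rewrite (@derive_val _ _ _ _ _ _ _ (derive_prim x vR u)).
by rewrite (@derive_val _ _ _ _ _ _ _ (derive_prim x vI u)) complex_eta.
Qed.

Lemma cprimE u : cprim u = (u 0 x)%:C * cint01 (fun z => v (upd u x (z * u 0 x))).
Proof.
rewrite /cprim /cint01; apply/eqP; rewrite eq_complex /= !mul0r subr0 addr0.
by apply/andP; split; apply/eqP; congr (_ * _); apply: eq_Rintegral => z _;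
  rewrite mul1r; congr (_ (v _)); apply/rowP => l; rewrite !mxE; case: eqP => [->|_]; ring.
Qed.

Lemma cprimD u a : a != x -> cprim (u + evec a) = mult a u * cprim u.
Proof.
move=> ax; rewrite !cprimE evec_coord// [in RHS]mulrCA; congr (_ * _).
rewrite -cint01Z; first by congr cint01; apply/funext => z; rewrite updD// qv mult_upd.
apply: (ccontinuous_comp (g := fun z : R => z * u 0 x) (F := fun z => v (upd u x z))).
  by move=> z; apply: cvgM; [exact: cvg_id|exact: cvg_cst].
exact: ccontinuous_upd.
Qed.

(** The difference of the two sides has zero derivative in u_x and vanishes at
    u_x = 0. *)
Lemma cprim_turn u : cprim (u + evec x) = circle_int u + mult x u * cprim u.
Proof.
pose K (z : R) := cprim (upd u x (z + 1)) - mult x u * cprim (upd u x z).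
have updS z : upd u x (z + 1) = upd u x z + evec x.
  by apply/rowP => l; rewrite !mxE eqxx /=; case: eqP => // _; rewrite addr0.
have vS z : v (upd u x (z + 1)) = mult x u * v (upd u x z).
  by rewrite updS qv !mult_lx mxE eq_rlshift.
have K0 : K 0 = circle_int u.
  rewrite /K add0r !cprimE !mxE !eqxx mul0r mulr0 subr0 mul1r.
  congr cint01; apply/funext => z; congr v; apply/rowP => l; rewrite !mxE mulr1.
  by case: eqP.
have D (f : 'rV[R]_(n + n) -> R) (Hf : forall m, Ck m f) (z : R) :
    is_derive z 1 (fun z => prim x f (upd u x z)) (f (upd u x z)).
  by apply: is_derive_upd; exact: derive_prim.
have D1 (f : 'rV[R]_(n + n) -> R) (Hf : forall m, Ck m f) (z : R) :
    is_derive z 1 (fun z => prim x f (upd u x (z + 1))) (f (upd u x (z + 1))).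
  have D2 : is_derive z 1 (fun z : R => z + 1) 1.
    by have := is_derive_affine 1 1 z; under eq_fun do rewrite mulr1.
  have := @is_derive1_comp _ (fun z => prim x f (upd u x z)) (fun z => z + 1) z _ _ (D f Hf (z + 1)) D2.
  by rewrite mulr1.
have KR z : complex.Re (K z) = complex.Re (K 0).
  apply: (@is_derive_0_is_cst _ (fun z => complex.Re (K z))) => z'.
  rewrite (_ : (fun z => _) = (fun z => prim x (fun u => complex.Re (v u)) (upd u x (z + 1))
      - (complex.Re (mult x u) * prim x (fun u => complex.Re (v u)) (upd u x z)
         - complex.Im (mult x u) * prim x (fun u => complex.Im (v u)) (upd u x z)))); last first.
    by apply/funext => z0; rewrite /K /cprim; case: (mult x u).
  have E := congr1 (@complex.Re R) (vS z').
  have := is_deriveB (D1 _ vR z') (is_deriveB (is_deriveZ (complex.Re (mult x u)) (D _ vR z')) (is_deriveZ (complex.Im (mult x u)) (D _ vI z'))).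
  move=> H; apply: is_derive_eq H _; rewrite /GRing.scale /= E.
  by case: (mult x u) (v _) => [? ?] [? ?] /=; ring.
have KI z : complex.Im (K z) = complex.Im (K 0).
  apply: (@is_derive_0_is_cst _ (fun z => complex.Im (K z))) => z'.
  rewrite (_ : (fun z => _) = (fun z => prim x (fun u => complex.Im (v u)) (upd u x (z + 1))
      - (complex.Re (mult x u) * prim x (fun u => complex.Im (v u)) (upd u x z)
         + complex.Im (mult x u) * prim x (fun u => complex.Re (v u)) (upd u x z)))); last first.
    by apply/funext => z0; rewrite /K /cprim; case: (mult x u).
  have E := congr1 (@complex.Im R) (vS z').
  have := is_deriveB (D1 _ vI z') (is_deriveD (is_deriveZ (complex.Re (mult x u)) (D _ vI z')) (is_deriveZ (complex.Im (mult x u)) (D _ vR z'))).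
  move=> H; apply: is_derive_eq H _; rewrite /GRing.scale /= E.
  by case: (mult x u) (v _) => [? ?] [? ?] /=; ring.
have : K (u 0 x) = circle_int u.
  by rewrite -K0 -[LHS]complex_eta KR KI complex_eta.
by rewrite /K updS upd_id => <-; rewrite subrK.
Qed.

(** The integral from x_j = 0 gains circle_int when x_j makes a turn
    ([cprim_turn]); corr is the function of the other variables that makes up for
    it. *)
Lemma primitive_exists : exists w, wsection k w /\ pdiff x w = v.
Proof.
have sC := smooth_corr; have sP := smooth_cprim.
exists (fun u => cprim u + corr u); split; last first.
  rewrite pdiffD// pdiff_cprim; apply/funext => u.
  by rewrite pdiff_line ?addr0// => t; exact: corr_line.
apply/wsectionP; split; first exact: smoothD.
move=> u a; have [->|ax] := eqVneq a x; last by rewrite cprimD// corrD// mulrDr.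
have E : corr (u + evec x) = corr u by rewrite addrC -[evec x]scale1r corr_line.
rewrite cprim_turn E -(corrP u); ring.
Qed.

End Primitive.

End Gauge.

(** * Functionals killed by the derivatives along x *)

Section Conj.
Context {R : realType}.
Implicit Types x y : R[i].

Lemma conjcD x y : conjc (x + y) = conjc x + conjc y.
Proof. by case: x y => [a b] [c d]; apply/eqP; rewrite eq_complex /= opprD !eqxx. Qed.

Lemma conjcM x y : conjc (x * y) = conjc x * conjc y.
Proof.
case: x y => [a b] [c d]; apply/eqP; rewrite eq_complex /=.
by apply/andP; split; apply/eqP; ring.
Qed.

Lemma conjc0 : conjc (0 : R[i]) = 0.
Proof. by apply/eqP; rewrite eq_complex /= oppr0 !eqxx. Qed.

Lemma conjc_real (a : R) : conjc a%:C = a%:C.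
Proof. by apply/eqP; rewrite eq_complex /= oppr0 !eqxx. Qed.

Lemma conjc_nat m : conjc (m%:R : R[i]) = m%:R.
Proof. by rewrite -(rmorph_nat (real_complex R)) conjc_real. Qed.

Lemma conjcK x : conjc (conjc x) = x.
Proof. by case: x => a b /=; rewrite opprK. Qed.
End Conj.

Lemma cint01_box_cst {R : realType} n (c : R[i]) : cint `[0, 1] (fun _ : 'rV[R]_n => c) = c.
Proof.
have E (x : R) : iter_int `[0, 1] (fun _ : 'rV[R]_n => x) = x.
  elim: n => [|n IH] //=; rewrite (_ : (fun _ : R => _) = (fun=> x)) ?itv01_int_cst//.
  by apply/funext.
by rewrite /cint !E complex_eta.
Qed.

Section Decomposition.
Context {R : realType} {n k : nat}.
Hypothesis k_gt0 : (0 < k)%N.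
Notation lx := (lshift n).
Notation ry := (rshift n).
Notation mult := (@mult R n k).
Implicit Types (u v : 'rV[R]_(n + n)) (w : 'rV[R]_(n + n) -> R[i]) (a : 'I_(n + n)).
Implicit Types (t : section R n k) (m : @Zk n k).

(** A basis of the space of values at the points y_j in (1/k)Z, in the variables
    x_j and y_j. *)
Record local_basis (b : 'I_n -> 'I_k -> 'rV[R]_(n + n) -> R[i]) : Prop := {
  lb_smooth : forall j p, smooth (b j p);
  lb_x : forall j p u, b j p (u + evec (lx j)) = mult (lx j) u * b j p u;
  lb_y : forall j p u, b j p (u + evec (ry j)) = b j p u;
  lb_dep : forall j p u v, u 0 (lx j) = v 0 (lx j) -> u 0 (ry j) = v 0 (ry j) ->
    b j p u = b j p v;
  lb_val : forall j p (q : 'I_k) u, u 0 (ry j) = q%:R / k%:R -> b j p u = (p == q)%:R }.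

Variable b : 'I_n -> 'I_k -> 'rV[R]_(n + n) -> R[i].
Hypothesis Hb : local_basis b.

Lemma lb_other j p u a : a != lx j -> b j p (u + evec a) = b j p u.
Proof.
move=> ax; have [->|ay] := eqVneq a (ry j); first exact: lb_y.
by apply: lb_dep => //; rewrite evec_coord.
Qed.

Definition upd2 u j (z q : R) := upd (upd u (lx j) z) (ry j) q.

Lemma upd2_x u j z q : upd2 u j z q 0 (lx j) = z.
Proof. by rewrite !mxE eq_lrshift eqxx. Qed.

Lemma upd2_y u j z q : upd2 u j z q 0 (ry j) = q.
Proof. by rewrite !mxE eqxx. Qed.

Lemma upd2_other u j z q a : a != lx j -> a != ry j -> upd2 u j z q 0 a = u 0 a.
Proof. by move=> ax ay; rewrite !mxE (negbTE ax) (negbTE ay). Qed.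

(** Integral over the x_j-circle at height y_j = q. *)
Definition avg j (q : R) w u : R[i] := cint01 (fun z => w (upd2 u j z q)).

Lemma smooth_avg j q w : smooth w -> smooth (avg j q w).
Proof.
move=> sw; apply: (smooth_upd_int (lx j) (w := fun u => w (upd u (ry j) q))).
exact: smooth_upd.
Qed.

Lemma ccontinuous_upd2 w u j q : smooth w -> ccontinuous (fun z => w (upd2 u j z q)).
Proof.
move=> sw; apply: (ccontinuous_upd (lx j) (w := fun u => w (upd u (ry j) q))).
exact: smooth_upd.
Qed.

Lemma upd2_agree u v j z q : (forall a, a != lx j -> a != ry j -> u 0 a = v 0 a) ->
  upd2 u j z q = upd2 v j z q.
Proof.
move=> uv; apply/rowP => a; have [->|ax] := eqVneq a (lx j); first by rewrite !upd2_x.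
have [->|ay] := eqVneq a (ry j); first by rewrite !upd2_y.
by rewrite !upd2_other// uv.
Qed.

Lemma avg_indep j q w u v : (forall a, a != lx j -> a != ry j -> u 0 a = v 0 a) ->
  avg j q w u = avg j q w v.
Proof. by move=> uv; congr cint01; apply/funext => z; rewrite (upd2_agree z q uv). Qed.

Lemma avgD j q w u a : wsection k w -> a != lx j -> a != ry j ->
  avg j q w (u + evec a) = mult a u * avg j q w u.
Proof.
move=> /wsectionP [sw qw] ax ay; rewrite /avg -cint01Z; last exact: ccontinuous_upd2.
congr cint01; apply/funext => z; rewrite /upd2 !updD// qw; congr (_ * _).
move: ax; case: (split_ordP a) => i ->; rewrite ?mult_ry// !mult_lx => ij.
have ij' : i != j by apply: contra ij => /eqP ->.
by rewrite !mxE eq_rlshift eq_rshift (negbTE ij').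
Qed.

(** An element of the span of the b j p, with coefficients independent of x_j and
    y_j, having the same circle integrals as w at all heights y_j in (1/k)Z. *)
Definition Rop j w u : R[i] := \sum_(p < k) b j p u * avg j (p%:R / k%:R) w u.

Lemma smooth_sum (I : Type) (r : seq I) (w : I -> 'rV[R]_(n + n) -> R[i]) :
  (forall i, smooth (w i)) -> smooth (fun u => \sum_(i <- r) w i u).
Proof.
move=> sw; elim: r => [|i r IH].
  by under eq_fun do rewrite big_nil; exact: smooth_cst.
by under eq_fun do rewrite big_cons; exact: smoothD.
Qed.

Lemma smooth_prod (I : Type) (r : seq I) (w : I -> 'rV[R]_(n + n) -> R[i]) :
  (forall i, smooth (w i)) -> smooth (fun u => \prod_(i <- r) w i u).
Proof.
move=> sw; elim: r => [|i r IH].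
  by under eq_fun do rewrite big_nil; exact: smooth_cst.
by under eq_fun do rewrite big_cons; exact: smoothM.
Qed.

Lemma wsection_Rop j w : wsection k w -> wsection k (Rop j w).
Proof.
move=> Hw; have [sw qw] := (wsectionP w).1 Hw; apply/wsectionP; split.
  by apply: smooth_sum => p; apply: smoothM; [exact: lb_smooth|exact: smooth_avg].
move=> u a; rewrite /Rop mulr_sumr; apply: eq_bigr => p _.
have [->|ax] := eqVneq a (lx j).
  rewrite lb_x// -mulrA; congr (_ * (_ * _)); apply: avg_indep => c cx _.
  by rewrite evec_coord// eq_sym.
have [->|ay] := eqVneq a (ry j).
  rewrite lb_y// mult_ry mul1r; congr (_ * _); apply: avg_indep => c _ cy.
  by rewrite evec_coord// eq_sym.
by rewrite lb_other// avgD// mulrCA.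
Qed.

Lemma avg_Rop j (q : 'I_k) w u : avg j (q%:R / k%:R) (Rop j w) u = avg j (q%:R / k%:R) w u.
Proof.
rewrite -[RHS]cint01_cst; congr cint01; apply/funext => z.
rewrite /Rop (bigD1 q)//= (lb_val Hb _ (upd2_y _ _ _ _)) eqxx mul1r big1 ?addr0; last first.
  by move=> p /negbTE pq; rewrite (lb_val Hb _ (upd2_y _ _ _ _)) pq mul0r.
by apply: avg_indep => a ax ay; rewrite upd2_other.
Qed.

(** w - Rop j w has vanishing circle integrals at the heights in (1/k)Z, so it is a
    derivative. *)
Lemma Rop_step j w : wsection k w ->
  exists W, wsection k W /\ forall u, w u = Rop j w u + pdiff (lx j) W u.
Proof.
move=> Hw; have HR := wsection_Rop j Hw.
have [sw qw] := (wsectionP w).1 Hw; have [sR qR] := (wsectionP _).1 HR.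
pose v u := -1 * Rop j w u + w u.
have Hv : wsection k v.
  apply/wsectionP; split; first by apply: smoothD => //; apply: smoothM => //; exact: smooth_cst.
  by move=> u a; rewrite /v qw qR; ring.
have [|W [HW WE]] := primitive_exists k_gt0 (j := j) Hv.
  move=> q u; rewrite -[LHS]/(avg j (q%:R / k%:R) v u) /avg /v cint01_lin; try exact: ccontinuous_upd2.
  by rewrite -[X in _ * X + _]/(avg j (q%:R / k%:R) (Rop j w) u) avg_Rop mulN1r addNr.
by exists W; split=> // u; rewrite WE /v mulN1r addrA subrr add0r.
Qed.

Definition killed_by_nabla (s : functional R n k) : Prop :=
  forall j t, s (nabla_section (lx j) t) = 0.

Lemma antilinearD (s : functional R n k) t1 t2 : antilinear s -> s (t1 + t2) = s t1 + s t2.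
Proof. by move=> al; have := al 1 t1 t2; rewrite scale1r rmorph1 mul1r. Qed.

Lemma antilinear0 (s : functional R n k) : antilinear s -> s 0 = 0.
Proof.
by move=> al; have := antilinearD 0 0 al; rewrite addr0 => /eqP; rewrite -subr_eq0 opprD addrA subrr sub0r oppr_eq0 => /eqP.
Qed.

Lemma antilinearZ (s : functional R n k) (c : R[i]) t : antilinear s -> s (c *: t) = conjc c * s t.
Proof. by move=> al; have := al c t 0; rewrite addr0 antilinear0// addr0. Qed.

Lemma antilinear_sum (s : functional R n k) (I : Type) (r : seq I) (t : I -> section R n k) :
  antilinear s -> s (\sum_(i <- r) t i) = \sum_(i <- r) s (t i).
Proof.
move=> al; elim: r => [|i r IH]; first by rewrite !big_nil antilinear0.
by rewrite !big_cons antilinearD// IH.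
Qed.

(** The coordinates in l are treated one after the other.  Each step splits a
    term into k terms and turns the coefficients into their circle integrals, which
    do not depend on the coordinate that was treated. *)
Lemma reduce_coordinates t (l : seq 'I_n) : uniq l ->
  exists (I : finType) (m : I -> @Zk n k) (c : I -> 'rV[R]_(n + n) -> R[i]) (t' : section R n k),
  [/\ forall i, smooth (c i),
      forall i u v, (forall j, j \notin l -> u 0 (lx j) = v 0 (lx j) /\ u 0 (ry j) = v 0 (ry j)) ->
        c i u = c i v,
      forall u, wform k t' u = \sum_(i : I) (\prod_(j <- l) b j (m i j) u) * c i u &
      forall s : functional R n k, antilinear s -> killed_by_nabla s -> s t = s t'].
Proof.
elim: l => [_|j l IH /= /andP[jl /IH {IH} [I [m [c [t' [sc ic wt' st']]]]]]].
  have [sw _] := wform_section t.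
  exists unit, (fun=> [ffun=> Ordinal k_gt0]), (fun=> wform k t), t; split=> //.
    by move=> _ u v uv; congr wform; apply/rowP => a; case: (split_ordP a) => i ->; have [] := uv i isT.
  by move=> u; rewrite big_const card_unit /= big_nil mul1r addr0.
have [W [HW WE]] := Rop_step j (wform_section t').
have HR := wsection_Rop j (wform_section t').
exists ('I_k * I)%type.
exists (fun pi : 'I_k * I => [ffun i0 => if i0 == j then pi.1 else m pi.2 i0]).
exists (fun pi : 'I_k * I => avg j (pi.1%:R / k%:R) (c pi.2)), (of_wform HR); split.
- by case=> p i; exact: smooth_avg.
- move=> [p i] u v uv; congr cint01; apply/funext => z; apply: ic => j' j'l /=.
  have [->|j'j] := eqVneq j' j; first by rewrite !upd2_x !upd2_y.
  rewrite !upd2_other ?eq_lshift ?eq_rlshift ?eq_lrshift ?eq_rshift//.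
  by apply: uv; rewrite in_cons negb_or j'j.
- move=> u; rewrite wform_of_wform /Rop.
  have avgE p : avg j (p%:R / k%:R) (wform k t') u =
     \sum_(i : I) (\prod_(j <- l) b j (m i j) u) * avg j (p%:R / k%:R) (c i) u.
    rewrite /avg (_ : (fun z => _) = (fun z => \sum_(i : I) (\prod_(j <- l) b j (m i j) u) * c i (upd2 u j z (p%:R / k%:R)))).
      rewrite cint01_sum => [|i].
        by apply: eq_bigr => i _; rewrite cint01Z//; exact: ccontinuous_upd2.
      by apply: ccontinuousM; [exact: ccontinuous_cst|exact: ccontinuous_upd2].
    apply/funext => z; rewrite wt'; apply: eq_bigr => i _; congr (_ * _).
    rewrite big_seq [RHS]big_seq; apply: eq_bigr => j' j'l.
    have j'j : j' != j by apply: contraNneq jl => <-.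
    by apply: (lb_dep Hb); rewrite upd2_other// ?eq_lshift ?eq_rlshift ?eq_lrshift ?eq_rshift.
  transitivity (\sum_(p < k) \sum_(i : I) b j p u * ((\prod_(j <- l) b j (m i j) u) * avg j (p%:R / k%:R) (c i) u)).
    by apply: eq_bigr => p _; rewrite avgE mulr_sumr.
  rewrite pair_big; apply: eq_bigr => -[p i] _ /=.
  rewrite mulrA big_cons ffunE eqxx; congr (_ * _ * _).
  rewrite big_seq [RHS]big_seq; apply: eq_bigr => j' j'l; rewrite ffunE ifF//.
  by apply/negbTE; apply: contraNneq jl => <-.
- move=> s al ks; rewrite (st' s al ks).
  have t'E : t' = of_wform HR + nabla_section (lx j) (of_wform HW).
    apply: (@wform_inj R n k); apply/funext => u; rewrite WE.
    have := wformZD 1 (of_wform HR) (nabla_section (lx j) (of_wform HW)) u.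
    by rewrite scale1r mul1r wform_nabla !wform_of_wform => ->.
  by rewrite [in LHS]t'E antilinearD// ks addr0.
Qed.

Lemma wsection_basis m : wsection k (fun u => \prod_(j < n) b j (m j) u).
Proof.
apply/wsectionP; split; first by apply: smooth_prod => j; exact: lb_smooth.
move=> u a; case: (split_ordP a) => i ->.
  rewrite (bigD1 i)//= [in RHS](bigD1 i)//= lb_x// mulrA; congr (_ * _).
  by apply: eq_bigr => j ji; rewrite lb_other// eq_lshift eq_sym.
rewrite mult_ry mul1r; apply: eq_bigr => j _.
by rewrite lb_other// eq_rlshift.
Qed.

(** Dual to the functionals sending t to conj((t)_m(0)) ([weil_brezin_basis]). *)
Definition basis_section m : section R n k := of_wform (wsection_basis m).

Lemma weil_brezin_basis m m' : weil_brezin (basis_section m) m' 0 = (m == m')%:R.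
Proof.
rewrite weil_brezin0// wform_of_wform.
rewrite (_ : (m == m')%:R = cint `[0, 1] (fun _ : 'rV[R]_n => (m == m')%:R)).
  apply: eq_cint => x _.
  have E j : b j (m j) (row_mx x (k%:R^-1 *: repr_Zk m')) = (m j == m' j)%:R.
    by apply: (lb_val Hb); rewrite row_mxEr !mxE mulrC.
  under eq_bigr do rewrite E.
  have [->|mm] := eqVneq m m'; first by rewrite big1// => j _; rewrite eqxx.
  have [j mj] : exists j, m j != m' j.
    by apply/existsP; apply: contraNT mm => /existsPn H; apply/eqP/ffunP => j; apply/eqP; rewrite -[_ == _]negbK.
  by rewrite (bigD1 j)//= (negbTE mj) mul0r.
by rewrite cint01_box_cst.
Qed.

(** The reduction above writes t, modulo derivatives, as a combination of the basis
    sections.  Its coefficients are identified by applying the same reduction to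
    the functionals sending t to conj((t)_m(0)), which are killed by the derivatives as well. *)
Lemma killed_by_nablaE (s : functional R n k) t : antilinear s -> killed_by_nabla s ->
  s t = \sum_(m : @Zk n k) conjc (weil_brezin t m 0) * s (basis_section m).
Proof.
move=> al ks.
have [I [m [c [t' [sc ic wt' st']]]]] := reduce_coordinates t (index_enum_uniq 'I_n).
have cE i u : c i u = c i 0 by apply: ic => j; rewrite mem_index_enum.
have t'E : t' = \sum_(i : I) c i 0 *: basis_section (m i).
  apply: (@wform_inj R n k); apply/funext => u; rewrite wt'.
  have -> : wform k (\sum_(i : I) c i 0 *: basis_section (m i)) u =
     \sum_(i : I) c i 0 * wform k (basis_section (m i)) u.
    elim/big_ind2: _ => [|x1 t1 x2 t2 <- <-|i _].
    - by rewrite /wform /= mulr0.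
    - by have := wformZD 1 t1 t2 u; rewrite scale1r mul1r.
    - by have := wformZD (c i 0) (basis_section (m i)) 0 u; rewrite addr0 => ->; rewrite /wform /= mulr0 addr0.
  by apply: eq_bigr => i _; rewrite wform_of_wform cE mulrC.
have E (s' : functional R n k) : antilinear s' -> killed_by_nabla s' ->
    s' t = \sum_(i : I) conjc (c i 0) * s' (basis_section (m i)).
  move=> al' ks'; rewrite (st' s')// t'E antilinear_sum//.
  by apply: eq_bigr => i _; rewrite antilinearZ.
rewrite (E s)//.
pose th m' : functional R n k := fun t => conjc (weil_brezin t m' 0).
have thE m' : conjc (weil_brezin t m' 0) = \sum_(i : I) conjc (c i 0) * (m i == m')%:R.
  rewrite -[LHS]/(th m' t) E.
  - by apply: eq_bigr => i _; rewrite /th weil_brezin_basis conjc_nat.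
  - by move=> x t1 t2; rewrite /th (weil_brezin_lin k_gt0) conjcD; congr (_ + _); exact: conjcM.
  - by move=> j t0; rewrite /th weil_brezin_nabla// conjc0.
transitivity (\sum_(m' : @Zk n k) \sum_(i : I) conjc (c i 0) * (m i == m')%:R * s (basis_section m')); last first.
  by apply: eq_bigr => m' _; rewrite thE mulr_suml.
rewrite exchange_big; apply: eq_bigr => i _ /=.
rewrite (bigD1 (m i))//= eqxx mulr1 big1 ?addr0// => m' mm'.
by rewrite eq_sym (negbTE mm') mulr0 mul0r.
Qed.

End Decomposition.

(** * Sections with prescribed Weil-Brezin coefficients *)

Section LatticeBox.
Variable n : nat.

Definition box (L : nat) : seq 'rV[int]_n :=
  undup [seq \row_i ((f i : nat)%:Z - L%:Z) | f : {ffun 'I_n -> 'I_(L + L).+1}].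

Lemma mem_box L (l : 'rV[int]_n) : (forall i, (`|l 0%R i| <= L)%N) -> l \in box L.
Proof.
move=> lL; rewrite mem_undup; apply/mapP.
have H i : (`|(l 0 i + L%:Z)%R| < (L + L).+1)%N by have := lL i; lia.
exists [ffun i => Ordinal (H i)]; first by rewrite mem_enum.
apply/rowP => i; rewrite mxE ffunE /=; have := lL i; lia.
Qed.

End LatticeBox.

Section LatticeSum.
Context {R : realType} {n k : nat}.
Hypothesis k_gt0 : (0 < k)%N.
Notation lx := (lshift n).
Notation ry := (rshift n).
Implicit Types (u v : 'rV[R]_(n + n)) (l : 'rV[int]_n) (m : @Zk n k) (y : 'rV[R]_n).

Let k0 : k%:R != 0 :> R.
Proof. by rewrite pnatr_eq0 -lt0n. Qed.

Definition bounded_supp (phi : 'rV[R]_n -> R[i]) (K : R) : Prop :=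
  forall (y : 'rV[R]_n) i, K < `|y 0 i| -> phi y = 0.

(** A nontrivial character is a constant multiple of its own partial derivative,
    whose integral over the torus is 0. *)
Lemma cint_character (d : 'rV[int]_n) :
  cint `[0, 1] (fun x : 'rV[R]_n => expi2pi (dot x (map_mx intr d))) = (d == 0)%:R.
Proof.
have [->|d0] := eqVneq d 0.
  rewrite -[RHS](cint01_box_cst n); apply: eq_cint => x _.
  by rewrite map_mx0 dot0r expi2pi0.
have [j dj] : exists j, d 0 j != 0.
  apply/existsP; apply: contraNT d0 => /existsPn H; apply/eqP/rowP => j.
  by apply/eqP; rewrite mxE -[_ == _]negbK.
pose g (x : 'rV[R]_n) := 2 * pi * dot x (map_mx intr d).
have sF : smooth (fun x : 'rV[R]_n => expi2pi (dot x (map_mx intr d))).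
  apply: smooth_cis => m; apply: CkM; first exact: Ck_cst.
  by apply: Ck_sum => i; apply: CkM; [exact: Ck_coord|exact: Ck_cst].
have Dg x : is_derive x (evec j) g (2 * pi * (d 0 j)%:~R).
  apply: is_derive_eq (linear_is_derive (f := g) x (evec j) _) _.
    move=> h w z; rewrite /g /dot !mulr_sumr -big_split; apply: eq_bigr => i _ /=.
    by rewrite !mxE; ring.
  rewrite /g /dot (bigD1 j)//= !mxE !eqxx mul1r big1 ?addr0// => i ij.
  by rewrite !mxE eqxx (negbTE ij) mul0r.
have pF (x : 'rV[R]_n) : expi2pi (dot (x + evec j) (map_mx intr d)) = expi2pi (dot x (map_mx intr d)).
  rewrite (_ : dot _ _ = dot x (map_mx intr d) + (d 0 j)%:~R) ?expi2piD_int//.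
  rewrite /dot [in RHS](bigD1 j)//= (bigD1 j)//= !mxE !eqxx [RHS]addrAC; congr (_ + _).
    by rewrite mulrDl mul1r.
  by apply: eq_bigr => i ij; rewrite !mxE eqxx (negbTE ij) addr0.
have := @cint_periodic_derive _ _ j _ sF pF.
rewrite (_ : pdiff j _ = fun x => 'i * (2 * pi * (d 0 j)%:~R)%:C * expi2pi (dot x (map_mx intr d))); last first.
  by apply/funext => x; exact: (pdiff_cis (Dg x)).
rewrite cintZ//; last exact: smooth_ccontinuous.
move/eqP; rewrite mulf_eq0 => /orP[|/eqP //].
rewrite mulf_eq0 (negbTE (@neq0Ci _)) /= eq_complex /= eqxx andbT.
rewrite !mulf_eq0 pnatr_eq0 intr_eq0 (negbTE dj) orbF /=.
by rewrite gt_eqF// pi_gt0.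
Qed.

Lemma Ck_rsub (m' : nat) (f : 'rV[R]_n -> R) (a : 'rV[R]_n) :
  Ck m' f -> Ck m' (fun u : 'rV[R]_(n + n) => f (rsubmx u + a)).
Proof.
have cR : continuous (fun u : 'rV[R]_(n + n) => rsubmx u + a).
  apply: continuous_row => i; rewrite (_ : (fun u => _) = (fun u : 'rV[R]_(n + n) => u 0 (ry i) + a 0 i)).
    have c1 : continuous (fun u : 'rV[R]_(n + n) => u 0 (ry i)) by exact: coord_continuous.
    by move=> u; exact: (cvgD (c1 u) (cvg_cst _)).
  by apply/funext => u; rewrite !mxE.
elim: m' f => [|m' IH] f Hf0; case: (Hf0) => cf Hf;
  (split; first exact: (continuous_compose cR cf)) => // j.
case: (split_ordP j) => i ->.
  have D u : is_derive u (evec (lx i)) (fun u => f (rsubmx u + a)) 0.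
    apply/is_derive_lineP; rewrite (_ : (fun t : R => _) = (fun t : R => f (rsubmx u + a))).
      exact: is_derive_cst.
    apply/funext => t; congr (f (_ + _)); apply/rowP => c.
    by rewrite !mxE eqxx /= eq_rlshift mulr0 add0r.
  split; first by move=> u; exact: (@ex_derive _ _ _ _ _ _ _ (D u)).
  apply: Ck_ext (Ck_cst m' 0) => u.
  by rewrite (@derive_val _ _ _ _ _ _ _ (D u)).
have [df Ddf] := Hf i.
have D u : is_derive u (evec (ry i)) (fun u => f (rsubmx u + a)) ('D_(evec i) f (rsubmx u + a)).
  apply/is_derive_lineP; have /is_derive_lineP := derivableP (df (rsubmx u + a)).
  rewrite (_ : (fun t : R => f (t *: evec i + _)) = (fun t : R => f (rsubmx (t *: evec (ry i) + u) + a)))//.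
  apply/funext => t; rewrite addrA; congr (f (_ + _)); apply/rowP => c.
  by rewrite !mxE eqxx /= eq_rshift.
split; first by move=> u; exact: (@ex_derive _ _ _ _ _ _ _ (D u)).
by apply: Ck_ext (IH _ Ddf) => u; rewrite (@derive_val _ _ _ _ _ _ _ (D u)).
Qed.

Section Sum.
Variables (phi : 'rV[R]_n -> R[i]) (K : R) (m : @Zk n k).
Hypotheses (sphi : smooth phi) (Kphi : bounded_supp phi K).

Let c : 'rV[R]_n := k%:R^-1 *: repr_Zk m.

Definition lat_arg l u : 'rV[R]_n := rsubmx u + (- c - map_mx intr l).

Definition lat_term l u : R[i] :=
  phi (lat_arg l u) * expi2pi (- (k%:R * dot (lsubmx u) (lat_arg l u))).

(** The inverse Weil-Brezin transform of the family with the single nonzero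
    member phi at m, in the gauge of wform. *)
Definition lat u : R[i] := \sum_(l \in [set: 'rV[int]_n]) lat_term l u.

Lemma lat_finite L u : (forall l, l \notin box n L -> lat_term l u = 0) ->
  lat u = \sum_(l <- box n L) lat_term l u.
Proof.
move=> H; rewrite /lat (fsbigE (box n L)) ?undup_uniq//; last by move=> l _; exact: H.
by apply: eq_bigl => l; rewrite in_setT.
Qed.

(** If some |l_i| is larger than L then the argument of phi has a coordinate
    outside [-K, K], since |c_i| <= 1. *)
Lemma lat_term_box L u M : (forall i, `|u 0 (ry i)| <= M) -> M + 1 + K <= L%:R ->
  forall l, l \notin box n L -> lat_term l u = 0.
Proof.
move=> uM ML l lL.
have [i li] : exists i, (L < `|l 0%R i|)%N.
  apply/existsP; apply: contraNT lL => /existsPn H; apply: mem_box => i.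
  by rewrite leqNgt H.
rewrite /lat_term (@Kphi _ i) ?mul0r//.
have c01 : `|c 0 i| <= 1.
  rewrite !mxE ger0_norm; last by rewrite mulr_ge0 ?invr_ge0.
  by rewrite mulrC ler_pdivrMr ?ltr0n// mul1r ler_nat ltnW.
have E : `|(l 0 i)%:~R| = (`|l 0%R i|%N)%:R :> R by rewrite -intr_norm -abszE.
have lL' : L%:R + 1 <= `|(l 0 i)%:~R| :> R by rewrite E natr1 ler_nat.
have -> : lat_arg l u 0 i = u 0 (ry i) - c 0 i - (l 0 i)%:~R by rewrite !mxE; ring.
have := ler_normB (u 0 (ry i) - c 0 i - (l 0 i)%:~R) (u 0 (ry i) - c 0 i).
have -> : u 0 (ry i) - c 0 i - (l 0 i)%:~R - (u 0 (ry i) - c 0 i) = - (l 0 i)%:~R by ring.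
rewrite normrN; have := ler_normB (u 0 (ry i)) (c 0 i); have := uM i; lra.
Qed.

(** Local finiteness: the same finite range of summation serves for all points in
    a neighbourhood of u. *)
Lemma lat_bound u : exists L : nat, forall v, (forall i, `|v 0 (ry i)| <= `|u 0 (ry i)| + 1) ->
  forall l, l \notin box n L -> lat_term l v = 0.
Proof.
pose M := \sum_(i < n) `|u 0 (ry i)| + 1.
have [L HL] : exists L : nat, M + 1 + K <= L%:R.
  exists (Num.bound (Num.max 0 (M + 1 + K))).
  have := archi_boundP (x := Num.max 0 (M + 1 + K)).
  by rewrite le_max lexx => /(_ isT) /ltW; apply: le_trans; rewrite le_max lexx orbT.
exists L => v vu; apply: (lat_term_box (M := M)) => // i.
apply: le_trans (vu i) _; rewrite lerD2r (bigD1 i)//= lerDl.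
by apply: sumr_ge0.
Qed.

Lemma smooth_lat_term l : smooth (lat_term l).
Proof.
apply: smoothM.
  by move=> m'; have [? ?] := sphi m'; split; [exact: (Ck_rsub (f := fun y => complex.Re (phi y)))
    |exact: (Ck_rsub (f := fun y => complex.Im (phi y)))].
apply: smooth_cis => m'; apply: CkM; first exact: Ck_cst.
apply: CkN; apply: CkM; first exact: Ck_cst.
apply: Ck_sum => i; apply: CkM.
  by apply: Ck_ext (Ck_coord m' (lx i)) => u; rewrite mxE.
exact: (Ck_rsub _ (Ck_coord m' i)).
Qed.

Lemma smooth_lat : smooth lat.
Proof.
apply: smooth_local => u; have [L HL] := lat_bound u.
exists (fun v => \sum_(l <- box n L) lat_term l v); split.
  by apply: smooth_sum => l; exact: smooth_lat_term.
have H : nbhs u [set v : 'rV[R]_(n + n) | forall i : 'I_n, `|v 0 (ry i) - u 0 (ry i)| <= 1].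
  apply: (@near_all 'rV[R]_(n + n) 'I_n (fun i v => `|v 0 (ry i) - u 0 (ry i)| <= 1)) => i.
  apply: (continuous_near_le (f := fun v : 'rV[R]_(n + n) => v 0 (ry i))) => //.
  exact: coord_continuous.
apply: filterS H => v Hv; apply: lat_finite; apply: HL => i.
by rewrite -lerBlDl; apply: le_trans (Hv i); exact: lerB_dist.
Qed.

(** Translating x multiplies each term by the same factor, because the frequency
    of the l-th term differs from - k y_i by the integer m_i + k l_i; translating y by
    a period permutes the terms. *)
Lemma wsection_lat : wsection k lat.
Proof.
apply/wsectionP; split; first exact: smooth_lat.
move=> u a; case: (split_ordP a) => i ->.
  have [L HL] := lat_bound u.
  rewrite !(@lat_finite L); first last.
  - by apply: HL => j; rewrite evec_coord ?eq_lrshift// lerDl.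
  - by apply: HL => j; rewrite lerDl.
  rewrite mulr_sumr; apply: eq_bigr => l _; rewrite mult_lx /lat_term.
  have -> : lat_arg l (u + evec (lx i)) = lat_arg l u.
    by congr (_ + _); apply/rowP => j; rewrite !mxE eqxx /= eq_rlshift addr0.
  rewrite mulrCA -expi2piD; congr (_ * _).
  have -> : dot (lsubmx (u + evec (lx i))) (lat_arg l u) = dot (lsubmx u) (lat_arg l u) + lat_arg l u 0 i.
    rewrite /dot (bigD1 i)//= [in RHS](bigD1 i)//= [lsubmx (_ + _) 0 i]mxE [(u + _) 0 _]mxE [evec _ 0 _]mxE !eqxx.
    rewrite [lsubmx u 0 i]mxE mulrDl mul1r addrAC; congr (_ + _ + _).
    apply: eq_bigr => j ji; congr (_ * _).
    by rewrite !mxE eqxx /= eq_lshift (negbTE ji) addr0.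
  rewrite -(@expi2piD_int _ (- (k%:R * u 0 (ry i)) + _) ((m i : nat)%:Z + k%:Z * l 0 i)).
  congr expi2pi; rewrite /lat_arg !mxE rmorphD rmorphM /= -!pmulrn.
  by field.
rewrite mult_ry mul1r /lat.
rewrite (reindex_fsbigT (fun l => l + delta_mx 0 i)); last first.
  by exists (fun l => l - delta_mx 0 i) => l; rewrite ?addrK ?subrK.
apply: eq_fsbigr => l _; rewrite /lat_term.
have -> : lat_arg (l + delta_mx 0 i) (u + evec (ry i)) = lat_arg l u.
  apply/rowP => j; rewrite !mxE eqxx /= eq_rshift.
  by case: (j == i); rewrite /= ?mulr1n ?mulr0n rmorphD /=; ring.
by congr (_ * expi2pi (- (_ * dot _ _))); apply/rowP => j; rewrite !mxE eqxx /= eq_lrshift addr0.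
Qed.

Definition lat_section : section R n k := of_wform wsection_lat.

(** The l-th term integrates a character of frequency m - m' + k l; as the entries
    of m and m' lie in {0, ..., k-1}, this vanishes only for l = 0 and m = m'. *)
Lemma weil_brezin_lat m' y : weil_brezin lat_section m' y = (m' == m)%:R * phi y.
Proof.
rewrite weil_brezinE// wform_of_wform.
have [L HL] := lat_bound (row_mx 0 (wb_arg m' y)).
pose d l : 'rV[int]_n := \row_i ((m i : nat)%:Z - (m' i : nat)%:Z + k%:Z * l 0 i).
pose z l := wb_arg m' y + (- c - map_mx intr l).
rewrite (_ : cint _ _ = cint `[0, 1] (fun x => \sum_(l <- box n L) phi (z l) * expi2pi (dot x (map_mx intr (d l))))); last first.
  apply: eq_cint => x _; rewrite (@lat_finite L); last first.
    by apply: HL => i; rewrite !row_mxEr lerDl.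
  rewrite mulr_sumr; apply: eq_bigr => l _; rewrite /lat_term /lat_arg row_mxKr row_mxKl -/(z l).
  rewrite mulrCA -expi2piD; congr (_ * expi2pi _).
  rewrite /z /wb_arg -mulrN -mulrDr -dotNr -dotDr -dotZr; congr dot.
  by apply/rowP => i; rewrite !mxE !(rmorphD, rmorphN, rmorphM) /= -!pmulrn; field.
have cch l : ccontinuous (fun x : 'rV[R]_n => expi2pi (dot x (map_mx intr (d l)))).
  apply: smooth_ccontinuous; apply: smooth_cis => m0; apply: CkM; first exact: Ck_cst.
  by apply: Ck_sum => i; apply: CkM; [exact: Ck_coord|exact: Ck_cst].
rewrite cint_sum//; last by move=> l; apply: ccontinuousM => //; exact: ccontinuous_cst.
under eq_bigr do rewrite cintZ// cint_character.
have dE l : (d l == 0) = (m' == m) && (l == 0).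
  apply/eqP/andP => [d0|[/eqP mm /eqP ->]]; last first.
    by apply/rowP => i; rewrite !mxE mm mulr0 addr0 subrr.
  have mi i : m' i = m i /\ l 0 i = 0.
    have := congr1 (fun v : 'rV[int]_n => v 0 i) d0; rewrite !mxE.
    have := ltn_ord (m i); have := ltn_ord (m' i) => h1 h2 h3.
    have li0 : l 0 i = 0 by nia.
    by split=> //; apply: val_inj; move: h3; rewrite li0 /=; lia.
  split; first by apply/eqP/ffunP => i; have [] := mi i.
  by apply/eqP/rowP => i; rewrite mxE; have [] := mi i.
under eq_bigr do rewrite dE.
have [mm|mm] := eqVneq m' m; last by rewrite mul0r big1// => l _; rewrite mulr0.
have m0box : (0 : 'rV[int]_n) \in box n L by apply: mem_box => i; rewrite mxE.
rewrite (bigD1_seq 0)//= ?undup_uniq// eqxx mulr1 big1 ?addr0 ?mul1r.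
  by congr phi; rewrite /z /wb_arg mm -/c map_mx0 subr0 addrK.
by move=> l /negbTE ->; rewrite mulr0.
Qed.

End Sum.

Lemma plateau_box_bounded_supp (y0 : 'rV[R]_n) (e : R) : 0 < e ->
  exists K, bounded_supp (fun y => (plateau_box y0 e y)%:C) K.
Proof.
move=> e0; exists (\sum_(i < n) `|y0 0 i| + e) => y i yi; rewrite (plateau_box0 (i := i))//.
have H : `|y0 0 i| <= \sum_(i < n) `|y0 0 i|.
  by rewrite (bigD1 i)//= lerDl; apply: sumr_ge0.
have := ler_normD (y 0 i - y0 0 i) (y0 0 i); rewrite subrK; lra.
Qed.

Lemma smooth_plateau_box (y0 : 'rV[R]_n) (e : R) : smooth (fun y => (plateau_box y0 e y)%:C).
Proof. by apply: smooth_real => m; exact: Ck_plateau_box. Qed.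

(** Evaluating an n-dimensional lattice sum on the (x_j, y_j)-plane gives a
    one-dimensional one. *)
Lemma local_basis_exists : exists b : 'I_n -> 'I_k -> 'rV[R]_(n + n) -> R[i], local_basis b.
Proof.
(* The points of (1/k)Z are 1/k apart, so that a plateau of half-width 1/(2k)
   around one of them avoids the others. *)
pose e : R := (2 * k%:R)^-1.
have kR : 0 < k%:R :> R by rewrite ltr0n.
have e0 : 0 < e by rewrite invr_gt0 mulr_gt0.
pose phi (y : 'rV[R]_n) : R[i] := (plateau_box 0 e y)%:C.
have sphi : smooth phi by exact: smooth_plateau_box.
have [K HK] := @plateau_box_bounded_supp 0 e e0.
pose mp (j : 'I_n) (p : 'I_k) : @Zk n k := [ffun i => if i == j then p else Ordinal k_gt0].
pose pr (j : 'I_n) u : 'rV[R]_(n + n) := \row_a (if (a == lx j) || (a == ry j) then u 0 a else 0).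
have Hlat j p := (wsectionP _).1 (wsection_lat (mp j p) sphi HK).
have prD j u a : (a == lx j) || (a == ry j) -> pr j (u + evec a) = pr j u + evec a.
  move=> aj; apply/rowP => c; rewrite !mxE eqxx /=.
  by case: (eqVneq c a) => [->|_]; rewrite ?aj//= !addr0.
exists (fun j p u => lat phi (mp j p) (pr j u)); split.
- move=> j p; have [sl _] := Hlat j p.
  have := smooth_diag (fun a : 'I_(n + n) => if (a == lx j) || (a == ry j) then 1 else 0) (fun=> 0) sl.
  congr smooth; apply/funext => u; congr lat; apply/rowP => a; rewrite !mxE.
  by case: ifP => _; ring.
- move=> j p u; rewrite prD ?eqxx//; have [_ ->] := Hlat j p.
  by rewrite !mult_lx mxE eqxx orbT.
- move=> j p u; rewrite prD ?eqxx ?orbT//; have [_ ->] := Hlat j p.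
  by rewrite mult_ry mul1r.
- move=> j p u v ux uy; congr lat; apply/rowP => a; rewrite !mxE.
  by case: eqP => [->|_]; [rewrite ux|case: eqP => [->|]].
- move=> j p q u uy.
  have argE (l : 'rV[int]_n) i : lat_arg (mp j p) l (pr j u) 0 i =
     (((if i == j then (q : nat)%:Z - (p : nat)%:Z else 0) - k%:Z * l 0 i)%:~R) / k%:R.
    rewrite !mxE ffunE eq_rlshift eq_rshift /=.
    case: eqP => [->|_]; rewrite ?uy !(rmorphB, rmorphM, rmorph0) /= -?pmulrn; field; exact: k0.
  have zero (l : 'rV[int]_n) i : (if i == j then (q : nat)%:Z - (p : nat)%:Z else 0) - k%:Z * l 0 i != 0 ->
      lat_term phi (mp j p) l (pr j u) = 0.
    move=> N0; rewrite /lat_term /phi (plateau_box0 (i := i)) ?mul0r//.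
    rewrite argE mxE subr0 normrM normfV (gtr0_norm kR) ler_pdivlMr// /e.
    have -> : (2 * k%:R)^-1 * k%:R = 2^-1 :> R by field; exact: k0.
    rewrite -intr_norm; apply: (@le_trans _ _ 1); first by lra.
    by rewrite -[1]/(1%:~R) ler_int -gtz0_ge1 normr_gt0.
  rewrite /lat (fsbigE [:: 0])//=; last first.
    move=> l _; rewrite inE => l0.
    have [i li] : exists i, l 0 i != 0.
      apply/existsP; apply: contraNT l0 => /existsPn H; apply/eqP/rowP => i.
      by apply/eqP; rewrite mxE -[_ == _]negbK.
    apply: (zero l i); apply/eqP; have := ltn_ord p; have := ltn_ord q.
    move: (l 0 i) li (nat_of_ord p) (nat_of_ord q) => x x0 p' q' q'k p'k.
    have [xp|xn|x0'] := ltrgtP 0 x; last by rewrite -x0' eqxx in x0.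
      by case: eqP => _; nia.
    by case: eqP => _; nia.
  rewrite big_cons big_nil in_setT addr0.
  have [pq|pq] := eqVneq p q; last first.
    rewrite (zero 0 j)// eqxx mxE mulr0 subr0 subr_eq0.
    by apply: contra pq => /eqP h; apply/eqP/val_inj => /=; lia.
  have E : lat_arg (mp j p) 0 (pr j u) = 0.
    apply/rowP => i; rewrite argE !mxE mulr0 subr0.
    by case: eqP => _; rewrite ?pq ?subrr mul0r.
  rewrite /lat_term E dot0r mulr0 oppr0 expi2pi0 mulr1 /phi plateau_box1//.
  by move=> i; rewrite subrr normr0 divr_ge0// ltW.
Qed.

End LatticeSum.

(** * Test functions and compactly supported distributions *)

Section TestFunctions.
Context {R : realType} {n : nat}.
Implicit Types (y : 'rV[R]_n) (phi h : 'rV[R]_n -> R[i]).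

Lemma mem_tsupp phi y : phi y != 0 -> tsupp phi y.
Proof. by move=> phiy; exact: (@subset_closure _ [set z | phi z != 0] y phiy). Qed.

Lemma test_functionM phi h : test_function phi -> smooth h ->
  test_function (fun y => phi y * h y).
Proof.
move=> [sphi cphi] sh; split; first exact: smoothM.
apply: subclosed_compact cphi _; first exact: closed_closure.
by apply: closureS => y /=; apply: contraNneq => ->; rewrite mul0r.
Qed.

Lemma test_function0 : test_function (fun _ : 'rV[R]_n => 0).
Proof.
split; first exact: smooth_cst.
rewrite /tsupp (_ : [set _ | _] = set0) ?closure0; first exact: compact0.
by apply/seteqP; split=> y //=; rewrite eqxx.
Qed.

Lemma test_function_bounded phi : test_function phi ->
  exists2 K : R, 0 <= K & bounded_supp phi K.
Proof.
move=> [_ cphi]; have [M [_ HM]] := compact_bounded cphi.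
have M0 : M < Num.max (M + 1) 0 by rewrite lt_max ltrDl ltr01.
exists (Num.max (M + 1) 0); first by rewrite le_max lexx orbT.
move=> y i yi; apply/eqP; apply: contraTT yi => phiy; rewrite -leNgt.
have := HM _ M0 y (mem_tsupp phiy).
rewrite /= => yM; apply: le_trans yM; rewrite [leRHS]mx_normrE.
exact: (le_bigmax _ (fun ij : 'I_1 * 'I_n => `|y ij.1 ij.2|) (0, i)).
Qed.

Lemma tsupp_plateau_box y0 e : 0 < e -> tsupp (fun y => (plateau_box y0 e y)%:C) `<=`
  [set y : 'rV[R]_n | forall i, `[y0 0 i - e, y0 0 i + e]%classic (y 0 i)].
Proof.
move=> e0; set B := [set y : 'rV[R]_n | _].
have cB : compact B.
  exact: (@rV_compact R n (fun i => `[y0 0 i - e, y0 0 i + e]%classic) (fun i => @segment_compact R _ _)).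
have /closure_id -> : closed B.
  by apply: compact_closed cB; exact: norm_hausdorff.
apply: closureS => y /= py i.
change (is_true (y 0 i \in `[y0 0 i - e, y0 0 i + e])).
rewrite in_itv /= -ler_distl; apply: contraNT py.
by rewrite -ltNge => /ltW ye; rewrite (plateau_box0 (i := i)).
Qed.

Lemma test_function_plateau_box y0 e : 0 < e -> test_function (fun y => (plateau_box y0 e y)%:C).
Proof.
move=> e0; split; first exact: smooth_plateau_box.
apply: subclosed_compact (tsupp_plateau_box e0); first exact: closed_closure.
exact: (@rV_compact R n (fun i => `[y0 0 i - e, y0 0 i + e]%classic) (fun i => @segment_compact R _ _)).
Qed.

(** Shrinking the plateau by one half puts the closure of its support, and not
    only the support, inside U. *)
Lemma test_function_at y0 (U : set 'rV[R]_n) : open U -> U y0 ->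
  exists phi, [/\ test_function phi, tsupp phi `<=` U & phi y0 = 1].
Proof.
move=> oU Uy0; have [|e e0 He] := @plateau_box_small R n y0 U; first exact: open_nbhs_nbhs.
have e20 : 0 < e / 2 by rewrite divr_gt0.
exists (fun y => (plateau_box y0 (e / 2) y)%:C); split.
- exact: test_function_plateau_box.
- move=> y /(tsupp_plateau_box e20) /= yB; apply: He; rewrite plateau_box1 ?oner_eq0// => i.
  by have := yB i; rewrite in_itv /= -ler_distl.
- by rewrite plateau_box1// => i; rewrite subrr normr0 divr_ge0// ltW.
Qed.

(** The default value 0 of [cutoff] is a test function too. *)
Lemma cutoff_test (a : ('rV[R]_n -> R[i]) -> R[i]) : test_function (cutoff a).
Proof.
rewrite /cutoff; case: xgetP => [chi _ [] //|_]; exact: test_function0.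
Qed.

(** If c is not 0, the support of c delta_0 is {0}, so the cutoff is 1 at 0; if c
    is 0, both sides vanish. *)
Lemma cs_pairing_delta (a : ('rV[R]_n -> R[i]) -> R[i]) (c : R[i]) h :
  (forall phi, test_function phi -> a phi = c * phi 0) -> smooth h ->
  cs_pairing a h = c * h 0.
Proof.
move=> aE sh; rewrite /cs_pairing aE; last by apply: test_functionM => //; exact: cutoff_test.
have [->|c0] := eqVneq c 0; first by rewrite !mul0r.
suff -> : cutoff a 0 = 1 by rewrite mul1r.
have supp0 : dist_supp a 0.
  move=> [U [oU U0 Ha]]; have [phi [tphi sphi phi0]] := test_function_at oU U0.
  by have /eqP := Ha phi tphi sphi; rewrite aE// phi0 mulr1 (negbTE c0).
have supp1 y : dist_supp a y -> y = 0.
  move=> ya; apply/eqP/negP => /negP y0; apply: ya; exists (~` [set 0]); split => //.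
  - apply: closed_openC; apply: accessible_closed_set1.
    by apply: hausdorff_accessible; exact: norm_hausdorff.
  - by apply/eqP.
  - move=> phi tphi sphi; rewrite aE//; suff -> : phi 0 = 0 by rewrite mulr0.
    apply/eqP; apply/negP => /negP phi0.
    by have := sphi 0 (mem_tsupp phi0); apply.
have [_ [U [_ sU HU]]] : [set chi | test_function chi /\
    exists U, [/\ open U, dist_supp a `<=` U & forall y, U y -> chi y = 1]] (cutoff a).
  apply: xgetPex; exists (fun y => (plateau_box 0 1 y)%:C); split.
    by apply: test_function_plateau_box; exact: ltr01.
  have := plateau_box_near (0 : 'rV[R]_n) (@ltr01 R).
  have -> : (\forall y \near (0 : 'rV[R]_n), plateau_box 0 1 y = 1) = nbhs (0 : 'rV[R]_n) [set y | plateau_box 0 1 y = 1] by [].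
  rewrite nbhsE => -[U [oU U0] HU].
  by exists U; split=> // [y /supp1 -> //|y /HU ->].
exact/HU/sU.
Qed.

Lemma cint_setT phi K : 0 <= K -> ccontinuous phi -> bounded_supp phi K ->
  cint setT phi = cint `[- K, K] phi.
Proof.
move=> K0 [c1 c2] Kphi; rewrite /cint !(@iter_int_setT _ _ _ K)//.
- by move=> v i /Kphi ->.
- by move=> v i /Kphi ->.
Qed.

Lemma cint_setT_Z c phi : test_function phi ->
  cint setT (fun y => c * phi y) = c * cint setT phi.
Proof.
move=> tphi; have [K K0 Kphi] := test_function_bounded tphi.
have cphi := smooth_ccontinuous tphi.1.
have KK : - K <= K by lra.
rewrite !(cint_setT K0)//.
- by rewrite cintZ.
- by apply: ccontinuousM => //; exact: ccontinuous_cst.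
- by move=> y i /Kphi ->; rewrite mulr0.
Qed.

Lemma cint_setT_translate phi a : test_function phi ->
  cint setT (fun y => phi (y + a)) = cint setT phi.
Proof.
move=> tphi; have [K K0 Kphi] := test_function_bounded tphi.
have [c1 c2] := smooth_ccontinuous tphi.1.
rewrite /cint (iter_int_translate a K0 c1) ?(iter_int_translate a K0 c2)//.
- by move=> v i /Kphi ->.
- by move=> v i /Kphi ->.
Qed.

(** The lemma of du Bois-Reymond: the difference d is tested against its own
    conjugate times a plateau at a point where d does not vanish. *)
Lemma smooth_eq_test (h1 h2 : 'rV[R]_n -> R[i]) : smooth h1 -> smooth h2 ->
  (forall phi, test_function phi ->
    cint setT (fun y => h1 y * phi y) = cint setT (fun y => h2 y * phi y)) -> h1 = h2.
Proof.
move=> s1 s2 H; apply/funext => y0; apply/eqP; rewrite -subr_eq0.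
pose d y := h1 y + -1 * h2 y.
have sd : smooth d by apply: smoothD => //; apply: smoothM => //; exact: smooth_cst.
rewrite (_ : _ - _ = d y0); last by rewrite /d mulN1r.
apply/negPn/negP => d0.
pose p y := (plateau_box y0 1 y)%:C.
have tp : test_function p by apply: test_function_plateau_box; exact: ltr01.
have tphi : test_function (fun y => p y * conjc (d y)).
  by apply: test_functionM => //; exact: smooth_conj.
have tD h : smooth h -> test_function (fun y => h y * (p y * conjc (d y))).
  by move=> sh; rewrite (_ : (fun y => _) = (fun y => p y * conjc (d y) * h y));
    [exact: test_functionM|apply/funext => y; rewrite mulrC].
have td := tD _ sd.
have [K K0 Kphi] := test_function_bounded td.
have cd h : smooth h -> ccontinuous (fun y => h y * (p y * conjc (d y))).
  by move=> /tD [] /smooth_ccontinuous.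
have Z : cint setT (fun y => d y * (p y * conjc (d y))) = 0.
  have [K1 K10 Kp] := test_function_bounded tphi.
  have K1K1 : - K1 <= K1 by lra.
  have BK h : bounded_supp (fun y => h y * (p y * conjc (d y))) K1.
    by move=> y i /Kp ->; rewrite mulr0.
  have := H _ tphi; rewrite !(cint_setT K10)//; try exact: cd.
  move=> E; rewrite (_ : (fun y => _) = (fun y => -1 * (h2 y * (p y * conjc (d y))) + h1 y * (p y * conjc (d y)))).
    by rewrite cint_lin ?E ?mulN1r ?addNr//; exact: cd.
  by apply/funext => y; rewrite /d; ring.
have E y : d y * (p y * conjc (d y)) = (plateau_box y0 1 y * (complex.Re (d y) ^+ 2 + complex.Im (d y) ^+ 2))%:C.
  rewrite /p; case: (d y) => a b; apply/eqP; rewrite eq_complex /=.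
  by apply/andP; split; apply/eqP; ring.
have /(congr1 (@complex.Re R)) := Z.
(* A cube containing the support, with y0 in its interior. *)
pose M := K + \sum_(i < n) `|y0 0 i| + 1.
have M0 : 0 <= M by rewrite /M -addrA addr_ge0// addr_ge0//; apply: sumr_ge0.
have KM : K <= M by rewrite /M -addrA lerDl addr_ge0//; apply: sumr_ge0.
rewrite (cint_setT M0 (cd _ sd)); last by move=> y i /(le_lt_trans KM) /Kphi.
rewrite /cint /=.
have [cR _] := cd _ sd.
have H0 y : 0 <= complex.Re (d y * (p y * conjc (d y))).
  by rewrite E /= mulr_ge0 ?plateau_box_ge0// addr_ge0// sqr_ge0.
have y0M i : - M < y0 0 i < M.
  rewrite -ltr_norml /M (bigD1 i)//= -addrA -addrA addrCA ltrDl.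
  by rewrite ltr_wpDl// ltr_wpDl// sumr_ge0.
have MM : - M <= M by lra.
have := @iter_int_gt0 _ _ _ MM _ _ y0 cR H0 y0M; rewrite E /=.
rewrite plateau_box1 ?mul1r ?ltr01//; last by move=> i; rewrite subrr normr0; lra.
have pos : 0 < complex.Re (d y0) ^+ 2 + complex.Im (d y0) ^+ 2.
  rewrite lt_def addr_ge0 ?sqr_ge0// andbT; apply: contra d0.
  by rewrite paddr_eq0 ?sqr_ge0// !sqrf_eq0 eq_complex /=.
by move=> /(_ pos) /gt_eqF /negP nz /eqP.
Qed.

End TestFunctions.

(** * The Toeplitz operators of the exponentials *)

Section Toeplitz.
Context {R : realType} {n k : nat}.
Hypothesis k_gt0 : (0 < k)%N.
Implicit Types (y : 'rV[R]_n) (phi h : 'rV[R]_n -> R[i]) (m : @Zk n k) (t : section R n k).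

Let sig : R := 2 `^ (n%:R / 4) * k%:R `^ (n%:R / 2).
Let delta_scale : R := (2 * k%:R) `^ (- (n%:R / 2)).
Let cst_scale : R := 2 `^ (- (n%:R / 2)).

(** The constant for which [sigma m] sends t to sigma_mass * conj((t)_m(0)). *)
Definition sigma_mass : R := sig * delta_scale.

Lemma sigma_mass_gt0 : 0 < sigma_mass.
Proof.
rewrite /sigma_mass.
have kR : 0 < k%:R :> R by rewrite ltr0n.
by rewrite !mulr_gt0// powR_gt0// mulr_gt0.
Qed.

(** The half-form pairing is the factor that makes the two bases dual. *)
Lemma half_form_scale :
  half_form_pairing R n k * (sigma_mass%:C * (sig * cst_scale)%:C) = 1.
Proof.
have kR : 0 < k%:R :> R by rewrite ltr0n.
have two0 : 0 < 2%:R :> R by [].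
rewrite /half_form_pairing -!rmorphM /sigma_mass /sig /delta_scale /cst_scale /=.
rewrite powRM ?ltW// !powRN.
set A := 2 `^ (n%:R / 4); set B := k%:R `^ _; set C := 2 `^ (n%:R / 2).
have A0 : A != 0 by rewrite gt_eqF// powR_gt0.
have B0 : B != 0 by rewrite gt_eqF// powR_gt0.
have CE : C = A * A.
  rewrite /A -powRD; last by rewrite pnatr_eq0 implybT.
  by congr (_ `^ _); field.
by rewrite CE -[RHS](rmorph1 (real_complex R)); congr (_%:C); field; rewrite A0 B0.
Qed.

(** [weil_brezin_inv] chooses a section with given coefficients; the lattice sum
    shows that there is one. *)
Lemma weil_brezin_conj_test (phi : 'rV[R]_n -> R[i]) m : test_function phi ->
  weil_brezin (weil_brezin_inv (fun m' y => (m' == m)%:R * conjc (phi y)) : section R n k) =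
  fun m' y => (m' == m)%:R * conjc (phi y).
Proof.
move=> tphi; have [K K0 Kphi] := test_function_bounded tphi.
have Kc : bounded_supp (fun y => conjc (phi y)) K by move=> y i /Kphi ->; exact: conjc0.
pose w (m' : @Zk n k) y := (m' == m)%:R * conjc (phi y) : R[i].
apply: (@xgetPex _ (0 : section R n k) [set t : section R n k | weil_brezin t = w]).
exists (lat_section k_gt0 m (smooth_conj tphi.1) Kc); apply/funext => m'; apply/funext => y.
exact: weil_brezin_lat.
Qed.

Lemma sigmaE m t : sigma m t = sigma_mass%:C * conjc (weil_brezin t m 0).
Proof.
rewrite /sigma /theta /of_coefs fctE /GRing.scale /= (bigD1 m)//= big1 ?addr0.
  by rewrite eqxx mul1r mulrA -rmorphM.
by move=> m' mm; rewrite eq_sym (negbTE mm) !mul0r.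
Qed.

Definition delta_sum (c : @Zk n k -> R[i]) : functional R n k :=
  \sum_(m : @Zk n k) c m *: sigma m.

Lemma delta_sumE c t : delta_sum c t =
  sigma_mass%:C * \sum_(m : @Zk n k) c m * conjc (weil_brezin t m 0).
Proof.
rewrite /delta_sum fct_sumE mulr_sumr; apply: eq_bigr => m _.
by rewrite fctE sigmaE /GRing.scale /= mulrCA.
Qed.

Lemma coef_delta_sum c m phi : test_function phi ->
  coef (delta_sum c) m phi = c m * sigma_mass%:C * phi 0.
Proof.
move=> tphi; rewrite /coef delta_sumE weil_brezin_conj_test// (bigD1 m)//= big1 ?addr0.
  by rewrite eqxx mul1r conjcK mulrCA mulrA.
by move=> m' /negbTE ->; rewrite mul0r conjc0 mulr0.
Qed.

(** A smooth function that represents a coefficient is the one chosen by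
    [smooth_coef], by uniqueness. *)
Lemma smooth_coefE (s : functional R n k) m h : smooth h ->
  (forall phi, test_function phi -> coef s m phi = cint setT (fun y => h y * phi y)) ->
  smooth_coef s m = h.
Proof.
move=> sh H; apply: xget_subset1 => // h1 h2 [s1 H1] [s2 H2].
by apply: smooth_eq_test => // phi tphi; rewrite -H1// H2.
Qed.

Lemma mul_dist_conjX (f : smoothX R n) (s : functional R n k) t :
  mul_dist (conjX f) s t = s (mul_section f t).
Proof.
congr s; apply: val_inj; apply/funext => u /=.
by congr (_ * _); exact: conjcK.
Qed.

Lemma sigmavE m t : sigmav m t =
  sig%:C * cint setT (fun y => cst_scale%:C * conjc (weil_brezin t m y)).
Proof.
rewrite /sigmav /thetav /of_coefs fctE /GRing.scale /= (bigD1 m)//= big1 ?addr0.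
  congr (_ * _); apply: eq_cint => y _; rewrite eqxx mul1r //.
move=> m' mm; rewrite -[RHS](cint0 setT n); apply: eq_cint => y _.
by rewrite eq_sym (negbTE mm) !mul0r.
Qed.

Lemma smooth_phase i m : smooth (fun y => expi2pi (- wb_arg m y 0 i) : R[i]).
Proof.
apply: smooth_cis => p; apply: CkM; first exact: Ck_cst.
apply: CkN; apply: Ck_ext (CkD (Ck_coord p i) (Ck_cst p ((k%:R^-1 *: @repr_Zk R n k m) 0 i))) => y.
by rewrite /wb_arg [in RHS]mxE.
Qed.

Lemma smooth_coef_f i m m' : smooth_coef (mul_dist (conjX (f_ i)) (sigmav m)) m' =
  fun y => (m == m')%:R * (sig * cst_scale)%:C * expi2pi (- wb_arg m y 0 i).
Proof.
have sh : smooth (fun y => (m == m')%:R * (sig * cst_scale)%:C * expi2pi (- wb_arg m y 0 i) : R[i]).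
  apply: smoothM; first exact: smooth_cst.
  exact: smooth_phase.
apply: smooth_coefE => // phi tphi; rewrite /coef mul_dist_conjX sigmavE.
set a := cst_scale%:C * ((m == m')%:R : R[i]).
have tD : test_function (fun y => phi y * (a * expi2pi (- wb_arg m y 0 i))).
  apply: test_functionM => //; apply: smoothM; first exact: smooth_cst.
  exact: smooth_phase.
transitivity (sig%:C * cint setT (fun y => phi y * (a * expi2pi (- wb_arg m y 0 i)))).
  congr (_ * _); apply: eq_cint => y _; rewrite weil_brezin_f// weil_brezin_conj_test//.
  by rewrite !conjcM conjc_nat conjcK expi2pi_conj /a; ring.
rewrite -cint_setT_Z//; apply: eq_cint => y _; rewrite /a (rmorphM (real_complex R) sig cst_scale) /=; ring.
Qed.

Lemma smooth_coef_g i m m' : smooth_coef (mul_dist (conjX (g_ i)) (sigmav m)) m' =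
  fun y => (pred_Zk i m == m')%:R * (sig * cst_scale)%:C.
Proof.
apply: smooth_coefE; first exact: smooth_cst.
move=> phi tphi; rewrite /coef mul_dist_conjX sigmavE.
set a := cst_scale%:C * ((pred_Zk i m == m')%:R : R[i]).
have ta : test_function (fun y => phi y * a).
  by apply: test_functionM => //; exact: smooth_cst.
transitivity (sig%:C * cint setT (fun y => phi (y + k%:R^-1 *: evec i) * a)).
  congr (_ * _); apply: eq_cint => y _; rewrite weil_brezin_g// weil_brezin_conj_test//.
  by rewrite conjcM conjc_nat conjcK mulrA mulrC.
rewrite (cint_setT_translate (k%:R^-1 *: evec i) ta) -cint_setT_Z//.
by apply: eq_cint => y _; rewrite /a (rmorphM (real_complex R) sig cst_scale) /=; ring.
Qed.

(** Only the coefficient of index m1 contributes, with the value at 0 of the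
    smooth function on the other side. *)
Lemma pairing_mul_delta_sum (f : smoothX R n) c m (h : @Zk n k -> 'rV[R]_n -> R[i]) (m1 : @Zk n k) :
  (forall m', smooth_coef (mul_dist (conjX f) (sigmav m)) m' = fun y => (m1 == m')%:R * h m1 y) ->
  smooth (h m1) ->
  pairing_mul f (delta_sum c) (sigmav m) = c m1 * sigma_mass%:C * conjc (h m1 0).
Proof.
move=> hE sh; rewrite /pairing_mul /pairing.
have E m' : cs_pairing (coef (delta_sum c) m') (fun y => conjc (smooth_coef (mul_dist (conjX f) (sigmav m)) m' y)) =
  c m' * sigma_mass%:C * ((m1 == m')%:R * conjc (h m1 0)).
  rewrite (@cs_pairing_delta _ _ _ (c m' * sigma_mass%:C)).
  - by rewrite hE conjcM conjc_nat.
  - by move=> phi tphi; rewrite coef_delta_sum.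
  - by rewrite hE; apply: smooth_conj; apply: smoothM => //; exact: smooth_cst.
transitivity (\sum_(m' : @Zk n k) c m' * sigma_mass%:C * ((m1 == m')%:R * conjc (h m1 0))).
  by apply: eq_bigr => m' _; exact: E.
rewrite (bigD1 m1)//= eqxx mul1r big1 ?addr0// => m' mm.
by rewrite eq_sym (negbTE mm) mul0r mulr0.
Qed.

(** sigma m sits at the point y = m / k, where e(y^i) takes the value e(m_i / k). *)
Lemma toeplitz_f i c : toeplitz (f_ i) (delta_sum c) =
  delta_sum (fun m => expi2pi ((m i)%:R / k%:R) * c m).
Proof.
apply: eq_bigr => m _; congr (_ *: _).
pose h (m : @Zk n k) y := (sig * cst_scale)%:C * expi2pi (- wb_arg m y 0 i) : R[i].
rewrite (@pairing_mul_delta_sum _ _ _ h m); first last.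
- apply: smoothM; first exact: smooth_cst.
  exact: smooth_phase.
- by move=> m'; rewrite smooth_coef_f; apply/funext => y; rewrite /h mulrA.
rewrite /h conjcM conjc_real expi2pi_conj opprK.
have -> : wb_arg m (0 : 'rV[R]_n) 0 i = (m i)%:R / k%:R by rewrite /wb_arg !mxE add0r mulrC.
transitivity (half_form_pairing R n k * (sigma_mass%:C * (sig * cst_scale)%:C) * (expi2pi ((m i)%:R / k%:R) * c m)).
  by ring.
by rewrite half_form_scale mul1r.
Qed.

(** The representing function is constant, so only the index moves. *)
Lemma toeplitz_g i c : toeplitz (g_ i) (delta_sum c) =
  delta_sum (fun m => c (pred_Zk i m)).
Proof.
apply: eq_bigr => m _; congr (_ *: _).
pose h (m : @Zk n k) (y : 'rV[R]_n) := (sig * cst_scale)%:C : R[i].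
rewrite (@pairing_mul_delta_sum _ _ _ h (pred_Zk i m)); first last.
- exact: smooth_cst.
- by move=> m'; rewrite smooth_coef_g.
rewrite /h conjc_real.
transitivity (half_form_pairing R n k * (sigma_mass%:C * (sig * cst_scale)%:C) * c (pred_Zk i m)).
  by ring.
by rewrite half_form_scale mul1r.
Qed.

End Toeplitz.

Arguments sigma_mass : clear implicits.

(** * The quantum Hilbert space *)

Section Hilbert.
Context {R : realType} {n k : nat}.
Hypothesis k_gt0 : (0 < k)%N.
Implicit Types (m : @Zk n k) (t : section R n k) (c : @Zk n k -> R[i]) (s : hilb R n k).

(** Continuity of sigma^m for the C^oo topology, of order 0: the section is
    sampled at y = m / k, inside the unit cube, with factors of modulus 1. *)
Lemma weil_brezin0_norm t m (B : R) :
  (forall u : 'rV[R]_(n + n), (forall i, 0 <= u 0 i <= 1) -> `|t u| <= B%:C) ->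
  `|weil_brezin t m 0| <= (2 * B)%:C.
Proof.
move=> HB; have [sw _] := wform_section t.
rewrite (weil_brezin0 k_gt0); apply: cint_norm.
  exact/smooth_ccontinuous/smooth_row_mx.
move=> x x01; rewrite /wform normrM norm_cis mul1r; apply: HB => a.
case: (split_ordP a) => i ->; first by rewrite row_mxEl.
rewrite row_mxEr !mxE mulr_ge0 ?invr_ge0//=.
by rewrite mulrC ler_pdivrMr ?ltr0n// mul1r ler_nat ltnW.
Qed.

Lemma antilinear_sigma m : antilinear (sigma m : functional R n k).
Proof.
move=> a t1 t2; rewrite !sigmaE (weil_brezin_lin k_gt0) conjcD mulrDr; congr (_ + _).
by rewrite conjcM mulrCA.
Qed.

Lemma sigma_hilb m : (sigma m : functional R n k) \in @hilb_pred R n k.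
Proof.
apply/asboolP; split; first split.
- exact: antilinear_sigma.
- exists (sigma_mass R n k * 2), 0%N => t B HB.
  rewrite sigmaE normrM -mulrA [leRHS](rmorphM (real_complex R)).
  apply: ler_pM; rewrite ?normr_ge0//.
    by rewrite normc_def /= expr0n /= addr0 sqrtr_sqr ger0_norm// ltW// sigma_mass_gt0.
  by rewrite normcJ; apply: weil_brezin0_norm => u u01; exact: (HB [::]).
- move=> xi; rewrite /nabla_bar big1// => j _; apply/funext => t.
  by rewrite /mul_dist /nabla_dist sigmaE (weil_brezin_nabla k_gt0) conjc0 mulr0 oppr0.
Qed.

Lemma delta_sum_hilb c : delta_sum c \in @hilb_pred R n k.
Proof. by apply: rpred_sum => m _; apply: rpredZ; exact: sigma_hilb. Qed.

Lemma toeplitz_hilb (f : smoothX R n) (s : functional R n k) :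
  toeplitz f s \in @hilb_pred R n k.
Proof. by apply: rpred_sum => m _; apply: rpredZ; exact: sigma_hilb. Qed.

Lemma hilb_antilinear s : antilinear s.
Proof. by have /asboolP[[]] := hilb_in s. Qed.

(** The vector field with j-th component 1 and other components 0 isolates one
    covariant derivative. *)
Lemma hilb_killed s : killed_by_nabla s.
Proof.
move=> j t; have al := hilb_antilinear s.
(* The vector field is d/dx^j. *)
pose e : smoothX R n := @SmoothX R n (fun=> 1) (smooth_cst 1) (fun _ _ => erefl).
pose z : smoothX R n := @SmoothX R n (fun=> 0) (smooth_cst 0) (fun _ _ => erefl).
have /asboolP[_ /(_ (fun i => if i == j then e else z))] := hilb_in s.
move=> /(congr1 (fun F => F t)); rewrite /nabla_bar fct_sumE (bigD1 j)//= big1 ?addr0.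
  rewrite eqxx /mul_dist /nabla_dist => /eqP; rewrite oppr_eq0 => /eqP <-.
  congr (hilb_val s (nabla_section _ _)); apply: val_inj; apply/funext => u.
  by change (t u = conjc (conjc 1) * t u :> R[i]); rewrite conjcK mul1r.
move=> i ij; rewrite (negbTE ij) /mul_dist /nabla_dist.
rewrite (_ : nabla_section _ _ = 0) ?antilinear0 ?oppr0//.
have -> : mul_section (conjX (conjX z)) t = 0.
  by apply: val_inj; apply/funext => u; change (conjc (conjc 0) * t u = 0 :> R[i]); rewrite conjcK mul0r.
apply: val_inj; apply/funext => u /=; rewrite mulr0 subr0.
have /(congr1 (fun F => F u)) := pdiff_cst (lshift n i) (0 : R[i]).
by apply.
Qed.

Definition delta_hilb c : hilb R n k := Hilb (delta_sum_hilb c).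

(** The coordinates of s are, up to the factor sigma_mass, its values on the
    sections dual to the functionals sending t to conj((t)_m(0)). *)
Lemma hilb_delta_sum s : exists c, s = delta_hilb c.
Proof.
have [b Hb] := @local_basis_exists R n k k_gt0.
have mass0 : (sigma_mass R n k)%:C != 0 :> R[i].
  by rewrite eq_complex /= eqxx andbT gt_eqF// sigma_mass_gt0.
exists (fun m => (sigma_mass R n k)%:C^-1 * hilb_val s (basis_section Hb m)).
apply: val_inj; apply/funext => t /=.
rewrite (killed_by_nablaE k_gt0 Hb t (hilb_antilinear s) (@hilb_killed s)) delta_sumE mulr_sumr.
apply: eq_bigr => m _; rewrite mulrA mulrA divff// mul1r mulrC //.
Qed.

End Hilbert.

(** * Representations of the quantum torus *)

Section QuantumTorusRepresentation.
Context {F : fieldType} {N : nat} (q : 'M[F]_N) (V : lmodType F).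
Variables G GV : 'I_N -> V -> V.
Hypotheses (G_linear : forall i, linear (G i)) (GV_linear : forall i, linear (GV i)).
Hypotheses (GVK : forall i, cancel (G i) (GV i)) (GK : forall i, cancel (GV i) (G i)).
Hypothesis GC : forall i j v, G i (G j v) = q i j *: G j (G i v).

Fixpoint qeval (x : @qterm F N) : V -> V :=
  match x with
  | QCst a => fun v => a *: v
  | QGen i => G i
  | QInv i => GV i
  | QAdd x y => fun v => qeval x v + qeval y v
  | QMul x y => fun v => qeval x (qeval y v)
  end.

Lemma qeval_linear x : linear (qeval x).
Proof.
elim: x => [b|i|i|x Hx y Hy|x Hx y Hy] a u v //=.
- by rewrite scalerDr !scalerA mulrC.
- exact: G_linear.
- exact: GV_linear.
- by rewrite Hx Hy scalerDr addrACA.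
- by rewrite Hy Hx.
Qed.

Lemma qevalD x u v : qeval x (u + v) = qeval x u + qeval x v.
Proof. by have := qeval_linear x 1 u v; rewrite !scale1r. Qed.

Lemma qeval0 x : qeval x 0 = 0.
Proof. by apply: (addrI (qeval x 0)); rewrite -qevalD !addr0. Qed.

Lemma qevalZ x a v : qeval x (a *: v) = a *: qeval x v.
Proof. by have := qeval_linear x a v 0; rewrite qeval0 !addr0. Qed.

(** Every generating rule of the congruence is a property of linear operators,
    except the last three, which are the hypotheses on G and GV. *)
Lemma qeval_cong x y : qcong q x y -> qeval x =1 qeval y.
Proof.
elim=> {x y} /=.
- by [].
- by move=> x y _ H v; rewrite H.
- by move=> y x z _ H1 _ H2 v; rewrite H1 H2.
- by move=> x x' y y' _ H1 _ H2 v; rewrite H1 H2.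
- by move=> x x' y y' _ H1 _ H2 v; rewrite H2 H1.
- by move=> x y z v; rewrite addrA.
- by move=> x y v; rewrite addrC.
- by move=> x v; rewrite scale0r add0r.
- by move=> x v; rewrite scaleN1r addNr scale0r.
- by [].
- by move=> x v; rewrite scale1r.
- by move=> x v; rewrite scale1r.
- by [].
- by move=> x y z v; rewrite qevalD.
- by move=> a b v; rewrite scalerDl.
- by move=> a b v; rewrite scalerA.
- by move=> a x v; rewrite qevalZ.
- by move=> i v; rewrite scale1r GK.
- by move=> i v; rewrite scale1r GVK.
- by move=> i j v; rewrite GC.
Qed.

Definition qrep (x : qtorus q) : V -> V := qeval (repr x).

Lemma qrep_class x v : qrep (qclass q x) v = qeval x v.
Proof. exact/qeval_cong/repr_qclass. Qed.

Lemma representation_qrep : representation qrep.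
Proof.
split=> [x|x y v|a x v|v|x y v].
- exact: qeval_linear.
- by rewrite -(qreprK x) -(qreprK y) qclassD !qrep_class.
- by rewrite -(qreprK x) qclassZ !qrep_class.
- by rewrite qrep_class /= scale1r.
- by rewrite -(qreprK x) -(qreprK y) qclassM !qrep_class.
Qed.

End QuantumTorusRepresentation.

Lemma linear_iter (F : fieldType) (V : lmodType F) (f : V -> V) d :
  linear f -> linear (iter d f).
Proof. by move=> lf; elim: d => [|d IH] a u v //=; rewrite IH lf. Qed.

(** * Clock and shift operators *)

Section ClockShift.
Context {R : realType} {n k : nat}.
Hypothesis k_gt0 : (0 < k)%N.
Implicit Types (m : @Zk n k) (c : @Zk n k -> R[i]) (s : hilb R n k).
Notation lx := (lshift n).
Notation ry := (rshift n).

Let k0 : k%:R != 0 :> R.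
Proof. by rewrite pnatr_eq0 -lt0n. Qed.

Definition clock i c : @Zk n k -> R[i] := fun m => expi2pi ((m i)%:R / k%:R) * c m.
Definition cyc_shift i c : @Zk n k -> R[i] := fun m => c (pred_Zk i m).

Lemma clockC i j c : clock i (clock j c) = clock j (clock i c).
Proof. by apply/funext => m; rewrite /clock mulrCA. Qed.

Lemma shiftC i j c : cyc_shift i (cyc_shift j c) = cyc_shift j (cyc_shift i c).
Proof.
apply/funext => m; congr c; apply/ffunP => a; rewrite !ffunE.
by case: (a == i); case: (a == j).
Qed.

(** The index of cyc_shift j c at m is m_j - 1 modulo k, and e is 1 on integers. *)
Lemma clock_shift i j c : clock i (cyc_shift j c) =
  fun m => expi2pi (k%:R^-1 * (i == j)%:R) * cyc_shift j (clock i c) m.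
Proof.
apply/funext => m; rewrite /clock /cyc_shift mulrA -expi2piD; congr (_ * _).
rewrite ffunE; have [->|ij] := eqVneq i j; last by rewrite mulr0 add0r.
have [z ->] := ord_predE (R := R) (m j).
rewrite -[LHS](expi2piD_int _ z); congr expi2pi.
by rewrite mulr1 /=; field.
Qed.

Lemma iter_clock i d c m : iter d (clock i) c m = expi2pi (d%:R * ((m i)%:R / k%:R)) * c m.
Proof.
elim: d => [|d IH]; first by rewrite mul0r expi2pi0 mul1r.
by rewrite iterS {1}/clock IH mulrA -expi2piD -natr1 mulrDl mul1r [_ + (_ * _)]addrC.
Qed.

Lemma iter_clock_k i c : iter k (clock i) c = c.
Proof.
apply/funext => m; rewrite iter_clock (_ : k%:R * _ = (m i)%:R); last by field.
by rewrite expi2pi_nat mul1r.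
Qed.

Lemma iter_ordS d (p : 'I_k) : (iter d (@ordS k) p = (p + d) %% k :> nat)%N.
Proof.
elim: d => [|d IH]; first by rewrite addn0 modn_small.
by rewrite iterS /= IH -addn1 modnDml -addnA addn1.
Qed.

Lemma iter_ord_pred (p : 'I_k) : iter k (@ord_pred k) p = p.
Proof.
have H : iter k (@ordS k) p = p by apply: val_inj; rewrite /= iter_ordS modnDr modn_small.
have K d : cancel (iter d (@ordS k)) (iter d (@ord_pred k)).
  by elim: d => // d IH x; rewrite iterSr iterS ordSK IH.
by rewrite -{1}H K.
Qed.

Lemma iter_shift_k i c : iter k (cyc_shift i) c = c.
Proof.
have H d m : iter d (cyc_shift i) c m = c (iter d (pred_Zk i) m).
  by elim: d m => // d IH m; rewrite iterS /cyc_shift IH -iterSr.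
apply/funext => m; rewrite H; congr c.
have E d : iter d (pred_Zk i) m = [ffun j => if j == i then iter d (@ord_pred k) (m j) else m j].
  elim: d => [|d IH]; first by apply/ffunP => j; rewrite ffunE if_same.
  by rewrite iterS IH; apply/ffunP => j; rewrite !ffunE; case: (j == i).
by rewrite E; apply/ffunP => j; rewrite ffunE iter_ord_pred if_same.
Qed.

Definition toeplitz_op (f : smoothX R n) s : hilb R n k := Hilb (toeplitz_hilb k_gt0 f s).

Definition generator (a : 'I_(n + n)) : hilb R n k -> hilb R n k :=
  match fintype.split a with inl i => toeplitz_op (f_ i) | inr i => toeplitz_op (g_ i) end.

Definition generator_coef (a : 'I_(n + n)) (c : @Zk n k -> R[i]) : @Zk n k -> R[i] :=
  match fintype.split a with inl i => clock i c | inr i => cyc_shift i c end.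

Lemma generator_delta a c : generator a (delta_hilb k_gt0 c) = delta_hilb k_gt0 (generator_coef a c).
Proof.
apply: val_inj; rewrite /generator /generator_coef; case: (fintype.split a) => i /=.
  exact: toeplitz_f.
exact: toeplitz_g.
Qed.

Lemma delta_hilbZ a c : a *: delta_hilb k_gt0 c = delta_hilb k_gt0 (fun m => a * c m).
Proof.
apply: val_inj => /=; rewrite /delta_sum scaler_sumr; apply: eq_bigr => m _.
by apply/funext => t; rewrite !fctE /GRing.scale /= mulrA.
Qed.

Lemma delta_hilb_linear a c1 c2 : delta_hilb k_gt0 (fun m => a * c1 m + c2 m) =
  a *: delta_hilb k_gt0 c1 + delta_hilb k_gt0 c2.
Proof.
apply: val_inj => /=; rewrite /delta_sum scaler_sumr -big_split; apply: eq_bigr => m _ /=.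
by apply/funext => t; rewrite !fctE /GRing.scale /= mulrDl mulrA.
Qed.

Lemma generator_coef_linear a b c1 c2 : generator_coef a (fun m => b * c1 m + c2 m) =
  fun m => b * generator_coef a c1 m + generator_coef a c2 m.
Proof.
apply/funext => m; rewrite /generator_coef; case: (fintype.split a) => i //=.
by rewrite /clock mulrDr mulrCA.
Qed.

Lemma generator_linear a : linear (generator a).
Proof.
move=> b s1 s2; have [c1 ->] := hilb_delta_sum k_gt0 s1; have [c2 ->] := hilb_delta_sum k_gt0 s2.
by rewrite -delta_hilb_linear !generator_delta generator_coef_linear delta_hilb_linear.
Qed.

(** e(k m_i / k) = 1, and the k-th power of a cyclic permutation of k elements is
    trivial; this provides the inverses of the generators. *)
Lemma generator_order a s : iter k (generator a) s = s.
Proof.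
have [c ->] := hilb_delta_sum k_gt0 s.
have H d : iter d (generator a) (delta_hilb k_gt0 c) = delta_hilb k_gt0 (iter d (generator_coef a) c).
  by elim: d => // d IH; rewrite !iterS IH generator_delta.
rewrite H; congr delta_hilb; rewrite /generator_coef; case: (fintype.split a) => i.
  exact: iter_clock_k.
exact: iter_shift_k.
Qed.

Lemma generator_lx i s : hilb_val (generator (lx i) s) = U_ i (hilb_val s).
Proof. by rewrite /generator (unsplitK (inl i)). Qed.

Lemma generator_ry i s : hilb_val (generator (ry i) s) = V_ i (hilb_val s).
Proof. by rewrite /generator (unsplitK (inr i)). Qed.

Lemma generator_coef_lx i : generator_coef (lx i) = clock i.
Proof. by apply/funext => c; rewrite /generator_coef (unsplitK (inl i)). Qed.

Lemma generator_coef_ry i : generator_coef (ry i) = cyc_shift i.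
Proof. by apply/funext => c; rewrite /generator_coef (unsplitK (inr i)). Qed.

Lemma expi2pi_delta_conv (a b : 'I_n) :
  expi2pi (k%:R^-1 * (a + n == n + b)%N%:R) = expi2pi (k%:R^-1 * (a == b)%:R) :> R[i].
Proof. by rewrite addnC eqn_add2l. Qed.

Lemma expi2pi_delta_far (a b : nat) : (b < a)%N ->
  expi2pi (k%:R^-1 * (a == b)%N%:R) = 1 :> R[i].
Proof. by move=> /gtn_eqF ->; rewrite mulr0 expi2pi0. Qed.

Lemma qmatrix_lx i j : @qmatrix R n k (lx i) (lx j) = 1.
Proof.
by rewrite mxE /= !expi2pi_delta_far ?invr1 ?if_same// (leq_trans (ltn_ord _) (leq_addl _ _)).
Qed.

Lemma qmatrix_ry i j : @qmatrix R n k (ry i) (ry j) = 1.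
Proof.
by rewrite mxE /= !expi2pi_delta_far ?invr1 ?if_same// -addnA ltn_add2l (leq_trans (ltn_ord _) (leq_addl _ _)).
Qed.

Lemma qmatrix_lx_ry i j : @qmatrix R n k (lx i) (ry j) = expi2pi (k%:R^-1 * (i == j)%:R).
Proof.
by rewrite mxE /= (leq_trans (ltnW (ltn_ord i)) (leq_addr _ _)) expi2pi_delta_conv.
Qed.

Lemma qmatrix_ry_lx i j : @qmatrix R n k (ry i) (lx j) = (expi2pi (k%:R^-1 * (i == j)%:R))^-1.
Proof.
rewrite mxE /= leqNgt (leq_trans (ltn_ord j) (leq_addr _ _)) /=.
by rewrite expi2pi_delta_conv eq_sym.
Qed.

Lemma expi2pi_neq0 (x : R) : expi2pi x != 0 :> R[i].
Proof. by rewrite -normr_eq0 norm_cis oner_eq0. Qed.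

Lemma qtorus_matrix_qmatrix : (0 < n)%N -> qtorus_matrix (@qmatrix R n k).
Proof.
move=> n_gt0; split=> [a|a b]; case: (split_ordP a) => i ->.
- exact: qmatrix_lx.
- exact: qmatrix_ry.
- case: (split_ordP b) => j -> ab; first by rewrite !qmatrix_lx mulr1.
  by rewrite qmatrix_lx_ry qmatrix_ry_lx eq_sym divff ?expi2pi_neq0.
- case: (split_ordP b) => j -> ab; last by rewrite !qmatrix_ry mulr1.
  by rewrite qmatrix_lx_ry qmatrix_ry_lx eq_sym mulVf ?expi2pi_neq0.
Qed.

Lemma generatorC a b s : generator a (generator b s) =
  @qmatrix R n k a b *: generator b (generator a s).
Proof.
have [c ->] := hilb_delta_sum k_gt0 s; rewrite !generator_delta.
rewrite delta_hilbZ; congr delta_hilb; apply/funext => m.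
case: (split_ordP a) => i ->; case: (split_ordP b) => j ->.
- by rewrite !generator_coef_lx qmatrix_lx mul1r clockC.
- by rewrite generator_coef_lx generator_coef_ry qmatrix_lx_ry clock_shift.
- rewrite generator_coef_lx generator_coef_ry qmatrix_ry_lx clock_shift mulrA.
  by rewrite eq_sym mulVf ?mul1r ?expi2pi_neq0.
- by rewrite !generator_coef_ry qmatrix_ry mul1r shiftC.
Qed.

End ClockShift.

(** * The commutation relations *)

Theorem corollaryB2 (R : realType) (n k : nat) (n_gt0 : (0 < n)%N)
    (k_gt0 : (0 < k)%N) :
  [/\ (forall (i j : 'I_n) (s : hilb R n k), U_ i (U_ j s) = U_ j (U_ i s)),
      (forall (i j : 'I_n) (s : hilb R n k), V_ i (V_ j s) = V_ j (V_ i s)),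
      (forall (i j : 'I_n) (s : hilb R n k),
         U_ i (V_ j s) =
         expi2pi (k%:R^-1 * (i == j)%:R) *: V_ j (U_ i s)) &
      qtorus_matrix (@qmatrix R n k) /\
      exists rho : qtorus (@qmatrix R n k) -> hilb R n k -> hilb R n k,
        [/\ representation rho,
            (forall (i : 'I_n) (s : hilb R n k),
               rho (qgen _ (lshift n i)) s = U_ i s :> functional R n k) &
            (forall (i : 'I_n) (s : hilb R n k),
               rho (qgen _ (rshift n i)) s = V_ i s :> functional R n k)]].
Proof.
pose G := @generator R n k k_gt0; pose GV a := iter k.-1 (G a).
split.
- by move=> i j s; rewrite -!(generator_lx k_gt0) generatorC qmatrix_lx scale1r.
- by move=> i j s; rewrite -!(generator_ry k_gt0) generatorC qmatrix_ry scale1r.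
- by move=> i j s; rewrite -!(generator_lx k_gt0, generator_ry k_gt0) generatorC qmatrix_lx_ry.
split; first exact: qtorus_matrix_qmatrix.
have G_lin a : linear (G a) := generator_linear k_gt0 a.
have GV_lin a : linear (GV a) := linear_iter _ (G_lin a).
(* G a has order dividing k. *)
have GVK a : cancel (G a) (GV a).
  by move=> s; rewrite /GV -iterSr prednK//; exact: generator_order.
have GK a : cancel (GV a) (G a).
  by move=> s; rewrite /GV -iterS prednK//; exact: generator_order.
have GC a b s : G a (G b s) = @qmatrix R n k a b *: G b (G a s) := generatorC k_gt0 a b s.
exists (@qrep _ _ (@qmatrix R n k) _ G GV); split.
- exact: representation_qrep.
- by move=> i s; rewrite qrep_class//; exact: generator_lx.
- by move=> i s; rewrite qrep_class//; exact: generator_ry.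
Qed.
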